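(* Let $m\ge 1$, let $\mathcal B$ be a complex Banach space and let $P_1,\dots,P_m:\mathcal B\to\mathcal B$ be densely defined closed (possibly unbounded, not necessarily commuting) operators such that each $P_j$ has real spectrum and has a resolvent of locally temperate growth near $\mathbb R$. For $f\in C_0^\infty(\mathbb R^m)$ and a special almost holomorphic extension $\tilde f$ of $f$, put $$I(\tilde f)=\Big(-\frac1\pi\Big)^m\int\cdots\int \big(\partial_{\bar z_1}\cdots\partial_{\bar z_m}\tilde f\big)(z_1,\dots,z_m)\,(z_1-P_1)^{-1}\cdots(z_m-P_m)^{-1}\,L(dz_1)\cdots L(dz_m).$$ Then the integral converges in $\mathcal L(\mathcal B)$ (operator norm), the operator $I(\tilde f)$ depends only on $f$ and not on the choice of the special almost holomorphic extension $\tilde f$, and, writing $f(P_1,\dots,P_m):=I(\tilde f)$, for every compact $K\subset\mathbb R^m$ there are constants $C_K,N_K\ge 0$ such that $$\|f(P_1,\dots,P_m)\|\le C_K\sum_{|\alpha|\le N_K}\sup_K|\partial^\alpha f|$$ for every $f\in C_0^\infty(\mathbb R^m)$ with $\operatorname{supp} f\subset K$. In particular $f\mapsto f(P_1,\dots,P_m)$ is an $\mathcal L(\mathcal B)$-valued distribution on $\mathbb R^m$.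
   Context: $\mathcal L(\mathcal B)$ is the space of bounded operators on $\mathcal B$; $L(dz)$ is Lebesgue measure on $\mathbb C\simeq\mathbb R^2$; $\partial_{\bar z}=\frac12(\partial_{\Re z}+i\partial_{\Im z})$. $C_0^\infty$ denotes smooth compactly supported complex-valued functions. ''Resolvent of locally temperate growth near $\mathbb R$'' means: for every compact $K\subset\mathbb C$ there are $C_{K,j},N_{K,j}\ge0$ such that $\|(z-P_j)^{-1}\|\le C_{K,j}|\Im z|^{-N_{K,j}}$ for $z\in K\setminus\mathbb R$. A special almost holomorphic extension of $f\in C_0^\infty(\mathbb R^m)$ is a function $\tilde f\in C_0^\infty(\mathbb C^m)$ with $\tilde f|_{\mathbb R^m}=f$ and $\partial_{\bar z_j}\tilde f=\mathcal O(|\Im z_j|^\infty)$ for each $1\le j\le m$, i.e. for every $N$ there is $C_N$ with $|\partial_{\bar z_j}\tilde f(z)|\le C_N|\Im z_j|^N$ for all $z$. (Every $f\in C_0^\infty(\mathbb R^m)$ has such an extension.) *)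

(* Defs.v *)
From HB Require Import structures.
From mathcomp Require Import all_boot all_order all_algebra.
From mathcomp.real_closed Require Import complex.
From mathcomp Require Import all_classical all_reals all_analysis.

Set Implicit Arguments.
Unset Strict Implicit.
Unset Printing Implicit Defensive.

Import Order.TTheory GRing.Theory Num.Theory.
Import numFieldNormedType.Exports.

Local Open Scope classical_set_scope.
Local Open Scope ring_scope.
Local Open Scope complex_scope.

(* In a normed space over R[i] the norm takes values in R[i]; this is the same
   norm, seen as an element of R. *)
Definition rnorm (R : realType) (V : normedZmodType R[i]) (v : V) : R :=
  complex.Re `|v|.

Section rnorm_theory.
Context (R : realType).

Lemma rnormE (V : normedZmodType R[i]) (v : V) : `|v| = (rnorm v)%:C.
Proof.
have : 0 <= `|v| by exact: normr_ge0.
by rewrite /rnorm; case: `|v| => a b; rewrite lecE /= => /andP[/eqP -> _].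
Qed.

Lemma rnorm_ge0 (V : normedZmodType R[i]) (v : V) : 0 <= rnorm v.
Proof. by have := normr_ge0 v; rewrite rnormE lecR. Qed.

Lemma rnorm0 (V : normedZmodType R[i]) : rnorm (0 : V) = 0.
Proof. by rewrite /rnorm normr0. Qed.

Lemma rnorm_eq0 (V : normedZmodType R[i]) (v : V) : rnorm v = 0 -> v = 0.
Proof. by move=> v0; apply/eqP; rewrite -normr_eq0 rnormE v0. Qed.

Lemma ler_rnormD (V : normedZmodType R[i]) (v w : V) :
  rnorm (v + w) <= rnorm v + rnorm w.
Proof. by rewrite -lecR rmorphD /= -!rnormE ler_normD. Qed.

Lemma rnormZ (V : normedModType R[i]) (a : R[i]) (v : V) :
  rnorm (a *: v) = rnorm a * rnorm v.
Proof. by apply: (@complexI R); rewrite rmorphM /= -!rnormE normrZ. Qed.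

End rnorm_theory.

Section bounded_operators.
Context (R : realType) (B : normedModType R[i]).

Definition bounded_linear : {pred B -> B} :=
  mem [set T : B -> B | (forall a x y, T (a *: x + y) = a *: T x + T y) /\
                        (exists M : R, forall x, rnorm (T x) <= M * rnorm x)].

Record bop := Bop { bop_fun :> B -> B ; _ : bop_fun \in bounded_linear }.

HB.instance Definition _ := [isSub for bop_fun].
HB.instance Definition _ := [Choice of bop by <:].

Lemma bopP (T : bop) :
  (forall a x y, T (a *: x + y) = a *: T x + T y) /\
  (exists M : R, forall x, rnorm (T x) <= M * rnorm x).
Proof. by case: T => T /= /set_mem. Qed.

Lemma bounded_linear_submod_closed : submod_closed bounded_linear.
Proof.
split=> [|a S T /set_mem[Sl [M SM]] /set_mem[Tl [N TN]]]; apply/mem_set; split.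
- by move=> a x y; rewrite [RHS]/= scaler0 addr0.
- by exists 0 => x; rewrite rnorm0 mul0r.
- move=> b x y.
  rewrite -[LHS]/(a *: S (b *: x + y) + T (b *: x + y)).
  rewrite -[RHS]/(b *: (a *: S x + T x) + (a *: S y + T y)).
  by rewrite Sl Tl !scalerDr !scalerA mulrC addrACA.
- exists (rnorm a * M + N) => x.
  rewrite -[X in rnorm X]/(a *: S x + T x).
  apply: le_trans (ler_rnormD _ _) _; rewrite rnormZ mulrDl lerD//.
  by rewrite -mulrA ler_wpM2l// rnorm_ge0.
Qed.

HB.instance Definition _ :=
  GRing.isSubmodClosed.Build R[i] (B -> B) bounded_linear
    bounded_linear_submod_closed.
HB.instance Definition _ := [SubChoice_isSubLmodule of bop by <:].

Definition opnorm (T : bop) : R :=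
  sup [set rnorm (T x) | x in [set x : B | rnorm x <= 1]].

Lemma bop_has_sup (T : bop) :
  has_sup [set rnorm (T x) | x in [set x : B | rnorm x <= 1]].
Proof.
split; first by exists (rnorm (T 0)), 0 => //=; rewrite rnorm0.
have [_ [M TM]] := bopP T; exists `|M| => _ [x /= x1 <-].
apply: le_trans (TM x) _; apply: le_trans (ler_wpM2r (rnorm_ge0 x) (ler_norm M)) _.
by rewrite -[leRHS]mulr1 ler_wpM2l.
Qed.

Lemma bop_le_opnorm (T : bop) x : rnorm x <= 1 -> rnorm (T x) <= opnorm T.
Proof. by move=> x1; apply: (ub_le_sup (bop_has_sup T).2); exists x. Qed.

Lemma opnorm_le (T : bop) (M : R) :
  (forall x, rnorm x <= 1 -> rnorm (T x) <= M) -> opnorm T <= M.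
Proof.
by move=> TM; apply: (sup_le_ub (bop_has_sup T).1) => _ [x /= x1 <-]; exact: TM.
Qed.

Let bop_norm (T : bop) : R[i] := (opnorm T)%:C.

Let bop_normD S T : bop_norm (S + T) <= bop_norm S + bop_norm T.
Proof.
rewrite /bop_norm -rmorphD /= lecR; apply: opnorm_le => x x1.
rewrite -[X in rnorm X]/(S x + T x).
by apply: le_trans (ler_rnormD _ _) _; rewrite lerD// bop_le_opnorm.
Qed.

Let bop_normZ (a : R[i]) T : bop_norm (a *: T) = `|a| * bop_norm T.
Proof.
rewrite /bop_norm rnormE -rmorphM /=; congr (_%:C).
have hle (b : R[i]) S : opnorm (b *: S) <= rnorm b * opnorm S.
  apply: opnorm_le => x x1; rewrite -[X in rnorm X]/(b *: S x) rnormZ.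
  by rewrite ler_wpM2l ?rnorm_ge0// bop_le_opnorm.
apply/eqP; rewrite eq_le hle/=.
have [->|a0] := eqVneq a 0.
  rewrite rnorm0 mul0r; apply: le_trans (bop_le_opnorm (0 *: T) (x := 0) _).
    exact: rnorm_ge0.
  by rewrite rnorm0.
have ra0 : 0 < rnorm a.
  by rewrite lt_neqAle rnorm_ge0 andbT eq_sym; apply: contra a0 => /eqP/rnorm_eq0->.
rewrite -ler_pdivlMl//; have := hle a^-1 (a *: T).
rewrite scalerA mulVf// scale1r => /le_trans; apply.
suff -> : rnorm a^-1 = (rnorm a)^-1 by [].
by apply: (@complexI R); rewrite fmorphV/= -!rnormE normfV.
Qed.

Let bop_norm_eq0 T : bop_norm T = 0 -> T = 0.
Proof.
move/complexI => T0; apply/val_inj/funext => x /=; apply: rnorm_eq0.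
have [Tl _] := bopP T; apply/eqP; rewrite eq_le rnorm_ge0 andbT.
have [->|x0] := eqVneq x 0.
  have := bop_le_opnorm T (x := 0); rewrite rnorm0 T0.
  by apply.
have rx0 : 0 < rnorm x.
  by rewrite lt_neqAle rnorm_ge0 andbT eq_sym; apply: contra x0 => /eqP/rnorm_eq0->.
have T00 : T 0 = 0.
  by have := Tl (-1) 0 0; rewrite scaler0 addr0 scaleN1r addNr.
have := bop_le_opnorm T (x := ((rnorm x)^-1)%:C *: x).
rewrite T0 -[X in T X]addr0 Tl T00 addr0 !rnormZ.
have -> : rnorm ((rnorm x)^-1)%:C = (rnorm x)^-1.
  by apply: (@complexI R); rewrite -rnormE normc_def/= expr0n/= addr0 sqrtr_sqr
    ger0_norm// invr_ge0 ltW.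
rewrite mulVf ?gt_eqF// => /(_ (lexx _)).
by rewrite pmulr_rle0// invr_gt0.
Qed.

HB.instance Definition _ :=
  Lmodule_isNormed.Build R[i] bop bop_normD bop_normZ bop_norm_eq0.

Lemma rnorm_bop (T : bop) : rnorm T = opnorm T.
Proof. by []. Qed.

Lemma bop_id_subproof : idfun \in bounded_linear.
Proof. by apply/mem_set; split=> //; exists 1 => x; rewrite mul1r. Qed.

Lemma bop_comp_subproof (S T : bop) : S \o T \in bounded_linear.
Proof.
have [Sl [M SM]] := bopP S; have [Tl [N TN]] := bopP T.
apply/mem_set; split=> [a x y|]; first by rewrite /= Tl Sl.
exists (`|M| * N) => x; apply: le_trans (SM (T x)) _.
apply: le_trans (ler_wpM2r (rnorm_ge0 _) (ler_norm M)) _.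
by rewrite -mulrA ler_wpM2l.
Qed.

Definition bop_id : bop := Bop bop_id_subproof.
Definition bop_comp (S T : bop) : bop := Bop (bop_comp_subproof S T).

End bounded_operators.

Section unbounded_operators.
Context (R : realType) (B : normedModType R[i]).

(* A possibly unbounded linear operator; only the values of [op_fun] on the
   subspace [op_dom] are meaningful. *)
Record operator := Operator {
  op_dom : set B ;
  op_fun :> B -> B ;
  op_dom0 : op_dom 0 ;
  op_domP : forall (a : R[i]) x y,
    op_dom x -> op_dom y -> op_dom (a *: x + y) ;
  op_linear : forall (a : R[i]) x y, op_dom x -> op_dom y ->
    op_fun (a *: x + y) = a *: op_fun x + op_fun y }.

Definition densely_defined (P : operator) := dense (op_dom P).

Definition closed_operator (P : operator) :=
  closed [set p : B * B | op_dom P p.1 /\ p.2 = P p.1].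

(* T is a two-sided inverse of z - P : op_dom P -> B. *)
Definition is_resolvent (P : operator) (z : R[i]) (T : bop B) :=
  (forall x, op_dom P (T x) /\ z *: T x - P (T x) = x) /\
  (forall x, op_dom P x -> T (z *: x - P x) = x).

Definition spectrum (P : operator) : set R[i] :=
  [set z | ~ exists T, is_resolvent P z T].

(* (z - P)^-1, with the value 0 for z in the spectrum *)
Definition resolvent (P : operator) (z : R[i]) : bop B :=
  xget 0 [set T | is_resolvent P z T].

Definition real_spectrum (P : operator) :=
  forall z, spectrum P z -> complex.Im z = 0.

Definition locally_temperate_resolvent (P : operator) :=
  forall K : set (R * R), compact K -> exists C N : R, [/\ 0 <= C, 0 <= N &
    forall x y, K (x, y) -> y != 0 ->
      opnorm (resolvent P (x +i* y)) <= C * `|y| `^ (- N)].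

End unbounded_operators.

Section bochner.
Context d (T : measurableType d) (R : realType).
Context (mu : {measure set T -> \bar R}) (V : normedModType R[i]).

(* The simple function sum_k 1_(A_k) v_k is given by the list of the
   (A_k, v_k), where A_k is measurable and of finite measure. *)
Definition is_simple (s : seq (set T * V)) :=
  forall p, p \in s -> measurable p.1 /\ (mu p.1 < +oo)%E.

Definition simple_fun (s : seq (set T * V)) (t : T) : V :=
  \sum_(p <- s) \1_(p.1) t *: p.2.

Definition simple_integral (s : seq (set T * V)) : V :=
  \sum_(p <- s) (fine (mu p.1))%:C *: p.2.

Definition has_bochner_integral (f : T -> V) (I : V) :=
  exists s : nat -> seq (set T * V),
    [/\ forall n, is_simple (s n),
        {ae mu, forall t, (fun n => simple_fun (s n) t) @ \oo --> f t},
        (fun n => \int[mu]_t (rnorm (f t - simple_fun (s n) t))%:E)%E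
          @ \oo --> (0 : \bar R) &
        (fun n => simple_integral (s n)) @ \oo --> I].

Definition bochner_integrable (f : T -> V) :=
  exists I, has_bochner_integral f I.

Definition bochner_integral (f : T -> V) : V :=
  xget 0 [set I | has_bochner_integral f I].

End bochner.

(* [mu \x nu] as a sigma-finite measure: for general mu and nu the library's
   sigma-finite structure on [\x] is shadowed by the subprobability one. *)
Section product_sigma_finite.
Context d1 d2 (T1 : measurableType d1) (T2 : measurableType d2) (R : realType).
Context (mu : {sigma_finite_measure set T1 -> \bar R}).
Context (nu : {sigma_finite_measure set T2 -> \bar R}).

Definition product_measure : set (T1 * T2) -> \bar R := (mu \x nu)%E.

HB.instance Definition _ := Measure.on product_measure.

Let product_measure_sigma_finite : sigma_finite setT product_measure.
Proof.
have /sigma_finiteP[F [TF ndF Foo]] := sigma_finiteT mu.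
have /sigma_finiteP[G [TG ndG Goo]] := sigma_finiteT nu.
exists (fun n => F n `*` G n).
  rewrite -setXTT TF TG predeqE => -[x y]; split.
    move=> [/= [n _ Fnx] [k _ Gky]]; exists (maxn n k) => //; split.
    - by move: x Fnx; exact/subsetPset/ndF/leq_maxl.
    - by move: y Gky; exact/subsetPset/ndG/leq_maxr.
  by move=> [n _ []/= ? ?]; split; exists n.
move=> k; have [? ?] := Foo k; have [? ?] := Goo k.
split; first exact: measurableX.
rewrite /product_measure product_measure1E//.
by rewrite lte_mul_pinfty// ge0_fin_numE.
Qed.

HB.instance Definition _ := Measure_isSigmaFinite.Build _ _ _ product_measure
  product_measure_sigma_finite.

End product_sigma_finite.

(* The n-fold product of a sigma-finite measure, on n-tuples. *)
Section power_measure.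
Context d (T : measurableType d) (R : realType).
Context (mu : {sigma_finite_measure set T -> \bar R}).

Definition tcons n (p : T * n.-tuple T) : n.+1.-tuple T :=
  [tuple of p.1 :: p.2].

Lemma measurable_tcons n : measurable_fun setT (@tcons n).
Proof. exact: (measurable_cons measurable_fst measurable_snd). Qed.

Section step.
Context n (nu : {sigma_finite_measure set n.-tuple T -> \bar R}).

Definition tcons_measure : set (n.+1.-tuple T) -> \bar R :=
  pushforward (product_measure mu nu) (@tcons n).

Let tcons_measure0 : tcons_measure set0 = 0%E.
Proof. by rewrite /tcons_measure /pushforward preimage_set0 measure0. Qed.

Let tcons_measure_ge0 A : (0 <= tcons_measure A)%E.
Proof. by rewrite /tcons_measure /pushforward measure_ge0. Qed.

Let tcons_measure_sigma_additive : semi_sigma_additive tcons_measure.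
Proof.
move=> F mF tF mUF; rewrite /tcons_measure /pushforward preimage_bigcup.
have mt : measurable_fun setT (@tcons n) := @measurable_tcons n.
apply: measure_semi_sigma_additive.
- by move=> k; rewrite -[X in measurable X]setTI; exact: mt.
- apply/trivIsetP => /= i j _ _ ij; rewrite -preimage_setI.
  by move/trivIsetP : tF => /(_ _ _ _ _ ij) ->//; rewrite preimage_set0.
- by rewrite -preimage_bigcup -[X in measurable X]setTI; exact: mt.
Qed.

HB.instance Definition _ := isMeasure.Build _ _ _ tcons_measure
  tcons_measure0 tcons_measure_ge0 tcons_measure_sigma_additive.

Let tcons_measure_sigma_finite : sigma_finite setT tcons_measure.
Proof.
have [F TF Foo] : sigma_finite setT (product_measure mu nu) :=
  sigma_finiteT _.
pose u (t : n.+1.-tuple T) := (thead t, [tuple of behead t]).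
have mu_ : measurable_fun setT u.
  apply: measurable_fun_pair => /=.
    exact: (measurable_tnth ord0).
  exact: measurable_behead.
have tcK : cancel (@tcons n) u.
  by move=> [x t]; congr pair; exact/val_inj.
exists (fun k => u @^-1` F k).
  apply/esym; rewrite -subTset => t _.
  have : [set: T * n.-tuple T] (u t) by [].
  by rewrite TF => -[k _ Fk]; exists k.
move=> k; have [mF oF] := Foo k; split.
  by rewrite -[X in measurable X]setTI; exact: mu_.
rewrite /tcons_measure /pushforward -comp_preimage.
by rewrite (_ : u \o @tcons n = id) ?preimage_id//; apply/funext.
Qed.

HB.instance Definition _ := Measure_isSigmaFinite.Build _ _ _ tcons_measure
  tcons_measure_sigma_finite.

End step.

Fixpoint power_measure n : {sigma_finite_measure set (n.-tuple T) -> \bar R} :=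
  if n is k.+1 then tcons_measure (power_measure k) else \d_([tuple]).

End power_measure.

Section calculus.
Context (R : realType).

(* Directional derivative of a complex-valued function of a real variable,
   taken on the real and imaginary parts. *)
Definition cderive (V : normedModType R) (v : V) (g : V -> R[i]) (x : V) :
    R[i] :=
  ('D_v (fun y => complex.Re (g y)) x) +i* ('D_v (fun y => complex.Im (g y)) x).

(* C^infty: the iterated directional derivatives, in all real directions and of
   all orders, exist and are continuous. *)
Definition is_smooth (V : normedModType R) (g : V -> R[i]) :=
  forall vs : seq V, let h := foldr (@cderive V) g vs in
  [/\ continuous (fun x => complex.Re (h x)),
      continuous (fun x => complex.Im (h x)),
      forall x v, derivable (fun y => complex.Re (h y)) x v &
      forall x v, derivable (fun y => complex.Im (h y)) x v].

Definition csupport (V : normedModType R) (g : V -> R[i]) : set V :=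
  closure [set x | g x != 0].

Definition test_function (V : normedModType R) (g : V -> R[i]) :=
  is_smooth g /\ compact (csupport g).

Context (m : nat).

(* C^m is 'rV[R]_m * 'rV[R]_m, the point x + i y being the pair (x, y). *)
Definition re_dir (j : 'I_m) : 'rV[R]_m * 'rV[R]_m := (delta_mx 0 j, 0).
Definition im_dir (j : 'I_m) : 'rV[R]_m * 'rV[R]_m := (0, delta_mx 0 j).

Definition dbar (j : 'I_m) (g : 'rV[R]_m * 'rV[R]_m -> R[i]) :
    'rV[R]_m * 'rV[R]_m -> R[i] :=
  fun z => 2^-1 * (cderive (re_dir j) g z + (0 +i* 1) * cderive (im_dir j) g z).

Definition special_extension (f : 'rV[R]_m -> R[i])
    (ft : 'rV[R]_m * 'rV[R]_m -> R[i]) :=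
  [/\ test_function ft, forall x, ft (x, 0) = f x &
      forall (j : 'I_m) (N : nat), exists C : R,
        forall z, rnorm (dbar j ft z) <= C * `|z.2 0 j| ^+ N].

Definition pderiv (al : 'I_m -> nat) (f : 'rV[R]_m -> R[i]) :
    'rV[R]_m -> R[i] :=
  foldr (fun j => iter (al j) (cderive (delta_mx 0 j))) f (enum 'I_m).

Definition seminorm_sum (K : set 'rV[R]_m) (N : nat) (f : 'rV[R]_m -> R[i])
    : R :=
  \sum_(al : {ffun 'I_m -> 'I_N.+1} | (\sum_j al j <= N)%N)
    sup [set rnorm (pderiv (fun j => al j : nat) f x) | x in K].

(* A vector-valued distribution on R^m, continuity being expressed by the usual
   seminorm estimates on each compact set. *)
Definition is_distribution (V : normedModType R[i])
    (u : ('rV[R]_m -> R[i]) -> V) :=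
  (forall (a : R[i]) f g, test_function f -> test_function g ->
     u (fun x => a * f x + g x) = a *: u f + u g) /\
  (forall K : set 'rV[R]_m, compact K -> exists (C : R) (N : nat), 0 <= C /\
     forall f, test_function f -> csupport f `<=` K ->
       rnorm (u f) <= C * seminorm_sum K N f).

End calculus.

Section functional_calculus.
Context (R : realType) (m : nat) (B : normedModType R[i]).
Context (P : 'I_m -> operator B).

Definition lebesgueC : {sigma_finite_measure set
    (measurableTypeR R * measurableTypeR R)%type -> \bar R} :=
  product_measure (@lebesgue_measure R) (@lebesgue_measure R).

Definition lebesgueCm := power_measure lebesgueC m.

(* The tuple t lists the points z_j = x_j + i y_j of C = R^2 as (x_j, y_j). *)
Definition integrand (ft : 'rV[R]_m * 'rV[R]_m -> R[i])
    (t : m.-tuple (measurableTypeR R * measurableTypeR R)%type) : bop B :=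
  foldr (@dbar R m) ft (enum 'I_m)
    (\row_j ((tnth t j).1 : R), \row_j ((tnth t j).2 : R))
  *: \big[@bop_comp R B/@bop_id R B]_(j < m)
       resolvent (P j) ((tnth t j).1 +i* (tnth t j).2).

Definition calculus_integral (ft : 'rV[R]_m * 'rV[R]_m -> R[i]) : bop B :=
  (- (pi^-1)%:C) ^+ m *: bochner_integral lebesgueCm (integrand ft).

(* f(P_1, ..., P_m): the integral of some special extension of f, if there is
   one. *)
Definition calculus (f : 'rV[R]_m -> R[i]) : bop B :=
  xget 0 [set calculus_integral ft | ft in special_extension f].

End functional_calculus.

(* Main.v *)
(** The weight dbar_1 ... dbar_m f~ is O(prod_j |Im z_j|^N) for every N, and this
    absorbs the singularities of the resolvents: the integrand is uniformly
    continuous with compact support, so its Bochner integral is the limit of its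
    Riemann sums on cubic grids.

    The difference h of two special extensions of f vanishes to infinite order on
    the real points. Multiply the j-th resolvent by a cutoff vanishing for
    |Im z_j| < eps: on a grid, m summations by parts move the d/dzbar_j from h to
    the products of cutoffs and resolvents, where the resolvent identity makes
    them O(eps^-N0) and, up to an error tending to 0 with the mesh, supported in
    |Im z_j| <= 3 eps. There h is O(eps^N) for all N, so that I(h) = 0.

    For the seminorm estimate take a particular extension, built one variable at
    a time from F |-> sum_k c_k F(z + 4^k (Im z_j) e_j), cut off by a plateau
    function, where sum_k c_k = 1 and c_k (1 + i 4^k) is proportional to a rapidly
    decreasing w_k with sum_k w_k 4^(a k) = 0 for all a >= 0. Then dbar_j of the
    series is, up to a factor, sum_k w_k (d_j F)(z + 4^k (Im z_j) e_j), which is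
    O(|Im z_j|^N) times a bound of finitely many derivatives of F, because
    the moments vanish. *)

Require Import Defs.
From HB Require Import structures.
From mathcomp Require Import all_boot all_order all_algebra.
From mathcomp.real_closed Require Import complex.
From mathcomp Require Import all_classical all_reals all_analysis.
From mathcomp Require Import ring lra.

Set Implicit Arguments.
Unset Strict Implicit.
Unset Printing Implicit Defensive.

Import Order.TTheory GRing.Theory Num.Theory.
Import numFieldNormedType.Exports.

Local Open Scope classical_set_scope.
Local Open Scope ring_scope.
Local Open Scope complex_scope.

(** * Differential calculus of complex-valued functions *)

(** The integration by parts is done on finite sums, so no derivative of an operator-valued function
    is ever taken: the cutoff need only be Lipschitz, and the resolvent identity is exact at finite
    distance. Each of the m steps costs an error O(mesh) whose constant blows up as eps tends to 0.
    Hence the order of the limits: eps is fixed, the mesh is chosen after it, and eps tends to 0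
    last.

    For the seminorm estimate the extension must be linear in f, with constants depending on K only.
    A Borel-type Taylor series, with cutoffs adapted to the size of the derivatives of f, would not
    give this. A series of translates involves no choice depending on f, and it commutes with
    derivatives in the other variables, which is what allows the variables to be treated one after
    the other.

    The factor 1 + i 4^k is what d/dx + i d/dy makes of F(x + 4^k y). Dividing w_k by it and
    normalising to sum_k c_k = 1 requires sum_k w_k / (1 + i 4^k) to be nonzero; its real part is
    sum_k w_k / (1 + 16^k), where the term 1/2 of k = 0 outweighs all the others. *)

Section rnorm_complement.
Context (R : realType).
Implicit Types (a b : R[i]) (r : R).

Lemma rnormM a b : rnorm (a * b) = rnorm a * rnorm b.
Proof. by apply: (@complexI R); rewrite rmorphM /= -!rnormE normrM. Qed.

Lemma rnorm1 : rnorm (1 : R[i]) = 1.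
Proof. by rewrite /rnorm normr1. Qed.

Lemma rnormX a n : rnorm (a ^+ n) = rnorm a ^+ n.
Proof. by elim: n => [|n IH]; rewrite ?expr0 ?rnorm1// !exprS rnormM IH. Qed.

Lemma rnormN (V : normedZmodType R[i]) (v : V) : rnorm (- v) = rnorm v.
Proof. by rewrite /rnorm normrN. Qed.

Lemma rnormB (V : normedZmodType R[i]) (v w : V) : rnorm (v - w) = rnorm (w - v).
Proof. by rewrite -rnormN opprB. Qed.

Lemma ler_rnormB (V : normedZmodType R[i]) (v w : V) :
  rnorm (v - w) <= rnorm v + rnorm w.
Proof. by rewrite -(rnormN w) ler_rnormD. Qed.

Lemma ler_rnorm_dist (V : normedZmodType R[i]) (v w : V) :
  rnorm v <= rnorm w + rnorm (v - w).
Proof. by rewrite -[in leLHS](subrK w v) addrC ler_rnormD. Qed.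

Lemma ler_dist_rnorm (V : normedZmodType R[i]) (v w : V) :
  `|rnorm v - rnorm w| <= rnorm (v - w).
Proof.
have h1 := ler_rnorm_dist v w; have h2 := ler_rnorm_dist w v.
by rewrite rnormB in h2; rewrite ler_norml; apply/andP; split; lra.
Qed.

Lemma ler_rnorm_sum (V : normedZmodType R[i]) (I : Type) (s : seq I)
    (Q : pred I) (F : I -> V) :
  rnorm (\sum_(i <- s | Q i) F i) <= \sum_(i <- s | Q i) rnorm (F i).
Proof.
elim/big_rec2 : _ => [|i y x _ h]; first by rewrite rnorm0.
by rewrite (le_trans (ler_rnormD _ _))// lerD2l.
Qed.

Lemma rnormC r : rnorm (r%:C) = `|r|.
Proof.
by apply: (@complexI R); rewrite -rnormE normc_def /= expr0n /= addr0 sqrtr_sqr.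
Qed.

Lemma ge_rnorm_Re a : `|complex.Re a| <= rnorm a.
Proof.
rewrite -lecR -rnormE normc_def lecR -sqrtr_sqr Num.Theory.ler_wsqrtr// lerDl.
exact: sqr_ge0.
Qed.

Lemma rnorm_imC r : rnorm (0 +i* r) = `|r|.
Proof.
by apply: (@complexI R); rewrite -rnormE normc_def /= expr0n /= add0r sqrtr_sqr.
Qed.

Lemma rnorm_le_ReIm a : rnorm a <= `|complex.Re a| + `|complex.Im a|.
Proof.
case: a => a b /=; have -> : a +i* b = a%:C + (0 +i* b).
  by apply/eqP; rewrite eq_complex /= addr0 add0r !eqxx.
by rewrite (le_trans (ler_rnormD _ _))// rnormC rnorm_imC.
Qed.

Lemma ge_rnorm_Im a : `|complex.Im a| <= rnorm a.
Proof.
have -> : `|complex.Im a| = `|complex.Re ((0 +i* (- 1)) * a)|.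
  by case: a => a b /=; rewrite mul0r add0r !mulN1r opprK.
by rewrite (le_trans (ge_rnorm_Re _))// rnormM rnorm_imC normrN1 mul1r.
Qed.

Lemma rnorm_gt0 (V : normedZmodType R[i]) (v : V) : (0 < rnorm v) = (v != 0).
Proof.
rewrite lt_def rnorm_ge0 andbT; apply/idP/idP; last first.
  by apply: contra => /eqP/rnorm_eq0->.
by apply: contra => /eqP->; rewrite rnorm0.
Qed.

Lemma rnormV a : rnorm a^-1 = (rnorm a)^-1.
Proof. by apply: (@complexI R); rewrite fmorphV/= -!rnormE normfV. Qed.

Lemma eq_ler r (s : R) : r = s -> r <= s.
Proof. by move=> ->. Qed.

Lemma ler_wXn2r n (x y : R) : 0 <= x -> x <= y -> x ^+ n <= y ^+ n.
Proof. by move=> x0 xy; rewrite lerXn2r ?nnegrE// (le_trans x0). Qed.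

(** Identities between limits are reduced to this test. It asks only for e <= 1, so that a caller
    may bound higher powers of e by e. *)
Lemma eq0_rnorm_le (V : normedZmodType R[i]) (v : V) (M : R) :
  (forall e, 0 < e -> e <= 1 -> rnorm v <= M * e) -> v = 0.
Proof.
move=> h; apply: rnorm_eq0; apply/eqP; rewrite eq_le rnorm_ge0 andbT leNgt.
apply/negP => v0; have M0 : 0 < M.
  by have := h 1 ltr01 (lexx _); rewrite mulr1; exact: lt_le_trans.
set e := Num.min 1 (rnorm v / M / 2).
have e0 : 0 < e by rewrite lt_min ltr01 !divr_gt0.
have := h e e0; rewrite ge_min lexx => /(_ isT).
apply/negP; rewrite -ltNge.
have : e <= rnorm v / M / 2 by rewrite ge_min lexx orbT.
rewrite -(ler_pM2l M0) => /le_lt_trans; apply.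
by rewrite mulrA mulrCA divff ?gt_eqF// mulr1 ltr_pdivrMr// ltr_pMr// ltr1n.
Qed.

End rnorm_complement.

Section complex_derivative.
Context (R : realType).
Local Notation "'C" := R[i].

(** [cderive] is a total function whose value says nothing about existence; this predicate records
    both, on real and imaginary parts because the directions are real. *)
Definition is_cderive (V : normedModType R) (g : V -> 'C) (x v : V) (d : 'C) :=
  is_derive x v (fun y => complex.Re (g y)) (complex.Re d) /\
  is_derive x v (fun y => complex.Im (g y)) (complex.Im d).

Section normed.
Context (V W : normedModType R).
Implicit Types (f g : V -> 'C) (x v : V).

Lemma cderive_val g x v d : is_cderive g x v d -> cderive v g x = d.
Proof. by case=> gr gi; rewrite /cderive !derive_val; case: d {gr gi}. Qed.

Lemma is_cderive_cst (a : 'C) x v : is_cderive (fun=> a) x v 0.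
Proof. by split; exact: is_derive_cst. Qed.

Lemma is_cderiveD f g x v a b : is_cderive f x v a -> is_cderive g x v b ->
  is_cderive (fun y => f y + g y) x v (a + b).
Proof.
move=> [fr fi] [gr gi]; split.
  rewrite (_ : (fun _ => _) = (fun y => complex.Re (f y)) + (fun y => complex.Re (g y))).
    by rewrite raddfD/=; exact: is_deriveD.
  by apply/funext => y; rewrite raddfD.
rewrite (_ : (fun _ => _) = (fun y => complex.Im (f y)) + (fun y => complex.Im (g y))).
  by rewrite raddfD/=; exact: is_deriveD.
by apply/funext => y; rewrite raddfD.
Qed.

Lemma ReD (a b : 'C) : complex.Re (a + b) = complex.Re a + complex.Re b.
Proof. by case: a b => [a b] [c d]. Qed.

Lemma ImD (a b : 'C) : complex.Im (a + b) = complex.Im a + complex.Im b.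
Proof. by case: a b => [a b] [c d]. Qed.

Lemma ReM (a b : 'C) : complex.Re (a * b) =
  complex.Re a * complex.Re b - complex.Im a * complex.Im b.
Proof. by case: a b => [a b] [c d]. Qed.

Lemma ImM (a b : 'C) : complex.Im (a * b) =
  complex.Re a * complex.Im b + complex.Im a * complex.Re b.
Proof. by case: a b => [a b] [c d]. Qed.

Lemma is_cderiveM f g x v a b : is_cderive f x v a -> is_cderive g x v b ->
  is_cderive (fun y => f y * g y) x v (a * g x + f x * b).
Proof.
move=> [fr fi] [gr gi]; split.
  rewrite (_ : (fun _ => _) = (fun y => complex.Re (f y)) * (fun y => complex.Re (g y)) -
    (fun y => complex.Im (f y)) * (fun y => complex.Im (g y))); last first.
    by apply/funext => y; rewrite ReM.
  apply: (is_derive_eq (is_deriveB (is_deriveM fr gr) (is_deriveM fi gi))).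
  by rewrite ReD !ReM /GRing.scale /=; ring.
rewrite (_ : (fun _ => _) = (fun y => complex.Re (f y)) * (fun y => complex.Im (g y)) +
    (fun y => complex.Im (f y)) * (fun y => complex.Re (g y))); last first.
  by apply/funext => y; rewrite ImM.
apply: (is_derive_eq (is_deriveD (is_deriveM fr gi) (is_deriveM fi gr))).
by rewrite ImD !ImM /GRing.scale /=; ring.
Qed.

(** The difference quotients of [u \o L] along [v] are literally those of [u] along [l], so a
    derivative in this single direction is enough for the chain rule. *)
Lemma is_derive_affine (u : W -> R) (L : V -> W) (l : W) x v (d : R) :
  (forall h : R, L (h *: v + x) = h *: l + L x) ->
  is_derive (L x) l u d -> is_derive x v (u \o L) d.
Proof.
move=> Lh; have E : (fun h : R => h^-1 *: ((u \o shift (L x)) (h *: l) - u (L x))) =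
    (fun h : R => h^-1 *: (((u \o L) \o shift x) (h *: v) - (u \o L) x)).
  by apply/funext => h /=; rewrite Lh.
by case=> ud <-; split; [move: ud; rewrite /derivable E | rewrite /derive E].
Qed.

Lemma is_cderive_affine (u : W -> 'C) (L : V -> W) (l : W) x v (d : 'C) :
  (forall h : R, L (h *: v + x) = h *: l + L x) ->
  is_cderive u (L x) l d -> is_cderive (u \o L) x v d.
Proof.
by move=> Lh [ur ui]; split;
  [move: ur|move: ui]; exact: is_derive_affine.
Qed.

End normed.

Lemma scale1_regular (k : R) : k *: (1 : R^o) = k.
Proof. exact: mulr1. Qed.

Section mean_value.
Context (V : normedModType R).
Implicit Types (g : V -> 'C) (x v : V).

Lemma mean_value_pos (u du : V -> R) x v (M h : R) :
  (forall y, is_derive y v u (du y)) -> 0 <= h ->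
  (forall t, 0 <= t <= h -> `|du (t *: v + x)| <= M) ->
  `|u (h *: v + x) - u x| <= M * h.
Proof.
move=> ud h0 duM; pose L (t : R^o) : V := t *: v + x.
have pd t : is_derive (t : R^o) (1 : R^o) (u \o L) (du (t *: v + x)).
  apply: (is_derive_affine (l := v)) => k.
  by rewrite /L scale1_regular scalerDl addrA.
have pc : {within `[0, h], continuous (u \o L : R -> R)}.
  apply/continuous_subspaceT => t; apply: differentiable_continuous.
  by apply/derivable1_diffP; exact: (@ex_derive _ _ _ _ _ _ _ (pd t)).
have [c c01] := @MVT_segment R (u \o L) (fun t => du (t *: v + x)) 0 h h0
   (fun t _ => pd t) pc.
rewrite /= /L subr0 scale0r add0r => ->.
by rewrite normrM (ger0_norm h0) ler_wpM2r//; apply: duM; rewrite in_itv in c01.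
Qed.

Lemma mean_value_real (u du : V -> R) x v (M h : R) :
  (forall y, is_derive y v u (du y)) ->
  (forall t, `|t| <= `|h| -> `|du (t *: v + x)| <= M) ->
  `|u (h *: v + x) - u x| <= M * `|h|.
Proof.
move=> ud duM; have [h0|h0] := leP 0 h.
  rewrite [X in _ <= _ * X](ger0_norm h0); apply: (mean_value_pos ud) => // t.
  by move=> /andP[t0 th]; apply: duM; rewrite !ger0_norm.
have := @mean_value_pos u du (h *: v + x) v M (- h) ud.
rewrite scaleNr addKr distrC (ltr0_norm h0); apply; first by rewrite oppr_ge0 ltW.
move=> t /andP[t0 th]; rewrite addrA -scalerDl; apply: duM.
by rewrite (ltr0_norm h0) ler_norml opprK; apply/andP; split; lra.
Qed.

(** The mean value theorem fails for complex values; using it on the real and imaginary parts costs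
    the harmless factor 2. *)
Lemma mean_value g dg x v (M h : R) :
  (forall y, is_cderive g y v (dg y)) ->
  (forall t, `|t| <= `|h| -> rnorm (dg (t *: v + x)) <= M) ->
  rnorm (g (h *: v + x) - g x) <= 2 * M * `|h|.
Proof.
move=> gd gM; rewrite (le_trans (rnorm_le_ReIm _))// !raddfB/=.
rewrite [2 * M]mulrDl mul1r mulrDl; apply: lerD.
  apply: (@mean_value_real (fun y => complex.Re (g y)) (fun y => complex.Re (dg y))) => [y|t t01].
    by case: (gd y).
  exact: le_trans (ge_rnorm_Re _) (gM _ t01).
apply: (@mean_value_real (fun y => complex.Im (g y)) (fun y => complex.Im (dg y))) => [y|t t01].
  by case: (gd y).
exact: le_trans (ge_rnorm_Im _) (gM _ t01).
Qed.

End mean_value.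

Section mean_value2.
Context (V : normedModType R).
Implicit Types (g : V -> 'C) (x v : V).

(** Two uses of the mean value theorem: t |-> u(tv + x) - t du(x) has derivative du(tv + x) - du(x),
    which is itself bounded by M |t|. *)
Lemma mean_value_quad_real (u du d2u : V -> R) x v (M h : R) :
  (forall y, is_derive y v u (du y)) -> (forall y, is_derive y v du (d2u y)) ->
  (forall y, `|d2u y| <= M) -> `|u (h *: v + x) - u x - h * du x| <= M * h ^+ 2.
Proof.
move=> ud dud d2M.
have M0 : 0 <= M by exact: le_trans (d2M x).
pose L (t : R^o) := t *: v + x.
pose G (t : R^o) : R := u (L t) - t * du x.
have Gd (t : R^o) : is_derive t (1 : R^o) G (du (L t) - du x).
  rewrite (_ : G = (u \o L) - (id : R^o -> R) * cst (du x))//.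
  have uL : is_derive t (1 : R^o) (u \o L) (du (L t)).
    apply: (is_derive_affine (l := v)) => k.
    by rewrite /L scale1_regular scalerDl addrA.
  by apply: is_derive_eq; rewrite /GRing.scale /= mulr0 add0r mulr1.
have := @mean_value_real R^o G (fun t => du (L t) - du x) 0 1 (M * `|h|) h Gd.
rewrite scale1_regular addr0 /G /L scale0r add0r mul0r subr0 => mv.
rewrite -real_normK ?num_real// expr2 mulrA addrAC; apply: mv => t th.
rewrite scale1_regular addr0.
have := @mean_value_real V du d2u x v M t dud (fun s _ => d2M _).
by move=> /le_trans; apply; rewrite ler_wpM2l.
Qed.

Lemma mean_value_quad g dg d2g x v (M h : R) :
  (forall y, is_cderive g y v (dg y)) -> (forall y, is_cderive dg y v (d2g y)) ->
  (forall y, rnorm (d2g y) <= M) ->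
  rnorm (g (h *: v + x) - g x - h%:C * dg x) <= 2 * M * h ^+ 2.
Proof.
move=> gd dgd d2M; rewrite (le_trans (rnorm_le_ReIm _))//.
rewrite [2 * M]mulrDl mul1r mulrDl; apply: lerD.
  have := @mean_value_quad_real (fun y => complex.Re (g y)) (fun y => complex.Re (dg y))
    (fun y => complex.Re (d2g y)) x v M h (fun y => (gd y).1) (fun y => (dgd y).1)
    (fun y => le_trans (ge_rnorm_Re _) (d2M y)).
  by congr (`|_| <= _); rewrite !raddfB /= ReM /= mul0r subr0.
have := @mean_value_quad_real (fun y => complex.Im (g y)) (fun y => complex.Im (dg y))
  (fun y => complex.Im (d2g y)) x v M h (fun y => (gd y).2) (fun y => (dgd y).2)
  (fun y => le_trans (ge_rnorm_Im _) (d2M y)).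
by congr (`|_| <= _); rewrite !raddfB /= ImM /= mul0r addr0.
Qed.

Lemma is_derive_quad (u : V -> R) x v (d M : R) :
  (forall h : R, `|u (h *: v + x) - u x - h * d| <= M * h ^+ 2) ->
  is_derive x v u d.
Proof.
move=> H; have cvgH : h^-1 *: ((u \o shift x) (h *: v) - u x) @[h --> 0^'] --> d.
  apply/cvgrPdist_le => e e0; near=> h.
  have h0 : h != 0 by near: h; exact: nbhs_dnbhs_neq.
  have -> : d - h^-1 *: ((u \o shift x) (h *: v) - u x) =
     - (h^-1 * (u (h *: v + x) - u x - h * d)).
    by rewrite [in RHS]mulrBr mulKf// opprB.
  rewrite normrN normrM normfV ler_pdivrMl ?normr_gt0//.
  apply: le_trans (H h) _; rewrite -real_normK ?num_real// expr2 mulrCA.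
  rewrite ler_wpM2l//; apply: le_trans (ler_wpM2r (normr_ge0 _) (ler_norm M)) _.
  apply: (@le_trans _ _ ((`|M| + 1) * `|h|)); first by rewrite ler_wpM2r// lerDl.
  rewrite -ler_pdivlMl ?ltr_wpDl//; near: h.
  by apply: dnbhs0_le; rewrite mulr_gt0// invr_gt0 ltr_wpDl.
split; first by apply/cvg_ex; exists d.
exact: cvg_lim.
Unshelve. all: by end_near. Qed.

(** A quadratic remainder can be added, composed and summed over a series, whereas limits of
    difference quotients would have to be interchanged. Derivatives of new functions are therefore
    established through this criterion. *)
Lemma is_cderive_quad g x v (d : 'C) (M : R) :
  (forall h : R, rnorm (g (h *: v + x) - g x - h%:C * d) <= M * h ^+ 2) ->
  is_cderive g x v d.
Proof.
move=> H; split; apply: (@is_derive_quad _ _ _ _ M) => h.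
  apply: le_trans (le_trans (ge_rnorm_Re _) (H h)).
  by rewrite !raddfB /= ReM /= mul0r subr0.
apply: le_trans (le_trans (ge_rnorm_Im _) (H h)).
by rewrite !raddfB /= ImM /= mul0r addr0.
Qed.

End mean_value2.
End complex_derivative.

(** * Functions all of whose directional derivatives are bounded *)

Section bounded_smooth.
Context (R : realType).
Local Notation "'C" := R[i].

Definition ccontinuous (V : normedModType R) (g : V -> 'C) :=
  continuous (fun x => complex.Re (g x)) /\ continuous (fun x => complex.Im (g x)).

(** Boundedness on the whole space makes the constants in the Taylor estimates independent of the
    point. Test functions have it by compactness, and the extension operators preserve it, which a
    condition of compact support would not allow before the cutoff. *)
Fixpoint bcn (V : normedModType R) n (g : V -> 'C) : Prop :=
  [/\ ccontinuous g, exists M, forall x, rnorm (g x) <= M &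
    if n is k.+1 then
      forall v, (forall x, is_cderive g x v (cderive v g x)) /\ bcn k (cderive v g)
    else True].

Definition bsmooth (V : normedModType R) (g : V -> 'C) := forall n, bcn n g.

Section closure.
Context (V W : normedModType R).
Implicit Types (f g : V -> 'C) (x v w : V).

Lemma bcnW n g : bcn n.+1 g -> bcn n g.
Proof.
elim: n g => [|n IH] g; first by case=> cg bg _; split.
case=> cg bg dg; split => // v; have [gd bdg] := dg v; split => //.
exact: IH.
Qed.

Lemma bsmooth_cderive g v : bsmooth g -> bsmooth (cderive v g).
Proof. by move=> bg n; have [_ _ /(_ v)[]] := bg n.+1. Qed.

Lemma bsmooth_is_cderive g x v : bsmooth g -> is_cderive g x v (cderive v g x).
Proof. by move=> bg; have [_ _ /(_ v)[]] := bg 1%N. Qed.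

Lemma bsmooth_continuous g : bsmooth g -> ccontinuous g.
Proof. by move=> bg; have [] := bg 0%N. Qed.

Lemma bsmooth_bounded g : bsmooth g -> exists2 M, 0 <= M & forall x, rnorm (g x) <= M.
Proof.
move=> bg; have [_ [M gM] _] := bg 0%N; exists M => //.
exact: le_trans (rnorm_ge0 _) (gM 0).
Qed.

Lemma bsmooth_foldr g (vs : seq V) : bsmooth g -> bsmooth (foldr (@cderive R V) g vs).
Proof. by move=> bg; elim: vs => //= v vs; exact: bsmooth_cderive. Qed.

Lemma bsmooth_smooth g : bsmooth g -> is_smooth g.
Proof.
move=> bg vs; have := bsmooth_foldr vs bg; set h := foldr _ _ _ => bh.
have [ch1 ch2] := bsmooth_continuous bh.
by split => // x v; have [[? _] [? _]] := bsmooth_is_cderive x v bh.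
Qed.

Lemma bcn_cst n (a : 'C) : bcn n (fun _ : V => a).
Proof.
elim: n a => [|n IH] a; split; try by split => x; exact: cst_continuous.
- by exists (rnorm a).
- by exists (rnorm a).
- move=> v; have d x := is_cderive_cst a x v.
  have -> : cderive v (fun _ : V => a) = fun=> 0.
    by apply/funext => x; rewrite (cderive_val (d x)).
  by split.
Qed.

Lemma bsmooth_cst (a : 'C) : bsmooth (fun _ : V => a).
Proof. by move=> n; exact: bcn_cst. Qed.

Lemma ccontinuousD f g : ccontinuous f -> ccontinuous g ->
  ccontinuous (fun x => f x + g x).
Proof.
move=> [f1 f2] [g1 g2]; split => x.
  under eq_fun do rewrite ReD; exact: (cvgD (f1 x) (g1 x)).
by under eq_fun do rewrite ImD; exact: (cvgD (f2 x) (g2 x)).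
Qed.

Lemma ccontinuousM f g : ccontinuous f -> ccontinuous g ->
  ccontinuous (fun x => f x * g x).
Proof.
move=> [f1 f2] [g1 g2]; split => x.
  under eq_fun do rewrite ReM.
  exact: (cvgB (cvgM (f1 x) (g1 x)) (cvgM (f2 x) (g2 x))).
under eq_fun do rewrite ImM.
exact: (cvgD (cvgM (f1 x) (g2 x)) (cvgM (f2 x) (g1 x))).
Qed.

Lemma bcnD n f g : bcn n f -> bcn n g -> bcn n (fun x => f x + g x).
Proof.
elim: n f g => [|n IH] f g [cf [M fM] df] [cg [N gN] dg]; split => //;
  try exact: ccontinuousD;
  try by exists (M + N) => x; exact: le_trans (ler_rnormD _ _) (lerD _ _).
move=> v; have [fd bdf] := df v; have [gd bdg] := dg v.
have d x := is_cderiveD (fd x) (gd x).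
have E x := cderive_val (d x).
split => [x|]; first by rewrite E.
by rewrite (funext E); exact: IH.
Qed.

Lemma bcnM n f g : bcn n f -> bcn n g -> bcn n (fun x => f x * g x).
Proof.
elim: n f g => [|n IH] f g bf bg; move: (bf) (bg) => [cf [M fM] df] [cg [N gN] dg];
  split => //; try exact: ccontinuousM;
  try by exists (M * N) => x; rewrite rnormM ler_pM ?rnorm_ge0.
move=> v; have [fd bdf] := df v; have [gd bdg] := dg v.
have d x := is_cderiveM (fd x) (gd x).
have E x := cderive_val (d x).
split => [x|]; first by rewrite E.
by rewrite (funext E); apply: bcnD; apply: IH => //; exact: bcnW.
Qed.

Lemma bsmoothD f g : bsmooth f -> bsmooth g -> bsmooth (fun x => f x + g x).
Proof. by move=> bf bg n; exact: bcnD. Qed.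

Lemma bsmoothM f g : bsmooth f -> bsmooth g -> bsmooth (fun x => f x * g x).
Proof. by move=> bf bg n; exact: bcnM. Qed.

Lemma bsmoothZ (a : 'C) g : bsmooth g -> bsmooth (fun x => a * g x).
Proof. by move=> bg; apply: bsmoothM => //; exact: bsmooth_cst. Qed.

Lemma bsmoothB f g : bsmooth f -> bsmooth g -> bsmooth (fun x => f x - g x).
Proof.
move=> bf /(bsmoothZ (-1)) bg; have := bsmoothD bf bg.
by under eq_fun do rewrite mulN1r.
Qed.

Lemma cderiveD f g x v : bsmooth f -> bsmooth g ->
  cderive v (fun x => f x + g x) x = cderive v f x + cderive v g x.
Proof.
by move=> bf bg; apply: cderive_val; apply: is_cderiveD; exact: bsmooth_is_cderive.
Qed.

Lemma cderiveM f g x v : bsmooth f -> bsmooth g ->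
  cderive v (fun x => f x * g x) x = cderive v f x * g x + f x * cderive v g x.
Proof.
by move=> bf bg; apply: cderive_val; apply: is_cderiveM; exact: bsmooth_is_cderive.
Qed.

Lemma cderive_cst (a : 'C) x v : cderive v (fun=> a) x = 0.
Proof. exact: cderive_val (is_cderive_cst _ _ _). Qed.

Lemma cderiveZ (a : 'C) g x v : bsmooth g ->
  cderive v (fun x => a * g x) x = a * cderive v g x.
Proof.
by move=> bg; rewrite cderiveM ?cderive_cst ?mul0r ?add0r//; exact: bsmooth_cst.
Qed.

Lemma cderiveB f g x v : bsmooth f -> bsmooth g ->
  cderive v (fun x => f x - g x) x = cderive v f x - cderive v g x.
Proof.
move=> bf bg; rewrite -mulN1r -cderiveZ// -cderiveD//; last exact: bsmoothZ.
by under [in RHS]eq_fun do rewrite mulN1r.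
Qed.

Lemma bsmooth_lipschitz g v : bsmooth g -> exists2 M, 0 <= M &
  forall x (h : R), rnorm (g (h *: v + x) - g x) <= M * `|h|.
Proof.
move=> bg; have [M M0 gM] := bsmooth_bounded (bsmooth_cderive v bg).
exists (2 * M) => [|x h]; first by rewrite mulr_ge0.
by apply: (mean_value (fun y => bsmooth_is_cderive y v bg)).
Qed.

Lemma bsmooth_quad g v : bsmooth g -> exists2 M, 0 <= M &
  forall x (h : R), rnorm (g (h *: v + x) - g x - h%:C * cderive v g x) <= M * h ^+ 2.
Proof.
move=> bg; have bdg := bsmooth_cderive v bg.
have [M M0 gM] := bsmooth_bounded (bsmooth_cderive v bdg).
exists (2 * M) => [|x h]; first by rewrite mulr_ge0.
exact: (mean_value_quad x h (fun y => bsmooth_is_cderive y v bg)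
  (fun y => bsmooth_is_cderive y v bdg) gM).
Qed.

(** The step along [v + a *: w] is made in two legs, first [v] and then [w]. The second leg starts
    from a displaced point, and the Lipschitz bound of [cderive w g] shows that the displacement
    costs only O(h^2). *)
Lemma cderive_lin g x v w (a : R) : bsmooth g ->
  cderive (v + a *: w) g x = cderive v g x + a%:C * cderive w g x.
Proof.
move=> bg; have [M M0 gM] := bsmooth_quad v bg; have [N N0 gN] := bsmooth_quad w bg.
have [K K0 gK] := bsmooth_lipschitz v (bsmooth_cderive w bg).
apply: cderive_val; apply: (@is_cderive_quad _ _ _ _ _ _ (M + N * a ^+ 2 + `|a| * K)) => h.
have -> : h *: (v + a *: w) + x = (h * a) *: w + (h *: v + x).
  by rewrite scalerDr scalerA addrCA addrA.
have -> : g ((h * a) *: w + (h *: v + x)) - g x -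
    h%:C * (cderive v g x + a%:C * cderive w g x) =
  (g (h *: v + x) - g x - h%:C * cderive v g x) +
  (g ((h * a) *: w + (h *: v + x)) - g (h *: v + x) -
     (h * a)%:C * cderive w g (h *: v + x)) +
  (h%:C * a%:C * (cderive w g (h *: v + x) - cderive w g x)).
  by rewrite rmorphM /=; ring.
rewrite 2!mulrDl; apply: le_trans (ler_rnormD _ _) _; apply: lerD.
  apply: le_trans (ler_rnormD _ _) _; apply: lerD; first exact: gM.
  by apply: le_trans (gN _ _) _; rewrite exprMn; apply: eq_ler; ring.
rewrite !rnormM !rnormC; apply: le_trans (ler_wpM2l _ (gK _ _)) _.
  by rewrite mulr_ge0.
by rewrite -[h ^+ 2]real_normK ?num_real//; apply: eq_ler; ring.
Qed.

Lemma cderiveZv g x v (a : R) : bsmooth g ->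
  cderive (a *: v) g x = a%:C * cderive v g x.
Proof.
move=> bg; have := cderive_lin x 0 v a bg; rewrite add0r => ->.
have := cderive_lin x 0 0 1 bg; rewrite scaler0 addr0 mul1r => /eqP.
by rewrite -subr_eq subrr eq_sym => /eqP ->; rewrite add0r.
Qed.

Lemma cderiveDv g x v w : bsmooth g ->
  cderive (v + w) g x = cderive v g x + cderive w g x.
Proof. by move=> bg; have := cderive_lin x v w 1 bg; rewrite scale1r mul1r. Qed.

Lemma cderive0v g x : bsmooth g -> cderive 0 g x = 0.
Proof. by move=> bg; rewrite -[0 in LHS](scale0r (0 : V)) cderiveZv// mul0r. Qed.

Lemma cderive_sumv g x (I : Type) (s : seq I) (F : I -> V) : bsmooth g ->
  cderive (\sum_(i <- s) F i) g x = \sum_(i <- s) cderive (F i) g x.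
Proof.
move=> bg; elim: s => [|i s IH]; first by rewrite !big_nil cderive0v.
by rewrite !big_cons cderiveDv// IH.
Qed.

(** The second difference is symmetric in [v] and [w], so approximating a mixed derivative by it up
    to O(h^3) in either order proves that the two orders agree. The estimate is the quadratic one
    along [v] for y |-> g(hw + y) - g(y), whose second derivative is O(h). *)
Let second_difference g x v w : bsmooth g -> exists2 M, 0 <= M & forall h : R, 0 <= h ->
  rnorm (g (h *: v + (h *: w + x)) - g (h *: v + x) - g (h *: w + x) + g x -
         h%:C ^+ 2 * cderive w (cderive v g) x) <= M * h ^+ 3.
Proof.
move=> bg; have bdg := bsmooth_cderive v bg; have bddg := bsmooth_cderive v bdg.
have [M M0 gM] := bsmooth_lipschitz w bddg.
have [N N0 gN] := bsmooth_quad w bdg.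
exists (2 * M + N) => [|h h0]; first by rewrite addr_ge0// mulr_ge0.
have T (f : V -> 'C) : bsmooth f -> forall y, is_cderive (fun z => f (h *: w + z)) y v
    (cderive v f (h *: w + y)).
  move=> bf y; apply: (@is_cderive_affine _ _ _ f (fun z => h *: w + z) v).
    by move=> k; rewrite addrCA.
  exact: bsmooth_is_cderive.
have dB (f : V -> 'C) : bsmooth f -> forall y, is_cderive (fun z => f (h *: w + z) - f z) y v
    (cderive v f (h *: w + y) - cderive v f y).
  move=> bf y; have := is_cderiveD (T f bf y)
    (is_cderiveM (is_cderive_cst (-1) y v) (bsmooth_is_cderive y v bf)).
  by rewrite mul0r add0r mulN1r; under eq_fun do rewrite mulN1r.
have := @mean_value_quad _ _ _ _ _ x v (M * `|h|) h (dB g bg) (dB _ bdg) (fun y => gM y h).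
set X := rnorm _ => hX.
apply: (@le_trans _ _ (X + h * rnorm (cderive v g (h *: w + x) - cderive v g x -
   h%:C * cderive w (cderive v g) x))).
  rewrite -[X in X * rnorm _](ger0_norm h0) -(@rnormC R) -rnormM.
  apply: le_trans (ler_rnormD _ _); rewrite [h *: v + (h *: w + x)]addrCA.
  by apply: eq_ler; congr rnorm; ring.
rewrite mulrDl; apply: lerD.
  by apply: le_trans hX _; rewrite ger0_norm//; apply: eq_ler; ring.
by apply: le_trans (ler_wpM2l h0 (gN _ _)) _; apply: eq_ler; ring.
Qed.

Lemma cderiveC g x v w : bsmooth g ->
  cderive w (cderive v g) x = cderive v (cderive w g) x.
Proof.
move=> bg; have [M M0 gM] := second_difference x v w bg.
have [N N0 gN] := second_difference x w v bg.
apply/eqP; rewrite -subr_eq0; apply/eqP; apply: (@eq0_rnorm_le _ _ _ (M + N)) => h h0 _.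
have h20 : 0 < h ^+ 2 by rewrite exprn_gt0.
rewrite -(ler_pM2l h20) -[X in X * rnorm _](gtr0_norm h20) -rnormC -rnormM.
have -> : h ^+ 2 * ((M + N) * h) = N * h ^+ 3 + M * h ^+ 3 by ring.
apply: le_trans (lerD (gN _ (ltW h0)) (gM _ (ltW h0))).
apply: le_trans (ler_rnormB _ _); rewrite [h *: v + (h *: w + x)]addrCA rmorphXn/=.
move: (g _) (g _) (g _) (g _) (cderive w _ _) (cderive v _ _) => a b c d e f.
by apply: eq_ler; congr rnorm; ring.
Qed.

Lemma cderive_foldrC g x v (vs : seq V) : bsmooth g ->
  cderive v (foldr (@cderive R V) g vs) x = foldr (@cderive R V) (cderive v g) vs x.
Proof.
move=> bg; elim: vs x => //= w vs IH x.
rewrite cderiveC; last exact: bsmooth_foldr.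
by congr (cderive w _ x); exact: funext.
Qed.

End closure.

Lemma bcn_affine (V W : normedModType R) n (g : W -> 'C) (L l : V -> W) :
  (forall x v (h : R), L (h *: v + x) = h *: l v + L x) -> continuous L ->
  bcn n g -> bcn n (g \o L).
Proof.
move=> Ll cL; elim: n g => [|n IH] g [[c1 c2] [M gM] dg].
  split=> //; last by exists M => x; exact: gM.
  by split => x; [apply: (continuous_comp (cL x) (c1 (L x)))|
     apply: (continuous_comp (cL x) (c2 (L x)))].
split=> //; last first.
- move=> v; have [gd bdg] := dg (l v).
  have d x := is_cderive_affine (fun h => Ll x v h) (gd (L x)).
  have E x := cderive_val (d x).
  split => [x|]; first by rewrite E.
  by rewrite (funext E); exact: IH.
- by exists M => x; exact: gM.
- by split => x; [apply: (continuous_comp (cL x) (c1 (L x)))|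
     apply: (continuous_comp (cL x) (c2 (L x)))].
Qed.

Lemma bsmooth_affine (V W : normedModType R) (g : W -> 'C) (L l : V -> W) :
  (forall x v (h : R), L (h *: v + x) = h *: l v + L x) -> continuous L ->
  bsmooth g -> bsmooth (g \o L).
Proof. by move=> Ll cL bg n; exact: bcn_affine. Qed.

Lemma cderive_affine (V W : normedModType R) (g : W -> 'C) (L l : V -> W) x v :
  (forall x v (h : R), L (h *: v + x) = h *: l v + L x) -> bsmooth g ->
  cderive v (g \o L) x = cderive (l v) g (L x).
Proof.
move=> Ll bg; apply: cderive_val; apply: is_cderive_affine (bsmooth_is_cderive _ _ bg) => h.
exact: Ll.
Qed.

End bounded_smooth.

(** * Supports and test functions *)

Section support.
Context (R : realType).
Local Notation "'C" := R[i].

Definition ball_supported (V : normedModType R) (M : R) (g : V -> 'C) :=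
  forall x, M < `|x| -> g x = 0.

Section normed.
Context (V : normedModType R).
Implicit Types (g : V -> 'C) (x v : V).

Lemma cderive_near0 g x v : (\forall y \near x, g y = 0) -> cderive v g x = 0.
Proof.
move=> g0; have [->|v0] := eqVneq v 0; first by rewrite /cderive !derive0.
rewrite /cderive (@near_eq_derive R V R^o _ (cst 0) x v)//; last first.
  by apply: filterS g0 => y /= ->.
rewrite (@near_eq_derive R V R^o (fun y => complex.Im (g y)) (cst 0) x v)//.
  by rewrite !derive_cst.
by apply: filterS g0 => y /= ->.
Qed.

Lemma ball_supported_cderive M g v : ball_supported M g -> ball_supported M (cderive v g).
Proof.
move=> gM x Mx; apply: cderive_near0.
have : \forall y \near x, M < `|y|.
  by apply: (cvgr_norm_gt x) => //; exact: cvg_id.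
by apply: filterS => y; exact: gM.
Qed.

Lemma csupport0 g x : ~ csupport g x -> g x = 0.
Proof.
by move=> xg; apply: contrapT => /eqP gx; apply: xg; exact: subset_closure.
Qed.

Lemma csupport_near0 g x : ~ csupport g x -> \forall y \near x, g y = 0.
Proof.
move=> xg; have : nbhs x (~` csupport g).
  by apply: open_nbhs_nbhs; split => //; apply: closed_openC; exact: closed_closure.
apply: filterS => y; exact: csupport0.
Qed.

Lemma csupport_cderive g v : csupport (cderive v g) `<=` csupport g.
Proof.
have cg : closed (csupport g) by exact: closed_closure.
rewrite [X in _ `<=` X]((closure_id _).1 cg); apply: closureS => x /=; apply: contra_neqP => xg.
exact: cderive_near0 (csupport_near0 xg).
Qed.

Lemma csupport_foldr g (vs : seq V) :
  csupport (foldr (@cderive R V) g vs) `<=` csupport g.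
Proof.
by elim: vs => //= v vs IH; apply: subset_trans (IH); exact: csupport_cderive.
Qed.

Lemma test_function_ball g : test_function g -> exists2 M, 0 < M & ball_supported M g.
Proof.
move=> [_ /compact_bounded[N [_ gN]]]; exists (`|N| + 1) => [|x Nx].
  by rewrite ltr_pwDr.
apply: csupport0 => xg; have NN : N < `|N| + 1.
  by rewrite (le_lt_trans (ler_norm N))// ltrDl.
by have /= := gN _ NN x xg; rewrite leNgt Nx.
Qed.

Lemma continuous_compact_bounded (u : V -> R) (K : set V) : continuous u ->
  compact K -> exists2 M, 0 <= M & forall x, K x -> `|u x| <= M.
Proof.
move=> cu cK; have : compact (u @` K).
  by apply: continuous_compact => //; exact: continuous_subspaceT.
move=> /(@compact_bounded R R^o) [N [_ uN]]; exists (`|N| + 1) => [|x Kx].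
  by rewrite addr_ge0.
by apply: (uN (`|N| + 1)) => //; rewrite (le_lt_trans (ler_norm N))// ltrDl.
Qed.

Lemma ccontinuous_compact_bounded g (K : set V) : ccontinuous g ->
  compact K -> exists2 M, 0 <= M & forall x, K x -> rnorm (g x) <= M.
Proof.
move=> [c1 c2] cK; have [M M0 gM] := continuous_compact_bounded c1 cK.
have [N N0 gN] := continuous_compact_bounded c2 cK.
exists (M + N) => [|x Kx]; first by rewrite addr_ge0.
by rewrite (le_trans (rnorm_le_ReIm _))// lerD// ?gM ?gN.
Qed.

Lemma is_smooth_cderive g v : is_smooth g -> is_smooth (cderive v g).
Proof. by move=> gs vs; have := gs (rcons vs v); rewrite /= foldr_rcons. Qed.

Lemma test_function_cderive g v : test_function g -> test_function (cderive v g).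
Proof.
move=> [gs gc]; split; first exact: is_smooth_cderive.
by apply: (subclosed_compact _ gc); [exact: closed_closure|exact: csupport_cderive].
Qed.

(** Compactness of the support supplies the bounds, and derivatives of test functions are test
    functions again. *)
Lemma test_function_bsmooth g : test_function g -> bsmooth g.
Proof.
move=> tg n; elim: n g tg => [|n IH] g tg; have [/(_ [::])/= [c1 c2 d1 d2] gc] := tg.
  split => //; have [M M0 gM] := ccontinuous_compact_bounded (conj c1 c2) gc.
  exists M => x; have [/gM//|/csupport0->] := pselect (csupport g x).
  by rewrite rnorm0.
split => //.
  have [M M0 gM] := ccontinuous_compact_bounded (conj c1 c2) gc.
  exists M => x; have [/gM//|/csupport0->] := pselect (csupport g x).
  by rewrite rnorm0.
move=> v; split => [x|]; last by apply: IH; exact: test_function_cderive.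
by split; apply/derivableP; [exact: d1|exact: d2].
Qed.

End normed.

Section row_vectors.
Context (m : nat).
Notation Z := ('rV[R]_m * 'rV[R]_m)%type.

Lemma normr_row_coord (x : 'rV[R]_m) j : `|x 0 j| <= `|x|.
Proof.
rewrite [leRHS]/Num.norm /= mx_normrE.
by apply: (le_trans _ (@le_bigmax _ _ _ _ (fun ij => `|x ij.1 ij.2|) (0, j))).
Qed.

Lemma normr_row_le (x : 'rV[R]_m) (M : R) : 0 <= M -> (forall j, `|x 0 j| <= M) -> `|x| <= M.
Proof.
move=> M0 xM; rewrite [leLHS]/Num.norm /= mx_normrE.
by apply: bigmax_le => // -[i j] _ /=; rewrite ord1.
Qed.

Lemma ball_supported_compact (M : R) (g : Z -> 'C) : ball_supported M g ->
  compact (csupport g).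
Proof.
move=> gM.
have cM : compact [set x : 'rV[R]_m | `|x| <= M].
  apply: bounded_closed_compact.
    by exists M; split; rewrite ?num_real// => N MN x /= /le_trans; apply; exact: ltW.
  rewrite (_ : [set _ | _] = Num.norm @^-1` [set r | r <= M])//.
  by apply: preimage_closed; [move=> x _; exact: norm_continuous|exact: closed_le].
apply: (subclosed_compact _ (compact_setX cM cM)); first exact: closed_closure.
have cMM := compact_closed (@norm_hausdorff _ _) (compact_setX cM cM).
rewrite [X in _ `<=` X]((closure_id _).1 cMM); apply: closureS => -[x y] /= xy;
  have : `|(x, y)| <= M.
  by rewrite leNgt; apply: contra_neqN xy => /gM.
by rewrite prod_normE /= ge_max => /andP[].
Qed.

End row_vectors.
End support.

(** * Flatness of almost holomorphic extensions *)

(* Unification would otherwise unfold derivatives when it compares them. *)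
Local Opaque derive.

Section flatness.
Context (R : realType) (m : nat).
Local Notation "'C" := R[i].
Notation Z := ('rV[R]_m * 'rV[R]_m)%type.
Implicit Types (g h : Z -> 'C) (v z : Z) (i j : 'I_m).

Lemma dbar_bsmooth j g : bsmooth g -> bsmooth (dbar j g).
Proof.
by move=> bg; apply: bsmoothZ; apply: bsmoothD; [|apply: bsmoothZ];
  exact: bsmooth_cderive.
Qed.

Lemma dbar_foldr_bsmooth (s : seq 'I_m) g : bsmooth g -> bsmooth (foldr (@dbar R m) g s).
Proof. by move=> bg; elim: s => //= j s; exact: dbar_bsmooth. Qed.

Lemma dbarD j g h z : bsmooth g -> bsmooth h ->
  dbar j (fun z => g z + h z) z = dbar j g z + dbar j h z.
Proof.
move=> bg bh; rewrite /dbar !cderiveD//.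
move: (cderive _ g z) (cderive _ h z) (cderive _ g z) (cderive _ h z) (0 +i* 1).
by move=> a b c d e; ring.
Qed.

Lemma dbarZ j (a : 'C) g z : bsmooth g -> dbar j (fun z => a * g z) z = a * dbar j g z.
Proof.
move=> bg; rewrite /dbar !cderiveZ//.
by move: (cderive _ g z) (cderive _ g z) (0 +i* 1) => c d e; ring.
Qed.

Lemma dbarM j g h z : bsmooth g -> bsmooth h ->
  dbar j (fun z => g z * h z) z = dbar j g z * h z + g z * dbar j h z.
Proof.
move=> bg bh; rewrite /dbar !cderiveM//.
move: (cderive _ g z) (cderive _ h z) (cderive _ g z) (cderive _ h z) (0 +i* 1).
by move: (g z) (h z) => p q a b c d e; ring.
Qed.

Lemma dbar_foldr_lin (s : seq 'I_m) (a : 'C) g h z : bsmooth g -> bsmooth h ->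
  foldr (@dbar R m) (fun z => a * g z + h z) s z =
  a * foldr (@dbar R m) g s z + foldr (@dbar R m) h s z.
Proof.
move=> bg bh; elim: s z => //= j s IH z; rewrite (funext IH).
have bs := dbar_foldr_bsmooth s bg; have bt := dbar_foldr_bsmooth s bh.
by rewrite dbarD ?dbarZ//; exact: bsmoothZ.
Qed.

Lemma cderive_dbarC j g v : bsmooth g -> cderive v (dbar j g) = dbar j (cderive v g).
Proof.
move=> bg; have br := bsmooth_cderive (re_dir R j) bg.
have bi := bsmooth_cderive (im_dir R j) bg.
apply/funext => z; rewrite {1}/dbar cderiveZ; last first.
  by apply: bsmoothD => //; exact: bsmoothZ.
rewrite (cderiveD _ _ br (bsmoothZ _ bi)) (cderiveZ _ _ _ bi).
rewrite (cderiveC z (re_dir R j) v bg).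
rewrite (cderiveC z (im_dir R j) v bg).
reflexivity.
Qed.

Lemma dbarC i j g : bsmooth g -> dbar i (dbar j g) = dbar j (dbar i g).
Proof.
move=> bg; have br := bsmooth_cderive (re_dir R i) bg.
have bi := bsmooth_cderive (im_dir R i) bg; apply/funext => z.
rewrite [RHS](@dbarZ j 2^-1 _ z (bsmoothD br (bsmoothZ (0 +i* 1) bi))).
rewrite (@dbarD j _ _ z br (bsmoothZ (0 +i* 1) bi)) (dbarZ _ _ z bi).
rewrite -(cderive_dbarC j (re_dir R i) bg) -(cderive_dbarC j (im_dir R i) bg).
reflexivity.
Qed.

Lemma dbar_foldrC j (s : seq 'I_m) g : bsmooth g ->
  dbar j (foldr (@dbar R m) g s) = foldr (@dbar R m) (dbar j g) s.
Proof.
move=> bg; elim: s => [|i s IH]; first reflexivity.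
rewrite [foldr _ _ _]/= [RHS]/= -IH; apply: dbarC; exact: dbar_foldr_bsmooth.
Qed.

Definition flat j g := forall N : nat, exists2 K, 0 <= K &
  forall z, rnorm (g z) <= K * `|z.2 0 j| ^+ N.

Lemma flatD j g h : flat j g -> flat j h -> flat j (fun z => g z + h z).
Proof.
move=> fg fh N; have [K K0 gK] := fg N; have [L L0 hL] := fh N.
exists (K + L) => [|z]; first by rewrite addr_ge0.
by rewrite mulrDl (le_trans (ler_rnormD _ _))// lerD.
Qed.

Lemma flatZ j (a : 'C) g : flat j g -> flat j (fun z => a * g z).
Proof.
move=> fg N; have [K K0 gK] := fg N.
exists (rnorm a * K) => [|z]; first by rewrite mulr_ge0// rnorm_ge0.
by rewrite rnormM -mulrA ler_wpM2l// rnorm_ge0.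
Qed.

(* Landau-type interpolation: a difference quotient with step |y_j|^N
   approximates the derivative up to O(|y_j|^N). *)
Lemma flat_cderive j g v : bsmooth g -> flat j g -> flat j (cderive v g).
Proof.
move=> bg fg [|N].
  have [M M0 gM] := bsmooth_bounded (bsmooth_cderive v bg).
  by exists M => // z; rewrite expr0 mulr1.
have [B B0 gB] := bsmooth_bounded (bsmooth_cderive v bg).
(* The difference quotient has step t^(N+1), so flatness of order 2(N+1) is what leaves order N+1
   after the division. *)
have [M M0 gM] := bsmooth_quad v bg; have [K K0 gK] := fg (N.+1 * 2)%N.
set a := 1 + `|v.2 0 j|; set L := M + K * (a ^+ (N.+1 * 2) + 1).
have a0 : 0 <= a by rewrite addr_ge0.
have L0 : 0 <= L by rewrite addr_ge0// mulr_ge0// addr_ge0// exprn_ge0.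
(* The parameter t is only required to dominate |y_j|: where y_j = 0 the choice t = |y_j| is
   impossible, and t tends to 0 instead. *)
have key z (t : R) : 0 < t -> t <= 1 -> `|z.2 0 j| <= t ->
    rnorm (cderive v g z) <= L * t ^+ N.+1.
  move=> t0 t1 yt; have tN0 : 0 < t ^+ N.+1 by rewrite exprn_gt0.
  rewrite -(ler_pM2l tN0) -[X in X * rnorm _](gtr0_norm tN0) -rnormC -rnormM.
  set d := _%:C * _; set s := t ^+ N.+1.
  have -> : d = g (s *: v + z) - g z - (g (s *: v + z) - g z - d) by ring.
  apply: le_trans (ler_rnormB _ _) _.
  apply: (@le_trans _ _ ((K * (a * t) ^+ (N.+1 * 2) + K * t ^+ (N.+1 * 2)) + M * s ^+ 2)).
    apply: lerD; last exact: gM.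
    apply: le_trans (ler_rnormB _ _) _; apply: lerD.
      apply: le_trans (gK _) _; apply: ler_wpM2l => //.
      apply: ler_wXn2r => //; rewrite /= !mxE; apply: le_trans (ler_normD _ _) _;
        rewrite normrM mulrDl mul1r addrC.
      apply: lerD => //; rewrite mulrC; apply: ler_wpM2l => //.
      rewrite /s (gtr0_norm tN0) exprS.
      by apply: ler_piMr; [exact: ltW|apply: exprn_ile1 => //; exact: ltW].
    apply: le_trans (gK _) _; apply: ler_wpM2l => //.
    exact: ler_wXn2r.
  by rewrite exprMn !exprM -/s /L exprM; apply: eq_ler; ring.
exists (B + L) => [|z]; first by rewrite addr_ge0.
have [y1|y1] := leP 1 `|z.2 0 j|.
  apply: le_trans (gB z) _; rewrite -[leLHS]mulr1; apply: ler_pM => //.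
    by rewrite lerDl.
  exact: exprn_ege1.
have [y0|y0] := eqVneq (z.2 0 j) 0.
  suff -> : cderive v g z = 0 by rewrite rnorm0; apply: mulr_ge0;
    [exact: addr_ge0|exact: exprn_ge0].
  apply: (@eq0_rnorm_le _ _ _ L) => e e0 e1.
  apply: le_trans (key z e e0 e1 _) _; first by rewrite y0 normr0 ltW.
  apply: ler_wpM2l => //; rewrite exprS.
  by apply: ler_piMr; [exact: ltW|apply: exprn_ile1 => //; exact: ltW].
apply: le_trans (key z _ _ (ltW y1) (lexx _)) _; first by rewrite normr_gt0.
by rewrite ler_wpM2r ?exprn_ge0// lerDr.
Qed.

Lemma flat_dbar i j g : bsmooth g -> flat j g -> flat j (dbar i g).
Proof.
by move=> bg fg; apply: flatZ; apply: flatD; [|apply: flatZ]; exact: flat_cderive.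
Qed.

(** Only [dbar j g] is known to be flat, so [dbar j] is commuted to the innermost place; the
    remaining derivatives then preserve flatness. *)
Lemma flat_dbar_foldr j (s : seq 'I_m) g : bsmooth g -> flat j (dbar j g) -> j \in s ->
  flat j (foldr (@dbar R m) g s).
Proof.
move=> bg fg; elim: s => [|i s IH]; first by rewrite in_nil.
rewrite inE => /orP[/eqP <-|/IH js]; rewrite [foldr _ _ _]/=.
  rewrite (dbar_foldrC j s bg); elim: s {IH} => [|k s IH]; first exact: fg.
  by apply: flat_dbar; [apply: dbar_foldr_bsmooth; exact: dbar_bsmooth|exact: IH].
by apply: flat_dbar; [exact: dbar_foldr_bsmooth|exact: js].
Qed.

Definition prod_im z : R := \prod_(j < m) `|z.2 0 j|.

Lemma prod_im_ge0 z : 0 <= prod_im z.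
Proof. by apply: prodr_ge0. Qed.

(** Take for j the index with the smallest |Im z_j|: the power N m of this one number is at most the
    N-th power of the product. Flatness in each variable separately thus gives a weight controlling
    all the resolvents at once. *)
Lemma flat_prod_im g : (0 < m)%N -> (forall j, flat j g) -> forall N : nat,
  exists2 K, 0 <= K & forall z, rnorm (g z) <= K * prod_im z ^+ N.
Proof.
move=> m0 fg N; have /choice[K gK] : forall j, exists K : R, 0 <= K /\
    forall z, rnorm (g z) <= K * `|z.2 0 j| ^+ (N * m).
  by move=> j; have [K ? ?] := fg j (N * m)%N; exists K.
exists (\sum_j K j) => [|z]; first by apply: sumr_ge0 => j _; case: (gK j).
pose j0 := Ordinal m0.
pose j := [arg min_(i < j0) `|z.2 0 i|]%O.
have jmin i : `|z.2 0 j| <= `|z.2 0 i| by rewrite /j; case: arg_minP => // k _; exact.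
have [Kj gj] := gK j; apply: le_trans (gj z) _; apply: ler_pM => //.
  by rewrite (bigD1 j)//= lerDl; apply: sumr_ge0 => i _; case: (gK i).
rewrite mulnC exprM; apply: ler_wXn2r; first exact: exprn_ge0.
rewrite -[X in _ ^+ X](card_ord m) -prodr_const; apply: ler_prod => i _.
by rewrite normr_ge0 jmin.
Qed.

Definition real_flat g := forall (vs : seq Z) x, foldr (@cderive R Z) g vs (x, 0) = 0.

Lemma flat_real_flat j g : bsmooth g -> flat j g -> real_flat g.
Proof.
move=> bg fg vs x; have fvs : flat j (foldr (@cderive R Z) g vs).
  by elim: vs => //= v vs IH; apply: flat_cderive => //; exact: bsmooth_foldr.
have [K K0 /(_ (x, 0))] := fvs 1%N.
rewrite /= mxE normr0 mulr0 => h; apply: rnorm_eq0; apply/eqP.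
by rewrite eq_le rnorm_ge0 h.
Qed.

Lemma point_sum_dir v :
  v = \sum_j (v.1 0 j *: re_dir R j) + \sum_j (v.2 0 j *: im_dir R j).
Proof.
have f1 (F : 'I_m -> Z) : (\sum_j F j).1 = \sum_j (F j).1 by exact: (big_morph fst).
have f2 (F : 'I_m -> Z) : (\sum_j F j).2 = \sum_j (F j).2 by exact: (big_morph snd).
apply: injective_projections.
  rewrite /= f1 [X in _ = _ + X](_ : _ = 0) ?addr0; first exact: row_sum_delta.
  by rewrite f1 big1// => j _; rewrite /= scaler0.
rewrite /= f2 [X in _ = X + _](_ : _ = 0) ?add0r; last first.
  by rewrite big1// => j _; rewrite /= scaler0.
by rewrite f2; exact: row_sum_delta.
Qed.

(** Solving the definition of dbar for the imaginary direction gives d/dy = i d/dx - 2i dbar. Modulo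
    the functions [dbar j g], every derivative is a combination of derivatives in real
    directions. *)
Lemma cderive_dbar_expand g v z : bsmooth g -> cderive v g z =
  \sum_j ((v.1 0 j +i* v.2 0 j) * cderive (re_dir R j) g z +
          (0 +i* (- 2 * v.2 0 j)) * dbar j g z).
Proof.
move=> bg; rewrite [in LHS](point_sum_dir v) cderiveDv// !cderive_sumv// -big_split/=.
apply: eq_bigr => j _; rewrite !cderiveZv// /dbar.
set a := cderive _ _ _; set b := cderive (im_dir _ _) _ _.
have i2 : (0 +i* 1 : 'C) ^+ 2 = -1 by exact: sqr_i.
have -> : v.1 0 j +i* v.2 0 j = (v.1 0 j)%:C + (0 +i* 1) * (v.2 0 j)%:C.
  by apply/eqP; rewrite eq_complex /=; apply/andP; split; apply/eqP; ring.
have -> : 0 +i* (- 2 * v.2 0 j) = - 2 * (0 +i* 1) * (v.2 0 j)%:C.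
  by apply/eqP; rewrite eq_complex /=; apply/andP; split; apply/eqP; ring.
move: (_%:C) (_%:C) a b i2 => p q a b i2; have n2 : (2 : 'C) != 0 by rewrite pnatr_eq0.
by field: i2.
Qed.

Lemma foldr_cderiveD (vs : seq Z) g h z : bsmooth g -> bsmooth h ->
  foldr (@cderive R Z) (fun z => g z + h z) vs z =
  foldr (@cderive R Z) g vs z + foldr (@cderive R Z) h vs z.
Proof.
move=> bg bh; elim: vs z => //= v vs IH z.
by rewrite (funext IH) cderiveD//; exact: bsmooth_foldr.
Qed.

Lemma foldr_cderiveZ (vs : seq Z) (a : 'C) g z : bsmooth g ->
  foldr (@cderive R Z) (fun z => a * g z) vs z = a * foldr (@cderive R Z) g vs z.
Proof.
move=> bg; elim: vs z => //= v vs IH z.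
by rewrite (funext IH) cderiveZ//; exact: bsmooth_foldr.
Qed.

Lemma bsmooth_sum (I : Type) (s : seq I) (F : I -> Z -> 'C) :
  (forall k, bsmooth (F k)) -> bsmooth (fun z => \sum_(k <- s) F k z).
Proof.
move=> bF; elim: s => [|k s IH].
  by under eq_fun do rewrite big_nil; exact: bsmooth_cst.
by under eq_fun do rewrite big_cons; exact: bsmoothD.
Qed.

Lemma foldr_cderive_sum (vs : seq Z) (I : Type) (s : seq I) (F : I -> Z -> 'C) z :
  (forall k, bsmooth (F k)) ->
  foldr (@cderive R Z) (fun z => \sum_(k <- s) F k z) vs z =
  \sum_(k <- s) foldr (@cderive R Z) (F k) vs z.
Proof.
move=> bF; elim: s z => [|k s IH] z.
  under eq_fun do rewrite big_nil; rewrite big_nil.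
  by elim: vs z => //= v vs IH z; rewrite (funext IH) cderive_cst.
under eq_fun do rewrite big_cons.
by rewrite foldr_cderiveD// ?IH ?big_cons//; exact: bsmooth_sum.
Qed.

Lemma cderive_re_dir0 g j x : bsmooth g -> (forall x, g (x, 0) = 0) ->
  cderive (re_dir R j) g (x, 0) = 0.
Proof.
move=> bg g0; pose L (x : 'rV[R]_m) : Z := (x, 0).
have Ll (y w : 'rV[R]_m) (a : R) : L (a *: w + y) = a *: L w + L y.
  by apply: injective_projections; rewrite //= scaler0 addr0.
rewrite -[re_dir R j]/(L (delta_mx 0 j)) -[(x, 0)]/(L x).
rewrite -(cderive_affine (l := L) x (delta_mx 0 j) Ll bg).
rewrite (_ : g \o L = fun=> 0); first exact: cderive_cst.
by apply/funext => y; rewrite /= g0.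
Qed.

(** Induction on the number of derivatives. The innermost one is replaced by real directions, the
    dbar terms being flat and so vanishing with all derivatives on the real points. A real
    derivative is then moved outermost, where it is tangent to the real points and acts on a
    function that vanishes there by induction. *)
Lemma dbar_flat_real_flat h : bsmooth h -> (forall x, h (x, 0) = 0) ->
  (forall j, flat j (dbar j h)) -> real_flat h.
Proof.
move=> bh h0 hd vs; elim/last_ind : vs => [|vs v IH] x; first exact: h0.
rewrite foldr_rcons (funext (fun z => cderive_dbar_expand v z bh)).
have bd j := dbar_bsmooth j bh; have br j := bsmooth_cderive (re_dir R j) bh.
rewrite foldr_cderive_sum => [|j]; last by apply: bsmoothD; exact: bsmoothZ.
apply: big1 => j _; rewrite (foldr_cderiveD _ _ (bsmoothZ _ (br j)) (bsmoothZ _ (bd j))).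
rewrite (foldr_cderiveZ _ _ _ (br j)) (foldr_cderiveZ _ _ _ (bd j)).
rewrite (flat_real_flat (bd j) (hd j)) mulr0 addr0 -cderive_foldrC//.
by rewrite cderive_re_dir0 ?mulr0//; exact: bsmooth_foldr.
Qed.

(** Moving from (x, 0) to (x, y), the mean value theorem gains one power of |y|; the derivatives in
    imaginary directions are again flat on the real points, so the induction applies to them. *)
Lemma real_flat_bound h : bsmooth h -> real_flat h -> forall N : nat,
  exists2 K, 0 <= K & forall z, rnorm (h z) <= K * `|z.2| ^+ N.
Proof.
move=> bh hf N; elim: N h bh hf => [|N IH] h bh hf.
  have [M M0 hM] := bsmooth_bounded bh.
  by exists M => // z; rewrite expr0 mulr1.
have /choice[K hK] : forall j, exists K : R, 0 <= K /\
    forall z, rnorm (cderive (im_dir R j) h z) <= K * `|z.2| ^+ N.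
  move=> j; have [||K ? ?] := IH (cderive (im_dir R j) h).
  - exact: bsmooth_cderive.
  - by move=> vs x; have := hf (rcons vs (im_dir R j)) x; rewrite foldr_rcons.
  - by exists K.
have K0 j : 0 <= K j by case: (hK j).
exists (2 * \sum_j K j) => [|[x y]]; first by rewrite mulr_ge0// sumr_ge0.
have := @mean_value R _ h (cderive (0, y) h) (x, 0) (0, y)
  ((\sum_j K j) * `|y| ^+ N.+1) 1.
rewrite scale1r normr1 mulr1 (hf [::] x : h (x, 0) = 0) subr0 mulrA.
rewrite (_ : (0, y) + (x, 0) = (x, y)); last first.
  by apply: injective_projections; rewrite /= ?add0r ?addr0.
apply=> [z|t t1]; first exact: bsmooth_is_cderive.
rewrite [X in cderive X h](_ : (0, y) = \sum_j y 0 j *: im_dir R j); last first.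
  rewrite [LHS]point_sum_dir /= big1 ?add0r// => j _.
  by rewrite mxE scale0r.
rewrite cderive_sumv//; apply: le_trans (ler_rnorm_sum _ _ _) _.
rewrite mulr_suml; apply: ler_sum => j _; rewrite cderiveZv// rnormM rnormC.
rewrite exprS mulrCA; apply: ler_pM; rewrite ?rnorm_ge0//; first exact: normr_row_coord.
apply: le_trans ((hK j).2 _) _; apply: ler_wpM2l => //=.
rewrite addr0 normrZ; apply: ler_wXn2r; first exact: mulr_ge0.
by rewrite ler_piMl.
Qed.

End flatness.

(** * Bochner integrals as limits of Riemann sums *)

Section rnorm_convergence.
Context (R : realType) (V : normedModType R[i]).

Lemma cvg_rnormP (u : nat -> V) (l : V) : u @ \oo --> l <->
  forall e : R, 0 < e -> exists N : nat, forall n, (N <= n)%N -> rnorm (u n - l) <= e.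
Proof.
split=> [ul e e0|h].
  have e0' : 0 < e%:C by rewrite ltcR.
  have /cvgrPdist_le /(_ _ e0') [N _ hN] := ul.
  by exists N => n Nn; have := hN n Nn; rewrite /= rnormE lecR rnormB.
apply/cvgrPdist_le => e e0; have [N hN] : exists N : nat, forall n, (N <= n)%N ->
    rnorm (u n - l) <= complex.Re e.
  by apply: h; move: e0; rewrite ltcE /= => /andP[].
exists N => // n Nn; rewrite /= rnormE rnormB.
have -> : e = (complex.Re e)%:C.
  by move: e0; rewrite ltcE /=; case: e {hN} => a b /= /andP[/eqP -> _].
by rewrite lecR; exact: hN.
Qed.

End rnorm_convergence.

Section simple_functions.
Context d (T : measurableType d) (R : realType).
Context (mu : {measure set T -> \bar R}) (V : normedModType R[i]).
Implicit Types (s : seq (set T * V)) (f : T -> V).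

Lemma simple_fun_nil t : simple_fun ([::] : seq (set T * V)) t = 0.
Proof. by rewrite /simple_fun big_nil. Qed.

Lemma simple_fun_cons A v s t :
  simple_fun ((A, v) :: s) t = (if t \in A then v else 0) + simple_fun s t.
Proof.
rewrite /simple_fun big_cons /= indicE.
by case: (t \in A); rewrite ?scale1r ?scale0r.
Qed.

Lemma is_simple_cons A v s : is_simple mu ((A, v) :: s) <->
  [/\ measurable A, (mu A < +oo)%E & is_simple mu s].
Proof.
split=> [h|[mA fA ss] p].
  have [mA fA] := h (A, v) (mem_head _ _).
  by split=> // p ps; apply: h; rewrite inE ps orbT.
by rewrite inE => /orP[/eqP ->|/ss].
Qed.

Lemma setID_setD (D A : set T) : D = (D `&` A) `|` (D `\` A).
Proof.
apply/seteqP; split=> [t Dt|t [[]|[]]//].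
by have [At|At] := pselect (A t); [left|right].
Qed.

Lemma simple_fun_cons_in A v s t : A t -> simple_fun ((A, v) :: s) t = v + simple_fun s t.
Proof. by move=> At; rewrite simple_fun_cons mem_set. Qed.

Lemma simple_fun_cons_notin A v s t : ~ A t -> simple_fun ((A, v) :: s) t = simple_fun s t.
Proof. by move=> At; rewrite simple_fun_cons memNset ?add0r. Qed.

Lemma measurable_rnorm_simple s (w : V) D : measurable D -> is_simple mu s ->
  measurable_fun D (fun t => rnorm (w + simple_fun s t)).
Proof.
elim: s w D => [|[A v] s IH] w D mD.
  by move=> _; under eq_fun do rewrite simple_fun_nil; exact: measurable_cst.
move=> /is_simple_cons[mA _ ss]; rewrite (setID_setD D A).
have mDA := measurableI D A mD mA; have mDA' := measurableD mD mA.
apply/(measurable_funU _ mDA mDA'); split.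
  apply: (eq_measurable_fun (fun t => rnorm ((w + v) + simple_fun s t))) => [t|].
    by move=> /set_mem[_ At]; rewrite simple_fun_cons_in// addrA.
  exact: IH.
apply: (eq_measurable_fun (fun t => rnorm (w + simple_fun s t))) => [t|].
  by move=> /set_mem[_ At]; rewrite simple_fun_cons_notin.
exact: IH.
Qed.

Let fine_measureID (A B : set T) : measurable A -> measurable B -> (mu A < +oo)%E ->
  fine (mu A) = fine (mu (A `&` B)) + fine (mu (A `\` B)).
Proof.
move=> mA mB fA; rewrite (measureDI mu mA mB) fineD; first exact: addrC.
  rewrite ge0_fin_numE//; apply: le_lt_trans fA; apply: le_measure; rewrite ?inE//.
  exact: measurableD.
rewrite ge0_fin_numE//; apply: le_lt_trans fA; apply: le_measure; rewrite ?inE//.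
exact: measurableI.
Qed.

(* Splitting [E] along the first set of the list reduces to a shorter list with
   a new constant [w] on each part, so no disjointness is needed. *)
Lemma rnorm_simple_integral_in s (w : V) E : measurable E -> (mu E < +oo)%E ->
  is_simple mu s ->
  ((rnorm ((fine (mu E))%:C *: w + \sum_(p <- s) (fine (mu (E `&` p.1)))%:C *: p.2))%:E
   <= \int[mu]_(t in E) (rnorm (w + simple_fun s t))%:E)%E.
Proof.
elim: s w E => [|[A v] s IH] w E mE fE.
  move=> _; rewrite big_nil addr0.
  under eq_integral do rewrite simple_fun_nil addr0.
  rewrite integral_cst// rnormZ rnormC ger0_norm ?fine_ge0// muleC EFinM fineK//.
  by rewrite ge0_fin_numE.
move=> scs; have /is_simple_cons[mA fA ss] := scs.
have mEA := measurableI E A mE mA; have mEA' := measurableD mE mA.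
have fEA : (mu (E `&` A) < +oo)%E.
  by apply: le_lt_trans fE; apply: le_measure; rewrite ?inE.
have fEA' : (mu (E `\` A) < +oo)%E.
  by apply: le_lt_trans fE; apply: le_measure; rewrite ?inE.
rewrite [in leRHS](setID_setD E A) ge0_integral_setU//; last 3 first.
- apply/measurable_realfun.measurable_EFinP/measurable_rnorm_simple => //.
  exact: measurableU.
- by move=> t _; rewrite lee_fin rnorm_ge0.
- by apply/disj_setPS => t [[_ At] [_ nAt]].
have -> : (\int[mu]_(t in E `&` A) (rnorm (w + simple_fun ((A, v) :: s) t))%:E =
    \int[mu]_(t in E `&` A) (rnorm ((w + v) + simple_fun s t))%:E)%E.
  by apply: eq_integral => t /set_mem[_ At]; rewrite simple_fun_cons_in// addrA.
have -> : (\int[mu]_(t in E `\` A) (rnorm (w + simple_fun ((A, v) :: s) t))%:E =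
    \int[mu]_(t in E `\` A) (rnorm (w + simple_fun s t))%:E)%E.
  by apply: eq_integral => t /set_mem[_ At]; rewrite simple_fun_cons_notin.
apply: le_trans (leeD (IH (w + v) _ mEA fEA ss) (IH w _ mEA' fEA' ss)).
rewrite -EFinD lee_fin; apply: le_trans (ler_rnormD _ _); apply: eq_ler; congr rnorm.
rewrite big_cons /= (fine_measureID mE mA fE) rmorphD /= scalerDl scalerDr.
have -> : \sum_(p <- s) (fine (mu (E `&` p.1)))%:C *: p.2 =
    \sum_(p <- s) (fine (mu (E `&` A `&` p.1)))%:C *: p.2 +
    \sum_(p <- s) (fine (mu ((E `\` A) `&` p.1)))%:C *: p.2.
  rewrite -big_split /=; apply: eq_big_seq => p ps; have [mp fp] := ss p ps.
  have fEp : (mu (E `&` p.1) < +oo)%E.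
    apply: le_lt_trans fp; apply: le_measure; rewrite ?inE//.
    exact: measurableI.
  rewrite (fine_measureID (measurableI _ _ mE mp) mA fEp) rmorphD /= scalerDl.
  by rewrite !setDE ![E `&` _ `&` p.1]setIAC.
by rewrite addrA [_ *: w + _ *: w + _]addrAC addrACA.
Qed.

Lemma rnorm_simple_integral s : is_simple mu s ->
  ((rnorm (simple_integral mu s))%:E <= \int[mu]_t (rnorm (simple_fun s t))%:E)%E.
Proof.
(* The localised inequality is used on the union of all the sets of the list, which has finite
   measure and on which intersecting changes nothing. *)
move=> ss; pose E := \big[setU/set0]_(p <- s) p.1.
have mE : measurable E.
  by rewrite /E big_seq; apply: bigsetU_measurable => p ps; case: (ss p ps).
have fE : (mu E < +oo)%E.
  rewrite /E; elim: s ss {E mE} => [|[A v] s IH]; first by rewrite big_nil measure0.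
  move=> /is_simple_cons[mA fA ss]; rewrite big_cons /=.
  apply: le_lt_trans (lte_add_pinfty fA (IH ss)); apply: measureU2 => //.
  by rewrite big_seq; apply: bigsetU_measurable => p ps; case: (ss p ps).
have := rnorm_simple_integral_in 0 mE fE ss; rewrite scaler0 add0r.
have -> : \sum_(p <- s) (fine (mu (E `&` p.1)))%:C *: p.2 = simple_integral mu s.
  apply: eq_big_seq => p ps; congr ((fine (mu _))%:C *: _); apply/setIidPr.
  by rewrite /E (big_rem p)//=; exact: subsetUl.
under eq_integral do rewrite add0r.
move=> /le_trans; apply; apply: ge0_subset_integral => //.
  apply/measurable_realfun.measurable_EFinP; have := measurable_rnorm_simple 0 measurableT ss.
  by under eq_fun do rewrite add0r.
by move=> t _; rewrite lee_fin rnorm_ge0.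
Qed.

End simple_functions.

Section bochner_limits.
Context d (T : measurableType d) (R : realType).
Context (mu : {measure set T -> \bar R}) (V : normedModType R[i]).
Implicit Types (s : seq (set T * V)) (f : T -> V).

Let simple_sub s s' : seq (set T * V) := s ++ [seq (p.1, - p.2) | p <- s'].

Let is_simple_sub s s' : is_simple mu s -> is_simple mu s' -> is_simple mu (simple_sub s s').
Proof.
by move=> ss ss' p; rewrite mem_cat => /orP[/ss//|/mapP[q qs' ->]]; exact: ss' qs'.
Qed.

Let simple_fun_sub s s' t :
  simple_fun (simple_sub s s') t = simple_fun s t - simple_fun s' t.
Proof.
rewrite /simple_fun big_cat big_map /= -sumrN; congr (_ + _).
by apply: eq_bigr => p _; rewrite scalerN.
Qed.

Let simple_integral_sub s s' :
  simple_integral mu (simple_sub s s') = simple_integral mu s - simple_integral mu s'.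
Proof.
rewrite /simple_integral big_cat big_map /= -sumrN; congr (_ + _).
by apply: eq_bigr => p _; rewrite scalerN.
Qed.

(** Convergence is asked at every point: the norms of the differences are then measurable as limits,
    with no appeal to completeness of the measure. The grid functions below do converge
    everywhere. *)
Definition simple_limit f := exists2 s : nat -> seq (set T * V),
  forall n, is_simple mu (s n) & forall t, (fun n => simple_fun (s n) t) @ \oo --> f t.

Lemma measurable_rnorm_limit f s : simple_limit f -> is_simple mu s ->
  measurable_fun setT (fun t => rnorm (f t - simple_fun s t)).
Proof.
move=> [u us uf] ss.
apply: (@measurable_realfun.measurable_fun_cvg _ _ _ _
  (fun n t => rnorm (0 + simple_fun (simple_sub (u n) s) t))) => [n|t _].
  by apply: measurable_rnorm_simple => //; exact: is_simple_sub.
apply/cvgrPdist_le => e e0; have [N hN] := (cvg_rnormP _ _).1 (uf t) e e0.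
exists N => // n Nn; rewrite /= add0r simple_fun_sub.
apply: le_trans (hN n Nn); apply: le_trans (ler_dist_rnorm _ _) _.
by rewrite opprB addrA subrK rnormB.
Qed.

Lemma simple_integral_dist f s s' : simple_limit f -> is_simple mu s -> is_simple mu s' ->
  ((rnorm (simple_integral mu s - simple_integral mu s'))%:E <=
   \int[mu]_t (rnorm (f t - simple_fun s t))%:E +
   \int[mu]_t (rnorm (f t - simple_fun s' t))%:E)%E.
Proof.
move=> lf ss ss'; rewrite -simple_integral_sub.
apply: le_trans (rnorm_simple_integral (is_simple_sub ss ss')) _.
have m1 := measurable_rnorm_limit lf ss; have m2 := measurable_rnorm_limit lf ss'.
rewrite -ge0_integralD//; last 4 first.
- by move=> t _; rewrite lee_fin rnorm_ge0.
- exact/measurable_realfun.measurable_EFinP.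
- by move=> t _; rewrite lee_fin rnorm_ge0.
- exact/measurable_realfun.measurable_EFinP.
apply: ge0_le_integral => //.
- by move=> t _; rewrite lee_fin rnorm_ge0.
- apply/measurable_realfun.measurable_EFinP.
  have := measurable_rnorm_simple 0 measurableT (is_simple_sub ss ss').
  by under eq_fun do rewrite add0r.
- by apply/measurable_realfun.measurable_EFinP/measurable_realfun.measurable_funD.
move=> t _; rewrite -EFinD lee_fin simple_fun_sub rnormB.
by apply: le_trans (ler_rnormB _ _); rewrite opprB [f t - _ + _]addrC addrA subrK.
Qed.

(** Two approximating sequences are compared by integrating a triangle inequality, for which
    [simple_limit] supplies the measurability. Of the total 4e, two e come from the integrals and
    two from the limits of the simple integrals. *)
Lemma has_bochner_integral_unique f I J : simple_limit f ->
  has_bochner_integral mu f I -> has_bochner_integral mu f J -> I = J.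
Proof.
move=> lf [s [ss _ s0 sI]] [s' [ss' _ s'0 sJ]].
apply/eqP; rewrite -subr_eq0; apply/eqP; apply: (@eq0_rnorm_le _ _ _ 4) => e e0 _.
have small (u : nat -> \bar R) : u @ \oo --> 0%E ->
    exists N, forall n, (N <= n)%N -> (u n <= e%:E)%E.
  move=> u0; have : nbhs (0%E : \bar R) [set y | (y < e%:E)%E].
    by apply: open_nbhs_nbhs; split; [exact: open_ereal_lt_ereal|rewrite /= lte_fin].
  by move=> /u0[N _ hN]; exists N => n /hN /ltW.
have [N1 h1] := small _ s0; have [N2 h2] := small _ s'0.
have [N3 h3] := (cvg_rnormP _ _).1 sI e e0; have [N4 h4] := (cvg_rnormP _ _).1 sJ e e0.
pose n := (maxn (maxn N1 N2) (maxn N3 N4)).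
have h : rnorm (simple_integral mu (s n) - simple_integral mu (s' n)) <= e + e.
  rewrite -lee_fin EFinD; apply: le_trans (simple_integral_dist lf (ss n) (ss' n)) _.
  by apply: leeD; [apply: h1|apply: h2]; rewrite /n !leq_max leqnn ?orbT.
have -> : 4 * e = (e + e) + e + e by ring.
have -> : I - J = (simple_integral mu (s n) - simple_integral mu (s' n)) -
    (simple_integral mu (s n) - I) + (simple_integral mu (s' n) - J).
  by rewrite opprB [_ - _ + (I - _)]addrC !addrA !subrK.
apply: le_trans (ler_rnormD _ _) _; apply: lerD; last first.
  by apply: h4; rewrite /n !leq_max leqnn ?orbT.
apply: le_trans (ler_rnormB _ _) _; apply: lerD => //.
by apply: h3; rewrite /n !leq_max leqnn ?orbT.
Qed.

Lemma has_bochner_integralE f I : simple_limit f -> has_bochner_integral mu f I ->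
  bochner_integral mu f = I.
Proof.
move=> lf fI; apply: (has_bochner_integral_unique lf) (fI).
by rewrite /bochner_integral; case: xgetP => [J -> //|/(_ I)].
Qed.

Section uniform.
Context (f : T -> V) (s : nat -> seq (set T * V)) (eps : nat -> R) (E : set T).
Hypotheses (ss : forall n, is_simple mu (s n)) (mE : measurable E) (fE : (mu E < +oo)%E).
Hypothesis sf : forall n t, rnorm (f t - simple_fun (s n) t) <= eps n.
Hypothesis sE : forall n t, ~ E t -> f t = simple_fun (s n) t.
Hypothesis eps0 : eps @ \oo --> 0.

Lemma uniform_simple_limit : simple_limit f.
Proof.
exists s => // t; apply/cvg_rnormP => e e0.
have /cvgrPdist_le /(_ _ e0)[N _ hN] := eps0; exists N => // n Nn.
rewrite rnormB; apply: le_trans (sf n t) _; apply: le_trans (hN n Nn).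
by rewrite sub0r normrN ler_norm.
Qed.

Lemma uniform_integral_le n :
  (\int[mu]_t (rnorm (f t - simple_fun (s n) t))%:E <= (eps n * fine (mu E))%:E)%E.
Proof.
have -> : (\int[mu]_t (rnorm (f t - simple_fun (s n) t))%:E =
    \int[mu]_(t in E) (rnorm (f t - simple_fun (s n) t))%:E)%E.
  rewrite [RHS]integral_mkcond; apply: eq_integral => t _; rewrite patchE.
  case: ifPn => // /negP tE; rewrite (sE n) ?subrr ?rnorm0// => Et; apply: tE.
  exact/mem_set.
have -> : ((eps n * fine (mu E))%:E = \int[mu]_(t in E) (cst (eps n)%:E) t)%E.
  by rewrite integral_cst// EFinM fineK// ge0_fin_numE.
apply: ge0_le_integral => //.
- by move=> t _; rewrite lee_fin rnorm_ge0.
- apply/measurable_realfun.measurable_EFinP; apply: measurable_funTS.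
  by apply: measurable_rnorm_limit => //; exact: uniform_simple_limit.
by move=> t _; rewrite lee_fin.
Qed.

(** The right-hand side tends to 0, so the simple integrals form a Cauchy sequence before any value
    of the integral is known. *)
Lemma uniform_simple_integral_dist n k :
  rnorm (simple_integral mu (s n) - simple_integral mu (s k)) <=
  (eps n + eps k) * fine (mu E).
Proof.
rewrite -lee_fin mulrDl EFinD.
apply: le_trans (simple_integral_dist uniform_simple_limit (@ss n) (@ss k)) _.
by apply: leeD; exact: uniform_integral_le.
Qed.

Lemma uniform_has_bochner_integral I :
  (fun n => simple_integral mu (s n)) @ \oo --> I -> has_bochner_integral mu f I.
Proof.
move=> sI; exists s; split => //.
  apply: aeW => t; apply/cvg_rnormP => e e0.
  have /cvgrPdist_le /(_ _ e0)[N _ hN] := eps0; exists N => // n Nn.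
  rewrite rnormB; apply: le_trans (sf n t) _; apply: le_trans (hN n Nn).
  by rewrite sub0r normrN ler_norm.
apply: (@squeeze_cvge _ _ _ _ (fun=> 0%E) _ (fun n => (eps n * fine (mu E))%:E)).
- near=> n; rewrite uniform_integral_le andbT integral_ge0// => t _.
  by rewrite lee_fin rnorm_ge0.
- exact: cvg_cst.
apply: cvg_EFin; first by near=> n.
rewrite /comp /= -[X in _ --> X](mul0r (fine (mu E))).
by apply: cvgM => //; exact: cvg_cst.
Unshelve. all: by end_near. Qed.

Lemma uniform_bochner_integralE I :
  (fun n => simple_integral mu (s n)) @ \oo --> I -> bochner_integral mu f = I.
Proof.
move=> sI; apply: has_bochner_integralE; first exact: uniform_simple_limit.
exact: uniform_has_bochner_integral.
Qed.

End uniform.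
End bochner_limits.

(** * Completeness of the space of bounded operators *)

Section bounded_operator_norm.
Context (R : realType) (B : normedModType R[i]).

Lemma rnorm_bop_apply (S : bop B) x : rnorm (S x) <= rnorm S * rnorm x.
Proof.
have [Sl _] := bopP S; have S0 : S 0 = 0.
  by have := Sl (-1) 0 0; rewrite scaler0 addr0 scaleN1r addNr.
have [->|x0] := eqVneq x 0; first by rewrite S0 !rnorm0 mulr0.
have rx0 : 0 < rnorm x by rewrite rnorm_gt0.
have := bop_le_opnorm S (x := ((rnorm x)^-1)%:C *: x).
rewrite -[X in S X]addr0 Sl S0 addr0 !rnormZ rnormC ger0_norm ?invr_ge0 ?rnorm_ge0//.
rewrite mulVf ?gt_eqF// lexx => /(_ isT).
by rewrite ler_pdivrMl// mulrC.
Qed.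

Lemma rnorm_bop_le (S : bop B) (M : R) : 0 <= M ->
  (forall x, rnorm (S x) <= M * rnorm x) -> rnorm S <= M.
Proof.
move=> M0 SM; apply: opnorm_le => x x1; apply: le_trans (SM x) _.
by rewrite ler_piMr.
Qed.

End bounded_operator_norm.

Section bounded_operator_limit.
Context (R : realType) (B : completeNormedModType R[i]).

Lemma cauchy_seq_cvg (u : nat -> B) :
  (forall e : R, 0 < e -> exists N : nat, forall n k, (N <= n)%N -> (N <= k)%N ->
    rnorm (u n - u k) <= e) -> exists l : B, u @ \oo --> l.
Proof.
move=> uc; suff : cvg (u @ \oo) by move=> /cvg_ex[l ul]; exists l.
apply/cauchy_cvgP; apply: cauchy_exP => e e0.
have ee : e = (complex.Re e)%:C.
  by move: e0; rewrite ltcE /=; case: e => a b /= /andP[/eqP -> _].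
have e20 : 0 < complex.Re e / 2 by rewrite divr_gt0//; rewrite ee ltcR in e0.
have [N hN] := uc _ e20; exists (u N); exists N => // n /= Nn.
rewrite -ball_normE /= rnormE ee ltcR; apply: le_lt_trans (hN _ _ (leqnn _) Nn) _.
by rewrite ltr_pdivrMr// ltr_pMr ?ltr1n//; rewrite ee ltcR in e0.
Qed.

Lemma rnorm_cvg_le (V : normedModType R[i]) (u : nat -> V) (l a : V) (M : R) (N : nat) :
  u @ \oo --> l -> (forall n, (N <= n)%N -> rnorm (u n - a) <= M) -> rnorm (l - a) <= M.
Proof.
move=> /cvg_rnormP ul uM; apply/ler_addgt0Pr => e e0; have [k hk] := ul e e0.
have -> : l - a = (u (maxn N k) - a) - (u (maxn N k) - l).
  by rewrite opprB [RHS]addrC addrA subrK.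
apply: le_trans (ler_rnormB _ _) _; apply: lerD.
  by apply: uM; rewrite leq_maxl.
by apply: hk; rewrite leq_maxr.
Qed.

(** The limit is taken pointwise in B. The Cauchy estimate, uniform in x up to the factor |x|,
    passes to the pointwise limit and yields its linearity, its boundedness and the convergence in
    norm. *)
Lemma bop_cauchy_cvg (u : nat -> bop B) :
  (forall e : R, 0 < e -> exists N : nat, forall n k, (N <= n)%N -> (N <= k)%N ->
    rnorm (u n - u k) <= e) -> exists l : bop B, u @ \oo --> l.
Proof.
move=> uc; have ucx x (e : R) : 0 < e -> exists N : nat, forall n k, (N <= n)%N -> (N <= k)%N ->
    rnorm (u n x - u k x) <= e * rnorm x.
  move=> e0; have [N hN] := uc e e0; exists N => n k Nn Nk.
  rewrite -[u n x - _]/((u n - u k) x); apply: le_trans (rnorm_bop_apply _ _) _.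
  by rewrite ler_wpM2r ?rnorm_ge0// hN.
have /choice[l ul] : forall x, exists y : B, (fun n => u n x) @ \oo --> y.
  move=> x; apply: cauchy_seq_cvg => e e0.
  have x0 : 0 < rnorm x + 1 by rewrite ltr_wpDl ?rnorm_ge0.
  have [|N hN] := ucx x (e / (rnorm x + 1)); first by rewrite divr_gt0.
  exists N => n k Nn Nk; apply: le_trans (hN n k Nn Nk) _.
  by rewrite -mulrA ler_piMr ?(ltW e0)// ler_pdivrMl// mulr1 lerDl.
have dist (e : R) : 0 < e -> exists N : nat, forall n, (N <= n)%N -> forall x,
    rnorm (l x - u n x) <= e * rnorm x.
  move=> e0; have [N hN] := uc e e0; exists N => n Nn x.
  apply: (rnorm_cvg_le (N := N) (ul x)) => k Nk.
  rewrite -[u k x - _]/((u k - u n) x); apply: le_trans (rnorm_bop_apply _ _) _.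
  by rewrite ler_wpM2r ?rnorm_ge0// hN.
have lP : l \in @bounded_linear R B.
  apply/mem_set; split=> [a x y|].
    apply/eqP; rewrite -subr_eq0; apply/eqP.
    apply: (@eq0_rnorm_le _ _ _ (rnorm (a *: x + y) + rnorm a * rnorm x + rnorm y)) => e e0 _.
    have [N hN] := dist e e0; have [uNl _] := bopP (u N).
    have -> : l (a *: x + y) - (a *: l x + l y) = (l (a *: x + y) - u N (a *: x + y)) -
        (a *: (l x - u N x)) - (l y - u N y).
      rewrite uNl scalerBr !opprB !opprD !addrA.
      by rewrite [RHS](ACl (1*5*7*(2*4)*(3*6)))/= !addNr !addr0.
    apply: le_trans (ler_rnormB _ _) _; rewrite mulrDl; apply: lerD.
      apply: le_trans (ler_rnormB _ _) _; rewrite mulrDl; apply: lerD.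
        by rewrite mulrC hN.
      by rewrite rnormZ -mulrA ler_wpM2l ?rnorm_ge0// mulrC hN.
    by rewrite mulrC hN.
  have [N hN] := dist 1 ltr01; exists (1 + rnorm (u N)) => x.
  apply: le_trans (ler_rnorm_dist _ (u N x)) _; rewrite mulrDl addrC; apply: lerD.
    exact: hN.
  exact: rnorm_bop_apply.
exists (Bop lP); apply/cvg_rnormP => e e0; have [N hN] := dist e e0.
exists N => n Nn; apply: rnorm_bop_le; first exact: ltW.
by move=> x; rewrite -[X in rnorm X]/(u n x - l x) rnormB hN.
Qed.

End bounded_operator_limit.

(** * Cubic grids and their Riemann sums *)

Section cylinders.
Context d (T : measurableType d) (R : realType).
Context (mu : {sigma_finite_measure set T -> \bar R}).

Definition cyl n (A : 'I_n -> set T) : set (n.-tuple T) :=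
  [set t | forall j, A j (tnth t j)].

Lemma measurable_cyl n (A : 'I_n -> set T) : (forall j, measurable (A j)) ->
  measurable (cyl A).
Proof.
move=> mA; rewrite (_ : cyl A = \bigcap_(j in [set: 'I_n]) (@tnth n T)^~ j @^-1` A j).
  apply: fin_bigcap_measurable => // j _.
  by rewrite -[X in measurable X]setTI; exact: measurable_tnth.
by apply/seteqP; split=> t At => [j _|j]; [exact: At|exact: (At j I)].
Qed.

(** The preimage of a cylinder under [tcons] is a rectangle, so the product measure splits off one
    factor at a time. *)
Lemma power_measure_cyl n (A : 'I_n -> set T) (a : R) : (forall j, measurable (A j)) ->
  (forall j, mu (A j) = a%:E) -> power_measure mu n (cyl A) = (a ^+ n)%:E.
Proof.
elim: n A => [|n IH] A mA Aa.
  by rewrite /= diracE mem_set// => -[].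
rewrite -[LHS]/(((mu \x power_measure mu n)%E) (@tcons _ T n @^-1` cyl A)).
rewrite (_ : _ @^-1` _ = A ord0 `*` cyl (fun j => A (lift ord0 j))).
  rewrite [LHS](_ : _ = mu (A ord0) * power_measure mu n (cyl (fun j => A (lift ord0 j))))%E.
    by rewrite Aa IH// -EFinM exprS.
  by apply: product_measure1E => //; exact: measurable_cyl.
apply/seteqP; split=> [[x t] /= At|[x t] [/= A0 At] j].
  split=> [|j]; first exact: (At ord0).
  by have := At (lift ord0 j); rewrite tnthS.
by case: (unliftP ord0 j) => [i ->|->]; [rewrite tnthS; exact: At|rewrite tnth0].
Qed.

End cylinders.

Section grid.
Context (R : realType) (m : nat).
Notation Z := ('rV[R]_m * 'rV[R]_m)%type.
Notation PT := (measurableTypeR R * measurableTypeR R)%type.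
Context (M n : nat).

Definition step : R := n.+1%:R^-1.

Definition gridI : Type := {ffun 'I_m -> 'I_(2 * M * n.+1) * 'I_(2 * M * n.+1)}.
HB.instance Definition _ := Finite.on gridI.

Definition node (i : nat) : R := step * i%:R - M%:R.

Definition gpt (k : gridI) : Z := (\row_j node (k j).1, \row_j node (k j).2).

Definition tup_point (t : m.-tuple PT) : Z :=
  (\row_j ((tnth t j).1 : R), \row_j ((tnth t j).2 : R)).

(** Half-open intervals make the cubes tile the box exactly: each of its points lies in one and only
    one cube, where the simple function takes a single value. *)
Definition cell (i : nat) : set R := `[node i, node i.+1[%classic.

Definition cube (k : gridI) : set (m.-tuple PT) :=
  cyl (fun j => (cell (k j).1 `*` cell (k j).2 : set PT)).

Definition grid_box : set (m.-tuple PT) :=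
  cyl (fun=> (`[- M%:R, M%:R[%classic `*` `[- M%:R, M%:R[%classic : set PT)).

Lemma step_gt0 : 0 < step. Proof. by rewrite invr_gt0. Qed.

Lemma nodeS i : node i.+1 = node i + step.
Proof. by rewrite /node -natr1 mulrDr mulr1 addrAC. Qed.

Lemma lebesgueC_rect (a b : R) (c : R) : 0 <= c ->
  lebesgueC R (`[a, a + c[%classic `*` `[b, b + c[%classic) = (c ^+ 2)%:E.
Proof.
move=> c0; rewrite -[LHS]/((lebesgue_measure \x lebesgue_measure)%E _).
have l (x : R) : lebesgue_measure (`[x, x + c[%classic : set R) = c%:E.
  rewrite lebesgue_measure_itv /= lte_fin ltrDl.
  case: ltP => [_|c0']; first by rewrite -EFinD addrAC subrr add0r.
  by congr _%:E; apply/eqP; rewrite eq_le c0 c0'.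
transitivity (lebesgue_measure (`[a, (a + c)%R[%classic : set R) *
              lebesgue_measure (`[b, (b + c)%R[%classic : set R))%E.
  by apply: product_measure1E; exact: measurable_itv.
by rewrite !l -EFinM expr2.
Qed.

Lemma measurable_rect (a b a' b' : R) :
  measurable (`[a, b[%classic `*` `[a', b'[%classic : set PT).
Proof. by apply: measurableX; exact: measurable_itv. Qed.

Lemma measurable_cube k : measurable (cube k).
Proof. by apply: measurable_cyl => j; exact: measurable_rect. Qed.

Lemma measurable_grid_box : measurable grid_box.
Proof. by apply: measurable_cyl => j; exact: measurable_rect. Qed.

Lemma measure_cube k : lebesgueCm R m (cube k) = ((step ^+ 2) ^+ m)%:E.
Proof.
apply: power_measure_cyl => j; first exact: measurable_rect.
by rewrite /cell !nodeS lebesgueC_rect// ltW// step_gt0.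
Qed.

Lemma measure_grid_box : lebesgueCm R m grid_box = (((2 * M%:R) ^+ 2) ^+ m)%:E.
Proof.
apply: power_measure_cyl => j; first exact: measurable_rect.
have M0 : 0 <= 2 * M%:R :> R by rewrite mulr_ge0.
have := lebesgueC_rect (- M%:R) (- M%:R) M0.
by rewrite (_ : - M%:R + 2 * M%:R = M%:R)//; ring.
Qed.

Lemma cell_exists (x : R) : - M%:R <= x -> x < M%:R ->
  exists i : 'I_(2 * M * n.+1), cell i x.
Proof.
move=> x1 x2; pose y := (x + M%:R) * n.+1%:R.
have y0 : 0 <= y by rewrite mulr_ge0// -lerBlDr sub0r.
have /andP[h1 h2] := truncn_itv y0.
have lt : (Num.truncn y < 2 * M * n.+1)%N.
  rewrite -(ltr_nat R); apply: le_lt_trans h1 _.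
  rewrite natrM natrM /y ltr_pM2r ?ltr0n//.
  have -> : 2%:R * M%:R = M%:R + M%:R :> R by ring.
  by rewrite ltrD2r.
exists (Ordinal lt); rewrite /cell /= in_itv /= /node /step !lerBlDr ltrBrDr.
by rewrite ler_pdivrMl ?ltr0n// ltr_pdivlMl ?ltr0n// [n.+1%:R * _]mulrC -/y h1 h2.
Qed.

Lemma cell_unique (x : R) (i i' : nat) : cell i x -> cell i' x -> i = i'.
Proof.
wlog : i i' / (i <= i')%N => [wl|ii'].
  by have [ii' | /ltnW ii'] := leqP i i'; [exact: wl|move=> c c'; apply/esym/wl].
rewrite /cell /= !in_itv /= => /andP[_ h1] /andP[h2 _].
apply/eqP; rewrite eqn_leq ii' /= -ltnS -(ltr_nat R).
by have := le_lt_trans h2 h1; rewrite /node ltrD2r ltr_pM2l// step_gt0.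
Qed.

Lemma cube_sub k : cube k `<=` grid_box.
Proof.
have ub (i : 'I_(2 * M * n.+1)) x : cell i x -> `[- M%:R, M%:R[%classic x.
  rewrite /cell /= !in_itv /= => /andP[h1 h2]; apply/andP; split.
    by apply: le_trans h1; rewrite /node lerBrDr addNr mulr_ge0// ltW// step_gt0.
  apply: lt_le_trans h2 _; rewrite /node lerBlDr /step ler_pdivrMl ?ltr0n//.
  have -> : n.+1%:R * (M%:R + M%:R) = (2 * M * n.+1)%:R :> R by rewrite !natrM; ring.
  by rewrite ler_nat.
by move=> t kt j; have [h1 h2] := kt j; split; [exact: ub h1|exact: ub h2].
Qed.

Lemma cube_exists t : grid_box t -> exists k, cube k t.
Proof.
move=> bt; have /choice[k kP] : forall j, exists i : 'I_(2 * M * n.+1) * 'I_(2 * M * n.+1),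
    cell i.1 (tnth t j).1 /\ cell i.2 (tnth t j).2.
  move=> j; have [] := bt j; rewrite /= !in_itv /= => /andP[a1 a2] /andP[b1 b2].
  have [i1 h1] := cell_exists a1 a2; have [i2 h2] := cell_exists b1 b2.
  by exists (i1, i2).
by exists [ffun j => k j] => j; rewrite ffunE; exact: kP.
Qed.

Lemma cube_unique t k k' : cube k t -> cube k' t -> k = k'.
Proof.
move=> kt kt'; apply/ffunP => j; have [h1 h2] := kt j; have [h1' h2'] := kt' j.
apply: injective_projections; apply: val_inj.
  exact: cell_unique h1 h1'.
exact: cell_unique h2 h2'.
Qed.

Lemma cube_dist t k : cube k t -> `|tup_point t - gpt k| <= step.
Proof.
move=> kt; have s0 := ltW step_gt0.
have cd i x : cell i x -> `|x - node i| <= step.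
  rewrite /cell /= in_itv /= nodeS => /andP[h1 h2].
  by rewrite ger0_norm ?subr_ge0// lerBlDl ltW.
rewrite prod_normE ge_max; apply/andP; split; apply: normr_row_le => // j.
  by rewrite !mxE; apply: cd; exact: (kt j).1.
by rewrite !mxE; apply: cd; exact: (kt j).2.
Qed.

Lemma grid_boxPn t : ~ grid_box t -> M%:R <= `|tup_point t|.
Proof.
move=> bt; rewrite leNgt; apply/negP => tM; apply: bt => j.
move: tM; rewrite prod_normE gt_max => /andP[t1 t2].
have := le_lt_trans (normr_row_coord _ j) t1.
have := le_lt_trans (normr_row_coord _ j) t2.
rewrite !mxE !ltr_norml => /andP[b1 b2] /andP[a1 a2].
by split; rewrite /= in_itv /= ?a2 ?b2 ltW.
Qed.

Section sums.
Context (V : normedModType R[i]).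
Implicit Types (Phi Psi : Z -> V).

Definition grid_simple Phi : seq (set (m.-tuple PT) * V) :=
  [seq (cube k, Phi (gpt k)) | k <- enum {: gridI}].

Definition riemann_sum Phi : V := ((step ^+ 2) ^+ m)%:C *: \sum_(k : gridI) Phi (gpt k).

Lemma is_simple_grid Phi : is_simple (lebesgueCm R m) (grid_simple Phi).
Proof.
move=> p /mapP[k _ ->] /=; split; first exact: measurable_cube.
by rewrite measure_cube ltry.
Qed.

Lemma simple_integral_grid Phi :
  simple_integral (lebesgueCm R m) (grid_simple Phi) = riemann_sum Phi.
Proof.
rewrite /simple_integral /riemann_sum scaler_sumr /grid_simple big_map big_enum /=.
by apply: eq_bigr => k _; rewrite measure_cube.
Qed.

Lemma simple_fun_grid Phi t k : cube k t -> simple_fun (grid_simple Phi) t = Phi (gpt k).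
Proof.
move=> kt; rewrite /simple_fun /grid_simple big_map big_enum /= (bigD1 k)//=.
rewrite indicE mem_set// scale1r big1 ?addr0// => k' k'k.
rewrite indicE memNset ?scale0r// => kt'.
by move/eqP : k'k; apply; exact: cube_unique kt' kt.
Qed.

Lemma simple_fun_grid0 Phi t : ~ grid_box t -> simple_fun (grid_simple Phi) t = 0.
Proof.
move=> bt; rewrite /simple_fun /grid_simple big_map big_enum /=.
apply: big1 => k _; rewrite indicE memNset ?scale0r// => kt.
by apply: bt; exact: cube_sub kt.
Qed.

Lemma riemann_sumD Phi Psi :
  riemann_sum (fun z => Phi z + Psi z) = riemann_sum Phi + riemann_sum Psi.
Proof. by rewrite /riemann_sum big_split scalerDr. Qed.

Lemma riemann_sumZ (a : R[i]) Phi :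
  riemann_sum (fun z => a *: Phi z) = a *: riemann_sum Phi.
Proof. by rewrite /riemann_sum -scaler_sumr !scalerA mulrC. Qed.

Lemma riemann_sumB Phi Psi :
  riemann_sum (fun z => Phi z - Psi z) = riemann_sum Phi - riemann_sum Psi.
Proof.
rewrite -[X in _ = _ + X]scaleN1r -riemann_sumZ -riemann_sumD.
by congr riemann_sum; apply/funext => z; rewrite scaleN1r.
Qed.

Lemma riemann_sum_le Phi (c : R) : (forall k, rnorm (Phi (gpt k)) <= c) ->
  rnorm (riemann_sum Phi) <= ((2 * M%:R) ^+ 2) ^+ m * c.
Proof.
have s2 : 0 <= (step ^+ 2) ^+ m by apply: exprn_ge0; exact: sqr_ge0.
move=> Pc; rewrite rnormZ rnormC ger0_norm//.
have s0 := step_gt0.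
have -> : ((2 * M%:R) ^+ 2) ^+ m = ((step ^+ 2) ^+ m) * #|{: gridI}|%:R.
  rewrite card_ffun card_prod !card_ord natrX -exprMn; congr (_ ^+ m).
  rewrite natrM -expr2 -exprMn; congr (_ ^+ 2).
  by rewrite [in RHS]natrM natrM [RHS]mulrC /step mulfK// pnatr_eq0.
rewrite -mulrA; apply: ler_wpM2l => //.
apply: le_trans (ler_rnorm_sum _ _ _) _.
have -> : #|{: gridI}|%:R * c = \sum_(k : gridI) c by rewrite sumr_const mulr_natl.
by apply: ler_sum => k _; exact: Pc.
Qed.

(** The shift is cyclic, by [ordS], hence a permutation of the grid, and sums can be reindexed by
    it. It differs from the translation only where it wraps around, at the faces -M and M, where the
    summand vanishes because of its support. *)
Let shift1 (j : 'I_m) (k : gridI) : gridI :=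
  [ffun i => if i == j then (ordS (k i).1, (k i).2) else k i].
Let shift2 (j : 'I_m) (k : gridI) : gridI :=
  [ffun i => if i == j then ((k i).1, ordS (k i).2) else k i].

Let node_wrap (i : 'I_(2 * M * n.+1)) : node (ordS i) = node i.+1 \/
  (node (ordS i) = - M%:R /\ node i.+1 = M%:R).
Proof.
have [iq|qi] := ltnP i.+1 (2 * M * n.+1).
  by left; rewrite /= modn_small.
right; have -> : i.+1 = (2 * M * n.+1)%N by apply/eqP; rewrite eqn_leq qi ltn_ord.
split; rewrite /node /step.
  by rewrite /= (_ : i.+1 = (2 * M * n.+1)%N) ?modnn ?mulr0 ?sub0r//;
     apply/eqP; rewrite eqn_leq qi ltn_ord.
rewrite !natrM; field.
by rewrite addrC natr1 pnatr_eq0.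
Qed.

Lemma riemann_sum_shift_re Phi j : (forall z, M%:R - 1 < `|z| -> Phi z = 0) ->
  riemann_sum (fun z => Phi (step *: re_dir R j + z)) = riemann_sum Phi.
Proof.
move=> P0; congr (_ *: _).
rewrite [RHS](reindex_inj (h := shift1 j)) /=; last first.
  move=> k k' /ffunP kk'; apply/ffunP => i; have := kk' i; rewrite !ffunE.
  case: ifP => // _ E; have h2 := congr1 snd E; have /ordS_inj h1 := congr1 fst E.
  exact: injective_projections.
apply: eq_bigr => k _.
have [E|[E1 E2]] := node_wrap (k j).1.
  congr Phi; apply: injective_projections; apply/rowP => i /=; rewrite !mxE ?eqxx /= ffunE.
    case: eqVneq => [->|ij] /=; last by rewrite mulr0 add0r.
    by rewrite E nodeS mulr1 addrC.
  by rewrite mulr0 add0r; case: ifP => // /eqP ->.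
rewrite !P0//.
  apply: (@lt_le_trans _ _ `|(gpt (shift1 j k)).1 0 j|).
    by rewrite mxE ffunE eqxx /= E1 normrN ger0_norm// ltrBlDr ltrDl.
  by apply: le_trans (normr_row_coord _ _) _; rewrite prod_normE le_max lexx.
apply: (@lt_le_trans _ _ `|(step *: re_dir R j + gpt k).1 0 j|).
  rewrite /= !mxE !eqxx mulr1 addrC -nodeS E2 ger0_norm//.
  by rewrite ltrBlDr ltrDl.
by apply: le_trans (normr_row_coord _ _) _; rewrite prod_normE le_max lexx.
Qed.

Lemma riemann_sum_shift_im Phi j : (forall z, M%:R - 1 < `|z| -> Phi z = 0) ->
  riemann_sum (fun z => Phi (step *: im_dir R j + z)) = riemann_sum Phi.
Proof.
move=> P0; congr (_ *: _).
rewrite [RHS](reindex_inj (h := shift2 j)) /=; last first.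
  move=> k k' /ffunP kk'; apply/ffunP => i; have := kk' i; rewrite !ffunE.
  case: ifP => // _ E; have h1 := congr1 fst E; have /ordS_inj h2 := congr1 snd E.
  exact: injective_projections.
apply: eq_bigr => k _.
have [E|[E1 E2]] := node_wrap (k j).2.
  congr Phi; apply: injective_projections; apply/rowP => i /=; rewrite !mxE ?eqxx /= ffunE.
    by rewrite mulr0 add0r; case: ifP => // /eqP ->.
  case: eqVneq => [->|ij] /=; last by rewrite mulr0 add0r.
  by rewrite E nodeS mulr1 addrC.
rewrite !P0//.
  apply: (@lt_le_trans _ _ `|(gpt (shift2 j k)).2 0 j|).
    by rewrite mxE ffunE eqxx /= E1 normrN ger0_norm// ltrBlDr ltrDl.
  by apply: le_trans (normr_row_coord _ _) _; rewrite prod_normE le_max lexx orbT.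
apply: (@lt_le_trans _ _ `|(step *: im_dir R j + gpt k).2 0 j|).
  rewrite /= !mxE !eqxx mulr1 addrC -nodeS E2 ger0_norm//.
  by rewrite ltrBlDr ltrDl.
by apply: le_trans (normr_row_coord _ _) _; rewrite prod_normE le_max lexx orbT.
Qed.

End sums.
End grid.

Section riemann_limit.
Context (R : realType) (m : nat) (B : completeNormedModType R[i]).
Notation Z := ('rV[R]_m * 'rV[R]_m)%type.

Definition uniformly_continuous_bop (Phi : Z -> bop B) := forall e : R, 0 < e ->
  exists2 del : R, 0 < del & forall z w, `|z - w| <= del -> rnorm (Phi z - Phi w) <= e.

Lemma step_small (e : R) : 0 < e -> exists N : nat, forall n, (N <= n)%N -> step R n <= e.
Proof.
move=> e0; exists (Num.truncn e^-1) => n Nn.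
have i0 : 0 <= e^-1 by rewrite invr_ge0 ltW.
have /andP[_ h] := truncn_itv i0.
rewrite /step -[leRHS]invrK lef_pV2 ?posrE ?invr_gt0 ?ltr0n//.
by apply: le_trans (ltW h) _; rewrite ler_nat.
Qed.

Lemma riemann_bochner (M : nat) (Phi : Z -> bop B) (c : R) :
  (forall z, M%:R - 1 < `|z| -> Phi z = 0) -> (forall z, rnorm (Phi z) <= c) ->
  uniformly_continuous_bop Phi ->
  exists I : bop B, [/\ (fun n => riemann_sum M n Phi) @ \oo --> I,
    has_bochner_integral (lebesgueCm R m) (Phi \o @tup_point R m) I &
    bochner_integral (lebesgueCm R m) (Phi \o @tup_point R m) = I].
Proof.
move=> P0 Pc Pu.
(* The supremum of [D n] is the oscillation of Phi at the scale of the mesh. It bounds the distance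
   to the grid function uniformly, and the bound [c] makes the supremum meaningful. *)
pose D n := [set rnorm (Phi p.1 - Phi p.2) | p in [set p : Z * Z | `|p.1 - p.2| <= step R n]].
have Dub n : ubound (D n) (c + c).
  by move=> _ [[z w] /= _ <-]; apply: le_trans (ler_rnormB _ _) _; rewrite lerD.
have D0 n : D n !=set0.
  exists (rnorm (Phi 0 - Phi 0)), (0, 0) => //=.
  by rewrite subrr normr0 ltW// step_gt0.
pose eps n := sup (D n).
have epsP n z w : `|z - w| <= step R n -> rnorm (Phi z - Phi w) <= eps n.
  by move=> zw; apply: ub_le_sup; [exists (c + c)|exists (z, w)].
have eps_ge0 n : 0 <= eps n.
  apply: le_trans (epsP n 0 0 _); first by rewrite subrr rnorm0.
  by rewrite subrr normr0 ltW// step_gt0.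
have eps_small (e : R) : 0 < e -> exists N : nat, forall n, (N <= n)%N -> eps n <= e.
  move=> e0; have [del del0 Pd] := Pu e e0; have [N hN] := step_small del0.
  exists N => n Nn; apply: sup_le_ub => // _ [[z w] /= zw <-].
  by apply: Pd; apply: le_trans zw (hN n Nn).
have eps0 : eps @ \oo --> 0.
  apply/cvgrPdist_le => e e0; have [N hN] := eps_small e e0; exists N => // n Nn.
  by rewrite sub0r normrN ger0_norm// hN.
pose s n := grid_simple M n Phi.
have ss n : is_simple (lebesgueCm R m) (s n) by exact: is_simple_grid.
have fE : (lebesgueCm R m (@grid_box R m M) < +oo)%E by rewrite measure_grid_box ltry.
have sE n t : ~ grid_box M t -> (Phi \o @tup_point R m) t = simple_fun (s n) t.
  move=> bt; rewrite simple_fun_grid0// /= P0//.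
  by apply: lt_le_trans (grid_boxPn bt); rewrite ltrBlDr ltrDl.
have sf n t : rnorm ((Phi \o @tup_point R m) t - simple_fun (s n) t) <= eps n.
  have [bt|bt] := pselect (grid_box M t); last by rewrite (sE n t bt) subrr rnorm0.
  have [k kt] := cube_exists n bt.
  by rewrite (simple_fun_grid Phi kt) /=; apply: epsP; exact: cube_dist.
have [I sI] : exists I : bop B, (fun n => simple_integral (lebesgueCm R m) (s n)) @ \oo --> I.
  apply: bop_cauchy_cvg => e e0; set b := fine (lebesgueCm R m (@grid_box R m M)).
  have b0 : 0 < b + 1 by rewrite ltr_wpDl// fine_ge0.
  have [|N hN] := eps_small (e / 2 / (b + 1)); first by rewrite !divr_gt0.
  exists N => n k Nn Nk.
  have := uniform_simple_integral_dist ss (@measurable_grid_box R m M) fE sf sE eps0 n k.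
  move=> /le_trans; apply.
  rewrite -/b; apply: (@le_trans _ _ ((e / 2 / (b + 1) + e / 2 / (b + 1)) * (b + 1))).
    apply: ler_pM; rewrite ?addr_ge0// ?fine_ge0//; first by apply: lerD; exact: hN.
    by rewrite lerDl.
  by rewrite -mulrDl mulfVK ?gt_eqF// -splitr.
exists I; split.
- by under eq_fun do rewrite -simple_integral_grid.
- exact: (uniform_has_bochner_integral ss (@measurable_grid_box R m M) fE sf sE eps0).
- exact: (uniform_bochner_integralE ss (@measurable_grid_box R m M) fE sf sE eps0).
Qed.

End riemann_limit.

(** * Resolvents *)

Section operator_products.
Context (R : realType) (B : normedModType R[i]).
Implicit Types (S T U : bop B).

Lemma bop_compA : associative (@bop_comp R B).
Proof. by move=> S T U; exact: val_inj. Qed.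

Lemma bop_comp1o : left_id (@bop_id R B) (@bop_comp R B).
Proof. by move=> S; exact: val_inj. Qed.

Lemma bop_compo1 : right_id (@bop_id R B) (@bop_comp R B).
Proof. by move=> S; exact: val_inj. Qed.

HB.instance Definition _ := Monoid.isLaw.Build (bop B) (@bop_id R B) (@bop_comp R B)
  bop_compA bop_comp1o bop_compo1.

Lemma bop_comp_linl (a : R[i]) S T U :
  bop_comp (a *: S + T) U = a *: bop_comp S U + bop_comp T U.
Proof. exact: val_inj. Qed.

Lemma bop_comp_linr (a : R[i]) S T U :
  bop_comp U (a *: S + T) = a *: bop_comp U S + bop_comp U T.
Proof. by apply/val_inj/funext => x /=; have [Ul _] := bopP U; exact: Ul. Qed.

Lemma bop_compBl S T U : bop_comp (S - T) U = bop_comp S U - bop_comp T U.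
Proof. exact: val_inj. Qed.

Lemma bop_compBr S T U : bop_comp U (S - T) = bop_comp U S - bop_comp U T.
Proof. by rewrite -scaleN1r addrC bop_comp_linr scaleN1r addrC. Qed.

Lemma bop_compZl (a : R[i]) S U : bop_comp (a *: S) U = a *: bop_comp S U.
Proof. exact: val_inj. Qed.

Lemma bop_compZr (a : R[i]) S U : bop_comp U (a *: S) = a *: bop_comp U S.
Proof.
rewrite -[a *: S]addr0 bop_comp_linr (_ : bop_comp U 0 = 0) ?addr0//.
by have := bop_compBr 0 0 U; rewrite !subrr.
Qed.

Lemma rnorm_bop_comp S T : rnorm (bop_comp S T) <= rnorm S * rnorm T.
Proof.
apply: rnorm_bop_le => [|x]; first by rewrite mulr_ge0 ?rnorm_ge0.
apply: le_trans (rnorm_bop_apply S (T x)) _; rewrite -mulrA.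
by rewrite ler_wpM2l ?rnorm_ge0// rnorm_bop_apply.
Qed.

Lemma rnorm_bop_id : rnorm (bop_id B) <= 1.
Proof. by apply: rnorm_bop_le => // x; rewrite mul1r. Qed.

Section product.
Context (I : eqType).
Implicit Types (r : seq I) (F G : I -> bop B).
Local Notation bprod r F := (\big[@bop_comp R B/@bop_id R B]_(i <- r) F i).

Lemma rnorm_bop_prod r F (f : I -> R) : (forall i, rnorm (F i) <= f i) ->
  rnorm (bprod r F) <= \prod_(i <- r) f i.
Proof.
move=> Ff; elim: r => [|i r IH]; rewrite ?big_nil ?big_cons; first exact: rnorm_bop_id.
by apply: le_trans (rnorm_bop_comp _ _) _; apply: ler_pM; rewrite ?rnorm_ge0.
Qed.

Lemma rnorm_bop_prod_const r F (K : R) : (forall i, rnorm (F i) <= K) ->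
  rnorm (bprod r F) <= K ^+ size r.
Proof.
move=> FK; apply: le_trans (rnorm_bop_prod r FK) _.
by rewrite big_const_seq count_predT iter_mulr_1.
Qed.

Lemma bop_prodZ r (a : I -> R[i]) F :
  bprod r (fun i => a i *: F i) = (\prod_(i <- r) a i) *: bprod r F.
Proof.
elim: r => [|i r IH]; first by rewrite !big_nil scale1r.
by rewrite !big_cons IH bop_compZl bop_compZr scalerA.
Qed.

(** Telescoping, one factor at a time. Since 1 <= K, the single power K^(size r) dominates all the
    partial products. *)
Lemma rnorm_bop_prod_dist r F G (K d : R) : 1 <= K ->
  (forall i, rnorm (F i) <= K) -> (forall i, rnorm (G i) <= K) ->
  (forall i, rnorm (F i - G i) <= d) ->
  rnorm (bprod r F - bprod r G) <= (size r)%:R * K ^+ size r * d.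
Proof.
move=> K1 FK GK Fd; have K0 : 0 <= K by exact: le_trans K1.
elim: r => [|i r IH]; first by rewrite !big_nil subrr rnorm0 !mul0r.
have d0 : 0 <= d by exact: le_trans (rnorm_ge0 _) (Fd i).
rewrite !big_cons.
have -> : bop_comp (F i) (bprod r F) - bop_comp (G i) (bprod r G) =
  bop_comp (F i - G i) (bprod r F) + bop_comp (G i) (bprod r F - bprod r G).
  by rewrite bop_compBl bop_compBr addrA subrK.
apply: le_trans (ler_rnormD _ _) _.
rewrite /= -[in leRHS]natr1 exprS !mulrDl mul1r addrC; apply: lerD.
  apply: le_trans (rnorm_bop_comp _ _) _.
  rewrite -!mulrA [in leRHS]mulrCA; apply: ler_pM; rewrite ?rnorm_ge0// mulrA.
  exact: IH.
apply: le_trans (rnorm_bop_comp _ _) _; rewrite mulrC.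
apply: ler_pM; rewrite ?rnorm_ge0//.
apply: le_trans (rnorm_bop_prod_const r FK) _.
by rewrite ler_peMl// exprn_ge0.
Qed.

(** The operators do not commute, so the product is cut into the parts before and after [k]; as [k]
    occurs only once, both parts are unaffected by what is put in its place. *)
Lemma bop_prod_slot_lin r k F (a : R[i]) S T : uniq r -> k \in r ->
  bprod r (fun i => if i == k then a *: S + T else F i) =
  a *: bprod r (fun i => if i == k then S else F i) +
  bprod r (fun i => if i == k then T else F i).
Proof.
move=> ur kr; case/splitPr : kr ur => r1 r2.
rewrite cat_uniq /= negb_or => /and3P[_ /andP[k1 _] /andP[k2 _]].
have E1 X : bprod r1 (fun i => if i == k then X else F i) = bprod r1 F.
  by apply: eq_big_seq => i ir; case: eqP => // ik; rewrite -ik ir in k1.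
have E2 X : bprod r2 (fun i => if i == k then X else F i) = bprod r2 F.
  by apply: eq_big_seq => i ir; case: eqP => // ik; rewrite -ik ir in k2.
rewrite !big_cat !big_cons !eqxx /= !E1 !E2.
by rewrite bop_comp_linl bop_comp_linr.
Qed.

End product.
End operator_products.

Section resolvent_theory.
Context (R : realType) (B : normedModType R[i]).
Implicit Types (P : operator B).

Lemma resolventP P x y : real_spectrum P -> y != 0 ->
  is_resolvent P (x +i* y) (resolvent P (x +i* y)).
Proof.
move=> rP y0; have [[S hS]|nS] := pselect (exists S, is_resolvent P (x +i* y) S).
  by rewrite /resolvent; case: xgetP => [T -> //|/(_ S)].
by have /= y0' := rP _ nS; rewrite y0' eqxx in y0.
Qed.

(** T maps into the domain of P, so z - P may be applied to T x; this gives (z - w) T x + x, while S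
    brings it back to T x. *)
Lemma resolvent_identity P z w (S T : bop B) : is_resolvent P z S -> is_resolvent P w T ->
  S - T = (w - z) *: bop_comp S T.
Proof.
move=> [_ zS] [wT _]; apply/val_inj/funext => x /=.
have [dT eT] := wT x; have := zS (T x) dT; have [Sl _] := bopP S.
have -> : z *: T x - P (T x) = (z - w) *: T x + x.
  by rewrite -[X in _ = _ + X]eT scalerBl addrA subrK.
rewrite Sl => E; rewrite -[LHS]/(S x - T x) -[RHS]/((w - z) *: S (T x)) -{1}E.
by rewrite opprD addrCA subrr addr0 -scaleNr opprB.
Qed.

(** The real exponent is rounded up to a natural number. For this the base must be at least 1 on the
    whole box, which L / |y| is and 1 / |y| need not be. *)
Lemma locally_temperate_bound P (L : R) : 1 <= L -> locally_temperate_resolvent P ->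
  exists (C : R) (N : nat), 0 <= C /\ forall x y, `|x| <= L -> `|y| <= L -> y != 0 ->
    rnorm (resolvent P (x +i* y)) <= C * (L / `|y|) ^+ N.
Proof.
move=> L1 tP; have cK : compact (`[- L, L]%classic `*` `[- L, L]%classic : set (R * R)).
  by apply: compact_setX; exact: segment_compact.
have [C [N [C0 N0 h]]] := tP _ cK.
exists C, (Num.truncn N).+1; split => // x y xL yL y0.
have inK (a : R) : `|a| <= L -> `[- L, L]%classic a.
  by rewrite ler_norml /= in_itv.
apply: le_trans (h x y (conj (inK x xL) (inK y yL)) y0) _; apply: ler_wpM2l => //.
have yp : 0 < `|y| by rewrite normr_gt0.
have Ly : 1 <= L / `|y| by rewrite ler_pdivlMr// mul1r.
have Lp : 0 < L by exact: lt_le_trans L1.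
have L0 := ltW Lp.
have E : `|y| `^ (- N) = L `^ (- N) * (L / `|y|) `^ N.
  rewrite powRM ?invr_ge0// mulrA -powRD; last by rewrite (gt_eqF Lp) implybT.
  by rewrite addNr powRr0 mul1r -powR_inv1// -powRrM mulN1r.
rewrite E; apply: (@le_trans _ _ (1 * (L / `|y|) `^ N)).
  rewrite ler_wpM2r ?powR_ge0// powRN invf_le1 ?powR_gt0//.
  by rewrite -[leLHS](powRr0 L) ler_powR.
rewrite mul1r -powR_mulrn ?divr_ge0//; apply: ler_powR => //.
by have /andP[_ /ltW] := truncn_itv N0.
Qed.

End resolvent_theory.

(** * Cutoff resolvents and their discrete Cauchy-Riemann equation *)

Section cutoff_resolvent.
Context (R : realType) (B : normedModType R[i]).

(** Piecewise linear, from 0 at |y| = eps to 1 at |y| = 2 eps: only difference quotients of it are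
    taken, for which the Lipschitz constant 1 / eps suffices. *)
Definition cutoff (eps y : R) : R := Num.max 0 (Num.min 1 (`|y| / eps - 1)).

Section cutoff_theory.
Context (eps : R) (eps0 : 0 < eps).

Lemma cutoff_ge0 y : 0 <= cutoff eps y.
Proof. by rewrite /cutoff le_max lexx. Qed.

Lemma cutoff_le1 y : cutoff eps y <= 1.
Proof. by rewrite /cutoff ge_max ler01 ge_min lexx. Qed.

Lemma cutoff_near y : `|y| <= eps -> cutoff eps y = 0.
Proof.
move=> ye; rewrite /cutoff; apply/max_idPl; rewrite ge_min; apply/orP; right.
by rewrite subr_le0 ler_pdivrMr// mul1r.
Qed.

Lemma cutoff_far y : 2 * eps <= `|y| -> cutoff eps y = 1.
Proof.
move=> ye; rewrite /cutoff (min_idPl _) ?(max_idPr _)//.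
by rewrite lerBrDr ler_pdivlMr.
Qed.

Lemma cutoff_lip x y : `|cutoff eps x - cutoff eps y| <= `|x - y| / eps.
Proof.
have maxl (a b c : R) : `|Num.max a b - Num.max a c| <= `|b - c|.
  by rewrite /Num.max; case: ltP => ?; case: ltP => ?; rewrite ler_norml;
    apply/andP; split; have := ler_norm (b - c); have := ler_norm (c - b);
    rewrite (distrC c b); lra.
have minl (a b c : R) : `|Num.min a b - Num.min a c| <= `|b - c|.
  by rewrite /Num.min; case: ltP => ?; case: ltP => ?; rewrite ler_norml;
    apply/andP; split; have := ler_norm (b - c); have := ler_norm (c - b);
    rewrite (distrC c b); lra.
apply: le_trans (maxl _ _ _) _; apply: le_trans (minl _ _ _) _.
rewrite opprB addrA subrK -mulrBl normrM normfV [X in _ / X]gtr0_norm//.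
by rewrite ler_pM2r ?invr_gt0// ler_dist_dist.
Qed.

End cutoff_theory.

Section estimates.
Context (P : operator B) (L C : R) (N : nat).
Hypothesis L1 : 1 <= L.
Hypothesis C0 : 0 <= C.
Hypothesis resP : forall x y, y != 0 -> is_resolvent P (x +i* y) (resolvent P (x +i* y)).
Hypothesis resC : forall x y, `|x| <= L -> `|y| <= L -> y != 0 ->
  rnorm (resolvent P (x +i* y)) <= C * (L / `|y|) ^+ N.

Let Rz x y : bop B := resolvent P (x +i* y).

Definition cutoff_resolvent eps x y : bop B := (cutoff eps y)%:C *: Rz x y.

(* The backward difference analogue of d/dzbar, with step h. *)
Definition dbar_cutoff eps h x y : bop B := ((2 * h)^-1)%:C *:
  ((cutoff_resolvent eps x y - cutoff_resolvent eps (x - h) y) +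
   (0 +i* 1) *: (cutoff_resolvent eps x y - cutoff_resolvent eps x (y - h))).

(** A bound of the resolvents at height at least eps / 2. The half makes room for neighbours, at
    distance at most eps / 2, of a point where the cutoff is not zero. *)
Definition far_bound eps : R := C * (L / (eps / 2)) ^+ N.

Context (eps : R) (eps0 : 0 < eps).
Local Notation K := (far_bound eps).

Let L0 : 0 <= L. Proof. exact: le_trans L1. Qed.

Lemma far_bound_ge0 : 0 <= K.
Proof. by rewrite mulr_ge0// exprn_ge0// divr_ge0// divr_ge0// ltW. Qed.

Let res_far x y : `|x| <= L -> `|y| <= L -> eps / 2 <= `|y| -> rnorm (Rz x y) <= K.
Proof.
move=> xL yL ye; have e20 : 0 < eps / 2 by rewrite divr_gt0.
have y0 : y != 0 by rewrite -normr_gt0; exact: lt_le_trans ye.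
apply: le_trans (resC xL yL y0) _; apply: ler_wpM2l => //.
apply: ler_wXn2r; first by rewrite divr_ge0.
by apply: ler_wpM2l => //; rewrite lef_pV2 ?posrE// normr_gt0.
Qed.

Let res_dist x y x' y' : `|x| <= L -> `|y| <= L -> eps / 2 <= `|y| ->
  `|x'| <= L -> `|y'| <= L -> eps / 2 <= `|y'| ->
  rnorm (Rz x y - Rz x' y') <= (`|x - x'| + `|y - y'|) * K ^+ 2.
Proof.
move=> xL yL ye xL' yL' ye'; have e20 : 0 < eps / 2 by rewrite divr_gt0.
have y0 : y != 0 by rewrite -normr_gt0; exact: lt_le_trans ye.
have y0' : y' != 0 by rewrite -normr_gt0; exact: lt_le_trans ye'.
rewrite (resolvent_identity (resP x y0) (resP x' y0')) rnormZ.
apply: ler_pM; rewrite ?rnorm_ge0//.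
  apply: le_trans (rnorm_le_ReIm _) _; apply: eq_ler.
  by rewrite /= (distrC x) (distrC y).
apply: le_trans (rnorm_bop_comp _ _) _; rewrite expr2.
by apply: ler_pM; rewrite ?rnorm_ge0//; exact: res_far.
Qed.

Lemma cutoff_resolvent_le x y : `|x| <= L -> `|y| <= L ->
  rnorm (cutoff_resolvent eps x y) <= K.
Proof.
move=> xL yL; have [ye|ye] := leP `|y| eps.
  by rewrite /cutoff_resolvent cutoff_near// scale0r rnorm0 far_bound_ge0.
rewrite rnormZ rnormC ger0_norm ?cutoff_ge0//.
apply: (@le_trans _ _ (1 * K)); last by rewrite mul1r.
apply: ler_pM; rewrite ?cutoff_ge0 ?rnorm_ge0 ?cutoff_le1//.
apply: res_far => //; apply: le_trans (ltW ye).
by rewrite ler_pdivrMr// ler_peMr ?ler1n// ltW.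
Qed.

Lemma cutoff_resolvent_lip x y x' y' (d : R) : `|x| <= L -> `|y| <= L ->
  `|x'| <= L -> `|y'| <= L -> `|x - x'| <= d -> `|y - y'| <= d -> d <= eps / 2 ->
  rnorm (cutoff_resolvent eps x y - cutoff_resolvent eps x' y') <=
    d * (2 * K ^+ 2 + K / eps).
Proof.
move=> xL yL xL' yL' xd yd de; have K0 := far_bound_ge0.
have d0 : 0 <= d by exact: le_trans xd.
have e0 := ltW eps0.
(* Either both cutoffs vanish, or one point is higher than eps and then, as d <= eps / 2, both are
   at height at least eps / 2, where the resolvent identity applies. *)
have [[ye ye']|nye] := pselect (`|y| <= eps /\ `|y'| <= eps).
  rewrite /cutoff_resolvent !cutoff_near// !scale0r subrr rnorm0.
  apply: mulr_ge0 => //; apply: addr_ge0; last exact: divr_ge0.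
  by apply: mulr_ge0 => //; exact: sqr_ge0.
have yy' : `|y| <= `|y'| + d.
  by rewrite -lerBlDl; apply: le_trans yd; exact: lerB_dist.
have y'y : `|y'| <= `|y| + d.
  by rewrite -lerBlDl; apply: le_trans yd; rewrite distrC; exact: lerB_dist.
have [yf yf'] : eps / 2 <= `|y| /\ eps / 2 <= `|y'|.
  have [ye|ye] := leP `|y| eps; last by split; lra.
  have [ye'|ye'] := leP `|y'| eps; last by split; lra.
  by exfalso; apply: nye.
have -> : cutoff_resolvent eps x y - cutoff_resolvent eps x' y' =
   (cutoff eps y)%:C *: (Rz x y - Rz x' y') + (cutoff eps y - cutoff eps y')%:C *: Rz x' y'.
  by rewrite scalerBr rmorphB /= scalerBl addrA subrK.
apply: le_trans (ler_rnormD _ _) _; rewrite mulrDr; apply: lerD; rewrite rnormZ rnormC.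
  rewrite ger0_norm ?cutoff_ge0//.
  apply: (@le_trans _ _ (1 * ((d + d) * K ^+ 2))); last by rewrite mul1r; apply: eq_ler; ring.
  apply: ler_pM; rewrite ?cutoff_ge0 ?rnorm_ge0 ?cutoff_le1//.
  apply: le_trans (res_dist xL yL yf xL' yL' yf') _.
  by rewrite ler_wpM2r ?sqr_ge0// lerD.
rewrite [leRHS]mulrCA [leRHS]mulrC; apply: ler_pM; rewrite ?rnorm_ge0//; last exact: res_far.
apply: le_trans (cutoff_lip eps0 _ _) _.
by rewrite ler_pM2r ?invr_gt0.
Qed.

(** By the resolvent identity the differences of R in x and y are -h R(x,y) R(x-h,y) and -ih R(x,y)
    R(x,y-h). In the dbar combination they become half of R(x,y) (R(x,y-h) - R(x-h,y)), and a second
    use of the identity bounds this by h K^3. What remains is the difference of the cutoff, at most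
    1 / (2 eps) after division by 2h; it vanishes for |y| > 3 eps, where both cutoffs are 1. *)
Lemma dbar_cutoff_le h x y : 0 < h -> h <= eps / 2 -> `|x| + h <= L -> `|y| + h <= L ->
  rnorm (dbar_cutoff eps h x y) <=
  (if `|y| <= 3 * eps then K / (2 * eps) else 0) + h * K ^+ 3.
Proof.
move=> h0 he xh yh; have K0 := far_bound_ge0; have e0 := ltW eps0; have hh := ltW h0.
have xL : `|x| <= L by lra.
have yL : `|y| <= L by lra.
have xL' : `|x - h| <= L.
  by apply: le_trans (ler_normB _ _) _; rewrite (ger0_norm hh).
have yL' : `|y - h| <= L.
  by apply: le_trans (ler_normB _ _) _; rewrite (ger0_norm hh).
have i1 : rnorm (0 +i* 1 : R[i]) = 1 by rewrite rnorm_imC normr1.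
have yy' : `|y| <= `|y - h| + h.
  rewrite -lerBlDl; apply: le_trans (lerB_dist _ _) _.
  by rewrite opprB addrC subrK (ger0_norm hh).
have y'y : `|y - h| <= `|y| + h.
  by apply: le_trans (ler_normB _ _) _; rewrite (ger0_norm hh).
set c := cutoff eps y; set c' := cutoff eps (y - h).
pose X := (c / 2)%:C *: bop_comp (Rz x y) (Rz x (y - h) - Rz (x - h) y).
pose Y := ((2 * h)^-1 * (c - c'))%:C *: ((0 +i* 1) *: Rz x (y - h)).
have -> : dbar_cutoff eps h x y = X + Y.
  rewrite /dbar_cutoff /cutoff_resolvent -/c -/c' /X /Y.
  (* For |y| <= eps the point may be real, where [Rz x y] is possibly a default value and no
     identity holds; there c = 0 removes it. For |y| > eps >= 2h both y and y - h are nonzero. *)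
  have [ye|ye] := leP `|y| eps.
    rewrite /c cutoff_near// !(mul0r, scale0r, subrr, oppr0, sub0r, add0r).
    rewrite -scaleNr !scalerA; congr (_ *: _).
    apply/eqP; rewrite eq_complex /=; apply/andP; split; apply/eqP; ring.
  have y0 : y != 0 by rewrite -normr_gt0; exact: lt_trans ye.
  have y0' : y - h != 0 by rewrite -normr_gt0; lra.
  have E1 : Rz x y - Rz (x - h) y = (- h)%:C *: bop_comp (Rz x y) (Rz (x - h) y).
    rewrite (resolvent_identity (resP x y0) (resP (x - h) y0)); congr (_ *: _).
    by apply/eqP; rewrite eq_complex /=; apply/andP; split; apply/eqP; ring.
  have E2 : Rz x y - Rz x (y - h) = (0 +i* (- h)) *: bop_comp (Rz x y) (Rz x (y - h)).
    rewrite (resolvent_identity (resP x y0) (resP x y0')); congr (_ *: _).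
    by apply/eqP; rewrite eq_complex /=; apply/andP; split; apply/eqP; ring.
  have -> : c%:C *: Rz x y - c'%:C *: Rz x (y - h) =
     c%:C *: (Rz x y - Rz x (y - h)) + (c - c')%:C *: Rz x (y - h).
    by rewrite scalerBr rmorphB /= scalerBl addrA subrK.
  rewrite -scalerBr E1 E2 bop_compBr.
  set X1 := bop_comp (Rz x y) (Rz (x - h) y); set X2 := bop_comp (Rz x y) (Rz x (y - h)).
  set W := Rz x (y - h).
  have h0' : h != 0 by rewrite gt_eqF.
  transitivity ((- (c / 2))%:C *: X1 + ((c / 2)%:C *: X2 +
      (((2 * h)^-1 * (c - c'))%:C * (0 +i* 1)) *: W)).
    rewrite !scalerDr !scalerA; congr (_ *: _ + (_ *: _ + _ *: _)).
    - by apply/eqP; rewrite eq_complex /=; apply/andP; split; apply/eqP; field.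
    - by apply/eqP; rewrite eq_complex /=; apply/andP; split; apply/eqP; field.
    - by apply/eqP; rewrite eq_complex /=; apply/andP; split; apply/eqP; field.
  by rewrite scalerBr rmorphN /= scaleNr scalerA addrA [- _ + _]addrC.
apply: le_trans (ler_rnormD _ _) _; rewrite [leRHS]addrC; apply: lerD.
  rewrite /X rnormZ rnormC; have [ye|ye] := leP `|y| eps.
    by rewrite /c cutoff_near// mul0r normr0 mul0r mulr_ge0// exprn_ge0.
  rewrite ger0_norm ?divr_ge0 ?cutoff_ge0//.
  have -> : h * K ^+ 3 = 2^-1 * (K * ((h + h) * K ^+ 2)) by field.
  apply: ler_pM; rewrite ?divr_ge0 ?cutoff_ge0 ?rnorm_ge0//.
    by rewrite ler_pdivrMr// mulVf// cutoff_le1.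
  apply: le_trans (rnorm_bop_comp _ _) _.
  apply: ler_pM; rewrite ?rnorm_ge0//; first by apply: res_far => //; lra.
  apply: le_trans (res_dist _ _ _ _ _ _) _ => //; [lra|lra|].
  rewrite ler_wpM2r ?sqr_ge0//; apply: lerD.
    by rewrite opprB addrC subrK (ger0_norm hh).
  by rewrite addrAC subrr add0r normrN (ger0_norm hh).
rewrite /Y !rnormZ rnormC i1 mul1r.
case: ifPn => [y3|]; last first.
  rewrite -ltNge => y3; rewrite /c /c' !cutoff_far//; [|lra|lra].
  by rewrite subrr mulr0 normr0 mul0r.
(* If |y - h| < eps / 2 then |y| < eps, so both cutoffs vanish and no bound of the resolvent is
   called for. *)
have [ye|ye] := leP (eps / 2) `|y - h|; last first.
  by rewrite /c /c' !cutoff_near//; [rewrite subrr mulr0 normr0 mul0r divr_ge0// mulr_ge0|lra|lra].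
rewrite mulrC; apply: ler_pM; rewrite ?rnorm_ge0//; first exact: res_far.
rewrite normrM ger0_norm ?invr_ge0 ?mulr_ge0//.
rewrite ler_pdivrMl ?mulr_gt0//; apply: le_trans (cutoff_lip eps0 _ _) _.
rewrite opprB addrC subrK (ger0_norm hh) invfM.
by rewrite mulrACA divff ?pnatr_eq0// mul1r.
Qed.

End estimates.
End cutoff_resolvent.

(** * Discrete Stokes formula *)

Section bsmooth_lipschitz_point.
Context (R : realType) (m : nat).
Notation Z := ('rV[R]_m * 'rV[R]_m)%type.
Local Notation "'C" := R[i].

(** The constants of [bsmooth_lipschitz] depend on the direction; expanding z - w in the coordinate
    directions leaves finitely many of them. *)
Lemma bsmooth_lipschitz_dist (g : Z -> 'C) : bsmooth g -> exists2 K, 0 <= K &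
  forall z w, rnorm (g z - g w) <= K * `|z - w|.
Proof.
move=> bg.
have /choice[Kr hr] : forall j, exists K : R, 0 <= K /\
    forall z, rnorm (cderive (re_dir R j) g z) <= K.
  by move=> j; have [K ? ?] := bsmooth_bounded (bsmooth_cderive (re_dir R j) bg); exists K.
have /choice[Ki hi] : forall j, exists K : R, 0 <= K /\
    forall z, rnorm (cderive (im_dir R j) g z) <= K.
  by move=> j; have [K ? ?] := bsmooth_bounded (bsmooth_cderive (im_dir R j) bg); exists K.
have S0 : 0 <= \sum_j Kr j + \sum_j Ki j.
  by rewrite addr_ge0// sumr_ge0// => j _; [case: (hr j)|case: (hi j)].
exists (2 * (\sum_j Kr j + \sum_j Ki j)) => [|z w]; first by rewrite mulr_ge0.
have := @mean_value R _ g (cderive (z - w) g) w (z - w)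
  ((\sum_j Kr j + \sum_j Ki j) * `|z - w|) 1 (fun y => bsmooth_is_cderive y _ bg).
rewrite scale1r subrK normr1 mulr1 mulrA; apply => t _.
have n1 : `|(z - w).1| <= `|z - w| by rewrite prod_normE le_max lexx.
have n2 : `|(z - w).2| <= `|z - w| by rewrite prod_normE le_max lexx orbT.
set p := t *: _ + _; rewrite [X in cderive X g](point_sum_dir (z - w)).
rewrite (cderiveDv _ _ _ bg) !(cderive_sumv _ _ _ bg) mulrDl.
apply: le_trans (ler_rnormD _ _) _; apply: lerD.
  apply: le_trans (ler_rnorm_sum _ _ _) _; rewrite mulr_suml; apply: ler_sum => j _.
  rewrite (cderiveZv _ _ _ bg) rnormM rnormC mulrC.
  apply: ler_pM; rewrite ?rnorm_ge0//; first by case: (hr j).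
  exact: le_trans (normr_row_coord _ _) n1.
apply: le_trans (ler_rnorm_sum _ _ _) _; rewrite mulr_suml; apply: ler_sum => j _.
rewrite (cderiveZv _ _ _ bg) rnormM rnormC mulrC.
apply: ler_pM; rewrite ?rnorm_ge0//; first by case: (hi j).
exact: le_trans (normr_row_coord _ _) n2.
Qed.

Lemma ball_supported_dbar M j (g : Z -> 'C) : ball_supported M g -> ball_supported M (dbar j g).
Proof.
move=> gM z zM; rewrite /dbar !(ball_supported_cderive _ gM zM).
by rewrite mulr0 addr0 mulr0.
Qed.

Lemma ball_supported_dbar_foldr M (s : seq 'I_m) (g : Z -> 'C) : ball_supported M g ->
  ball_supported M (foldr (@dbar R m) g s).
Proof. by move=> gM; elim: s => //= j s; exact: ball_supported_dbar. Qed.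

(* Forward difference analogue of d/dzbar_j. *)
Definition dbar_forward (h : R) j (g : Z -> 'C) z : 'C := (2 * h)^-1%:C *
  ((g (h *: re_dir R j + z) - g z) + (0 +i* 1) * (g (h *: im_dir R j + z) - g z)).

Lemma dbar_forward_dist j (g : Z -> 'C) : bsmooth g -> exists2 K, 0 <= K &
  forall z (h : R), 0 < h -> rnorm (dbar j g z - dbar_forward h j g z) <= K * h.
Proof.
move=> bg; have [K K0 hK] := bsmooth_quad (re_dir R j) bg.
have [K' K0' hK'] := bsmooth_quad (im_dir R j) bg.
exists (2^-1 * (K + K')) => [|z h h0]; first by rewrite mulr_ge0// addr_ge0.
set a := g (h *: re_dir R j + z); set b := g (h *: im_dir R j + z).
have -> : dbar j g z - dbar_forward h j g z = - ((2 * h)^-1%:C *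
    ((a - g z - h%:C * cderive (re_dir R j) g z) +
     (0 +i* 1) * (b - g z - h%:C * cderive (im_dir R j) g z))).
  have hc : (h%:C : 'C) != 0 by rewrite (inj_eq (@complexI R)) gt_eqF.
  have n2 : (2 : 'C) != 0 by rewrite pnatr_eq0.
  rewrite /dbar_forward -/a -/b /dbar.
  rewrite (_ : ((2 * h)^-1)%:C = (2 * h%:C)^-1); last first.
    by rewrite fmorphV /= rmorphM /= rmorph_nat.
  move: (cderive _ _ _) (cderive (im_dir R j) _ _) (g z) (h%:C) hc (0 +i* 1) a b.
  by move=> p q r s s0 i a b; field; rewrite ?s0 ?n2.
rewrite rnormN rnormM rnormC ger0_norm; last by rewrite invr_ge0 mulr_ge0// ltW.
rewrite ler_pdivrMl ?mulr_gt0//; apply: le_trans (ler_rnormD _ _) _.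
have -> : 2 * h * (2^-1 * (K + K') * h) = K * h ^+ 2 + K' * h ^+ 2 by field.
apply: lerD; first exact: hK.
by rewrite rnormM rnorm_imC normr1 mul1r; exact: hK'.
Qed.

End bsmooth_lipschitz_point.

Section summation_by_parts.
Context (R : realType) (m : nat) (B : normedModType R[i]).
Context (P : 'I_m -> operator B).
Notation Z := ('rV[R]_m * 'rV[R]_m)%type.
Local Notation "'C" := R[i].
Local Notation bprod F := (\big[@bop_comp R B/@bop_id R B]_(i < m) F i).

(** The state after [k] summations by parts: the factors of index below [k] have received their
    difference operator, the others are still waiting. *)
Definition mixed_factor (k : nat) (eps h : R) (z : Z) (i : 'I_m) : bop B :=
  if (i < k)%N then dbar_cutoff (P i) eps h (z.1 0 i) (z.2 0 i)
  else cutoff_resolvent (P i) eps (z.1 0 i) (z.2 0 i).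

Definition mixed_prod k eps h z : bop B := bprod (mixed_factor k eps h z).

Let slot (F : 'I_m -> bop B) k X := bprod (fun i => if i == k then X else F i).

Let slot_lin F k (a : 'C) S T : slot F k (a *: S + T) = a *: slot F k S + slot F k T.
Proof. by apply: bop_prod_slot_lin; rewrite ?index_enum_uniq// mem_index_enum. Qed.

Let slotB F k S T : slot F k (S - T) = slot F k S - slot F k T.
Proof. by rewrite -scaleN1r addrC slot_lin scaleN1r addrC. Qed.

Let slotZ F k (a : 'C) S : slot F k (a *: S) = a *: slot F k S.
Proof.
rewrite -[a *: S]addr0 slot_lin (_ : slot F k 0 = 0) ?addr0//.
by have := slotB F k 0 0; rewrite !subrr.
Qed.

Let slotD F k S T : slot F k (S + T) = slot F k S + slot F k T.
Proof. by have := slot_lin F k 1 S T; rewrite !scale1r. Qed.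

(** The variable z_k occurs in the k-th factor alone, so the difference operator acts inside this
    slot and the order of the operators is respected. *)
Lemma mixed_prod_backward (k : 'I_m) eps h z :
  (2 * h)^-1%:C *: ((mixed_prod k eps h z - mixed_prod k eps h (z - h *: re_dir R k)) +
   (0 +i* 1) *: (mixed_prod k eps h z - mixed_prod k eps h (z - h *: im_dir R k))) =
  mixed_prod k.+1 eps h z.
Proof.
set x := z.1 0 k; set y := z.2 0 k; set F := mixed_factor k eps h z.
have E0 : mixed_prod k eps h z = slot F k (cutoff_resolvent (P k) eps x y).
  apply: eq_bigr => i _; case: eqVneq => [->|//].
  by rewrite /mixed_factor ltnn.
have E1 : mixed_prod k eps h (z - h *: re_dir R k) =
    slot F k (cutoff_resolvent (P k) eps (x - h) y).
  apply: eq_bigr => i _; rewrite /F /mixed_factor /= !mxE /=.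
  case: eqVneq => [->|ik] /=.
    by rewrite ltnn mulr1 mulr0 subr0.
  by rewrite !mulr0 !subr0.
have E2 : mixed_prod k eps h (z - h *: im_dir R k) =
    slot F k (cutoff_resolvent (P k) eps x (y - h)).
  apply: eq_bigr => i _; rewrite /F /mixed_factor /= !mxE /=.
  case: eqVneq => [->|ik] /=.
    by rewrite ltnn mulr1 mulr0 subr0.
  by rewrite !mulr0 !subr0.
rewrite E0 E1 E2 -!slotB -slotZ -slotD -slotZ -/(dbar_cutoff (P k) eps h x y).
apply: eq_bigr => i _; rewrite /F /mixed_factor; case: eqVneq => [->|ik].
  by rewrite ltnSn.
have ik' : (nat_of_ord i == nat_of_ord k) = false.
  by apply: contraNF ik => /eqP/val_inj ->.
by rewrite ltnS [(i <= k)%N]leq_eqVlt ik'.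
Qed.

Let comb_scalel (W : lmodType 'C) (c i p q r : 'C) (u : W) :
  c *: ((p *: u - q *: u) + i *: (r *: u - q *: u)) = (c * ((p - q) + i * (r - q))) *: u.
Proof. by rewrite -!scalerBl scalerA -scalerDl scalerA. Qed.

Let comb_scaler (W : lmodType 'C) (c i p : 'C) (u u1 u2 : W) :
  c *: ((p *: u1 - p *: u) + i *: (p *: u2 - p *: u)) =
  -1 *: (p *: (c *: ((u - u1) + i *: (u - u2)))).
Proof.
rewrite -!scalerBr scaleN1r -!scalerN opprD -scalerN !opprB.
by rewrite [i *: (p *: _)]scalerA mulrC -scalerA -scalerDr !scalerA mulrC.
Qed.

(** Reindexing the grid turns a forward shift of [g] into a backward shift of the operator product.
    No boundary term appears, since [g] vanishes near the faces of the box. *)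
Lemma riemann_sum_by_parts M n (k : 'I_m) eps (g : Z -> 'C) : ball_supported (M%:R - 1) g ->
  riemann_sum M n (fun z => dbar_forward (step R n) k g z *: mixed_prod k eps (step R n) z) =
  - riemann_sum M n (fun z => g z *: mixed_prod k.+1 eps (step R n) z).
Proof.
move=> gM; set h := step R n; set A := mixed_prod k eps h.
have s1 : riemann_sum M n (fun z => g (h *: re_dir R k + z) *: A z) =
    riemann_sum M n (fun z => g z *: A (z - h *: re_dir R k)).
  rewrite -(@riemann_sum_shift_re R m M n _ (fun z => g z *: A (z - h *: re_dir R k)) k).
    by congr riemann_sum; apply/funext => z; rewrite -/h [h *: _ + z - _]addrAC subrr add0r.
  by move=> z zM; rewrite gM// scale0r.
have s2 : riemann_sum M n (fun z => g (h *: im_dir R k + z) *: A z) =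
    riemann_sum M n (fun z => g z *: A (z - h *: im_dir R k)).
  rewrite -(@riemann_sum_shift_im R m M n _ (fun z => g z *: A (z - h *: im_dir R k)) k).
    by congr riemann_sum; apply/funext => z; rewrite -/h [h *: _ + z - _]addrAC subrr add0r.
  by move=> z zM; rewrite gM// scale0r.
pose c : 'C := (2 * h)^-1%:C;
  pose comb (u0 u1 u2 : bop B) := c *: ((u1 - u0) + (0 +i* 1) *: (u2 - u0)).
have sum_comb (f0 f1 f2 : Z -> bop B) : riemann_sum M n (fun z => comb (f0 z) (f1 z) (f2 z)) =
    comb (riemann_sum M n f0) (riemann_sum M n f1) (riemann_sum M n f2).
  rewrite /comb (riemann_sumZ M n c) (riemann_sumD M n) (riemann_sumB M n f1 f0).
  by rewrite (riemann_sumZ M n (0 +i* 1)) (riemann_sumB M n f2 f0).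
transitivity (riemann_sum M n (fun z => comb (g z *: A z)
    (g (h *: re_dir R k + z) *: A z) (g (h *: im_dir R k + z) *: A z))).
  congr riemann_sum; apply/funext => z.
  exact/esym/comb_scalel.
rewrite sum_comb s1 s2 -sum_comb -[RHS]scaleN1r -(riemann_sumZ M n (-1)).
congr riemann_sum; apply/funext => z; rewrite -mixed_prod_backward -/A -/c /comb.
exact: comb_scaler.
Qed.

End summation_by_parts.

(** * Estimates of the operator products, and the vanishing of the integral *)

Section stokes.
Context (R : realType) (m : nat) (B : completeNormedModType R[i]).
Context (P : 'I_m -> operator B).
Notation Z := ('rV[R]_m * 'rV[R]_m)%type.
Local Notation "'C" := R[i].
Hypothesis m0 : (0 < m)%N.
Hypothesis rP : forall j, real_spectrum (P j).
Hypothesis tP : forall j, locally_temperate_resolvent (P j).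

Definition res_prod (z : Z) : bop B :=
  \big[@bop_comp R B/@bop_id R B]_(j < m) resolvent (P j) (z.1 0 j +i* z.2 0 j).

Lemma uniform_resolvent_bound (L : R) : 1 <= L -> exists (C : R) (N : nat), 0 <= C /\
  forall j x y, `|x| <= L -> `|y| <= L -> y != 0 ->
    rnorm (resolvent (P j) (x +i* y)) <= C * (L / `|y|) ^+ N.
Proof.
move=> L1; have /choice[CN h] : forall j, exists CN : R * nat, 0 <= CN.1 /\
    forall x y, `|x| <= L -> `|y| <= L -> y != 0 ->
    rnorm (resolvent (P j) (x +i* y)) <= CN.1 * (L / `|y|) ^+ CN.2.
  by move=> j; have [C [N hN]] := locally_temperate_bound L1 (tP j); exists (C, N).
exists (\sum_j (CN j).1), (\sum_j (CN j).2)%N; split=> [|j x y xL yL y0].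
  by apply: sumr_ge0 => j _; case: (h j).
have [Cj hj] := h j; apply: le_trans (hj x y xL yL y0) _.
have Ly : 1 <= L / `|y| by rewrite ler_pdivlMr ?normr_gt0// mul1r.
apply: ler_pM => //; first by rewrite exprn_ge0// (le_trans ler01).
  by rewrite (bigD1 j)//= lerDl; apply: sumr_ge0 => i _; case: (h i).
by apply: ler_weXn2l => //; rewrite (bigD1 j)//= leq_addr.
Qed.

Section bounds.
Context (L C : R) (N : nat) (L1 : 1 <= L) (C0 : 0 <= C).
Hypothesis resC : forall j x y, `|x| <= L -> `|y| <= L -> y != 0 ->
    rnorm (resolvent (P j) (x +i* y)) <= C * (L / `|y|) ^+ N.

Let L0 : 0 <= L. Proof. exact: le_trans L1. Qed.
Let resP j x y : y != 0 -> is_resolvent (P j) (x +i* y) (resolvent (P j) (x +i* y)).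
Proof. exact: resolventP. Qed.

Let coordL (z : Z) j : `|z| <= L -> `|z.1 0 j| <= L /\ `|z.2 0 j| <= L.
Proof.
rewrite prod_normE ge_max => /andP[h1 h2].
by split; [exact: le_trans (normr_row_coord _ j) h1|exact: le_trans (normr_row_coord _ j) h2].
Qed.

(** The resolvents use up the power N of the weight. The exponent N + 1 leaves one factor
    [prod_im z], which is small near the real hyperplanes and makes the cutoff error small there. *)
Lemma weighted_res_prod_le (g : 'C) (K : R) (z : Z) : 0 <= K -> `|z| <= L ->
  rnorm g <= K * prod_im z ^+ N.+1 ->
  rnorm (g *: res_prod z) <= K * (C * L ^+ N) ^+ m * prod_im z.
Proof.
move=> K0 zL gK; have p0 := prod_im_ge0 z.
have CL0 : 0 <= (C * L ^+ N) ^+ m by rewrite exprn_ge0// mulr_ge0// exprn_ge0.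
(* Where some z_j is real the resolvents are not controlled, but the weight is 0 because its
   exponent N + 1 is positive. *)
have [pz|pz] := eqVneq (prod_im z) 0.
  have -> : g = 0.
    by apply: rnorm_eq0; apply/eqP;
      rewrite eq_le rnorm_ge0 andbT (le_trans gK)// pz exprS mul0r mulr0.
  by rewrite scale0r rnorm0 !mulr_ge0.
have y0 j : z.2 0 j != 0.
  by apply: contra_neq pz => yj; rewrite /prod_im (bigD1 j)//= yj normr0 mul0r.
rewrite rnormZ.
have h : rnorm (res_prod z) <= (C * L ^+ N) ^+ m * (prod_im z ^+ N)^-1.
  have -> : (C * L ^+ N) ^+ m * (prod_im z ^+ N)^-1 = \prod_(j < m) (C * (L / `|z.2 0 j|) ^+ N).
    rewrite /prod_im -prodrXl -prodfV -[X in _ ^+ X](card_ord m) -prodr_const -big_split /=.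
    by apply: eq_bigr => j _; rewrite expr_div_n mulrA.
  by apply: rnorm_bop_prod => j; have [? ?] := coordL j zL; exact: resC.
apply: le_trans (ler_pM (rnorm_ge0 _) (rnorm_ge0 _) gK h) _.
by apply: eq_ler; rewrite exprS; field; rewrite ?expf_neq0.
Qed.

Lemma prod_im_le (z : Z) j : `|z| <= L -> prod_im z <= `|z.2 0 j| * L ^+ m.
Proof.
move=> zL; rewrite /prod_im (bigD1 j)//=; apply: ler_wpM2l => //.
apply: (@le_trans _ _ (\prod_(i < m | i != j) L)).
  by apply: ler_prod => i _; rewrite normr_ge0 (coordL i zL).2.
rewrite prodr_const; apply: ler_weXn2l => //.
by rewrite -[X in (_ <= X)%N](card_ord m) max_card.
Qed.

Lemma prod_im_leL (z : Z) : `|z| <= L -> prod_im z <= L ^+ m.+1.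
Proof.
move=> zL; have [_ h] := coordL (Ordinal m0) zL.
apply: le_trans (prod_im_le (Ordinal m0) zL) _.
by rewrite exprS; apply: ler_wpM2r => //; rewrite exprn_ge0.
Qed.

Lemma mixed_factor_le k eps h (z : Z) i : 0 < eps -> eps <= 1 -> 0 < h -> h <= eps / 2 ->
  `|z| + h <= L ->
  rnorm (mixed_factor P k eps h z i) <=
    1 + far_bound L C N eps + far_bound L C N eps / (2 * eps) + far_bound L C N eps ^+ 3.
Proof.
move=> e0 e1 h0 he zh; set K := far_bound L C N eps.
have K0 : 0 <= K by exact: far_bound_ge0.
have e2 : 0 <= K / (2 * eps) by rewrite divr_ge0// mulr_ge0// ltW.
have K3 : 0 <= K ^+ 3 by rewrite exprn_ge0.
have [x1 y1] : `|z.1 0 i| + h <= L /\ `|z.2 0 i| + h <= L.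
  move: zh; rewrite -!lerBrDr prod_normE ge_max => /andP[z1 z2].
  by split; [exact: le_trans (normr_row_coord _ i) z1|exact: le_trans (normr_row_coord _ i) z2].
rewrite /mixed_factor; case: ifP => _.
  apply: le_trans (dbar_cutoff_le L1 C0 (@resP i) (@resC i) e0 h0 he x1 y1) _.
  have hK : h * K ^+ 3 <= K ^+ 3.
    by rewrite ler_piMl//; apply: le_trans he _; rewrite ler_pdivrMr// (le_trans e1)// mul1r ler1n.
  by case: ifP => _; rewrite -/K; lra.
apply: le_trans (cutoff_resolvent_le L1 C0 (@resC i) e0 _ _) _.
- by rewrite (le_trans _ x1)// lerDl ltW.
- by rewrite (le_trans _ y1)// lerDl ltW.
by rewrite -/K; lra.
Qed.

(** The cutoffs are scalars and factor out as [eta]. Either all |Im z_j| >= 2 eps and [eta] is 1, or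
    the spare factor [prod_im z] is at most 2 eps L^m. *)
Lemma mixed_prod0_dist eps h (g : 'C) (K : R) (z : Z) : 0 < eps -> eps <= 1 -> 0 <= K ->
  `|z| <= L -> rnorm g <= K * prod_im z ^+ N.+1 ->
  rnorm (g *: res_prod z - g *: mixed_prod P 0 eps h z) <=
  (K * (C * L ^+ N) ^+ m * (2 * L ^+ m)) * eps.
Proof.
move=> e0 e1 K0 zL gK; have h1 := weighted_res_prod_le K0 zL gK.
have CL0 : 0 <= (C * L ^+ N) ^+ m by rewrite exprn_ge0// mulr_ge0// exprn_ge0.
pose eta := \prod_(j < m) cutoff eps (z.2 0 j).
have -> : mixed_prod P 0 eps h z = eta%:C *: res_prod z.
  rewrite rmorph_prod -bop_prodZ; apply: eq_bigr => j _.
  by rewrite /mixed_factor ltn0.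
have eta1 : 0 <= eta <= 1.
  rewrite /eta; elim/big_rec : _ => [|j x _ /andP[x0 x1]]; first by rewrite ler01 lexx.
  by rewrite mulr_ge0 ?cutoff_ge0//= mulr_ile1 ?cutoff_ge0 ?cutoff_le1.
rewrite scalerA mulrC -scalerA -[X in rnorm (X - _)]scale1r -scalerBl rnormZ.
have -> : (1 - eta%:C : 'C) = (1 - eta)%:C by rewrite rmorphB.
rewrite rnormC ger0_norm; last by rewrite subr_ge0; case/andP: eta1.
have [far|] := pselect (forall j, 2 * eps <= `|z.2 0 j|).
  rewrite (_ : eta = 1) ?subrr ?mul0r; last first.
    by rewrite /eta big1// => j _; rewrite cutoff_far.
  by rewrite !mulr_ge0// ?exprn_ge0// ltW.
move=> /existsNP[j /negP]; rewrite -ltNge => yj.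
apply: (@le_trans _ _ (1 * (K * (C * L ^+ N) ^+ m * prod_im z))).
  apply: ler_pM => //; rewrite ?rnorm_ge0//; case/andP: eta1 => a b.
    by rewrite subr_ge0.
  by rewrite lerBlDr lerDl.
rewrite mul1r -!mulrA; do 2! apply: ler_wpM2l => //.
apply: le_trans (prod_im_le j zL) _.
have -> : 2 * (L ^+ m * eps) = (2 * eps) * L ^+ m by ring.
by apply: ler_wpM2r; [rewrite exprn_ge0|exact: ltW].
Qed.

(** Near the real points the product grows only polynomially in 1 / eps, with the power (N + 1) m,
    which flatness of h to a slightly higher order compensates. *)
Lemma mixed_prod_m_le eps h (z : Z) : 0 < eps -> eps <= 1 -> 0 < h -> h <= eps / 2 ->
  `|z| + h <= L -> (forall j, `|z.2 0 j| <= 3 * eps) -> h * far_bound L C N eps ^+ 3 <= 1 ->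
  rnorm (mixed_prod P m eps h z) <= ((C * (2 * L) ^+ N + 1) / eps ^+ N.+1) ^+ m.
Proof.
move=> e0 e1 h0 he zh y3 hK; rewrite -[X in _ ^+ X](size_enum_ord m).
rewrite /mixed_prod -[index_enum _]enumT.
apply: rnorm_bop_prod_const => i; rewrite /mixed_factor ltn_ord.
have [x1 y1] : `|z.1 0 i| + h <= L /\ `|z.2 0 i| + h <= L.
  move: zh; rewrite -!lerBrDr prod_normE ge_max => /andP[z1 z2].
  by split; [exact: le_trans (normr_row_coord _ i) z1|exact: le_trans (normr_row_coord _ i) z2].
apply: le_trans (dbar_cutoff_le L1 C0 (@resP i) (@resC i) e0 h0 he x1 y1) _.
rewrite y3; apply: le_trans (lerD (lexx _) hK) _; rewrite [leRHS]mulrDl; apply: lerD.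
  have e0' : eps != 0 by rewrite gt_eqF.
  have -> : far_bound L C N eps = C * (2 * L) ^+ N / eps ^+ N.
    rewrite /far_bound -mulrA -expr_div_n; congr (C * _ ^+ _).
    by field.
  rewrite -[leLHS]mulrA -invfM exprS; apply: ler_wpM2l.
    by rewrite mulr_ge0// exprn_ge0// mulr_ge0.
  rewrite lef_pV2 ?posrE ?mulr_gt0 ?exprn_gt0//.
  rewrite [leRHS]mulrC; apply: ler_wpM2r; first by rewrite exprn_ge0// ltW.
  by have := e0; lra.
by rewrite mul1r invf_ge1 ?exprn_gt0//; apply: exprn_ile1 => //; exact: ltW.
Qed.

(** One factor is at height above 3 eps, where its cutoff is constant and the discrete
    Cauchy-Riemann equation makes it O(h); the crude bound of the other factors does not depend on
    the mesh. *)
Lemma mixed_prod_m_far eps h (z : Z) j (K := far_bound L C N eps)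
    (K1 := 1 + K + K / (2 * eps) + K ^+ 3) : 0 < eps -> eps <= 1 -> 0 < h -> h <= eps / 2 ->
  `|z| + h <= L -> 3 * eps < `|z.2 0 j| ->
  rnorm (mixed_prod P m eps h z) <= h * K ^+ 3 * K1 ^+ m.
Proof.
move=> e0 e1 h0 he zh y3.
have K0 : 0 <= K by exact: far_bound_ge0.
have e2 : 0 <= K / (2 * eps) by rewrite divr_ge0// mulr_ge0// ltW.
have K3 : 0 <= K ^+ 3 by rewrite exprn_ge0.
have K11 : 1 <= K1 by rewrite /K1; lra.
pose f (i : 'I_m) := if i == j then h * K ^+ 3 else K1.
have ff i : rnorm (mixed_factor P m eps h z i) <= f i.
  rewrite /f; case: eqVneq => [->|_]; last exact: mixed_factor_le.
  have [x1 y1] : `|z.1 0 j| + h <= L /\ `|z.2 0 j| + h <= L.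
    move: zh; rewrite -!lerBrDr prod_normE ge_max => /andP[z1 z2].
    by split; [exact: le_trans (normr_row_coord _ j) z1|exact: le_trans (normr_row_coord _ j) z2].
  rewrite /mixed_factor ltn_ord.
  apply: le_trans (dbar_cutoff_le L1 C0 (@resP j) (@resC j) e0 h0 he x1 y1) _.
  by rewrite ifN -?ltNge// add0r.
apply: le_trans (rnorm_bop_prod _ ff) _; rewrite (bigD1 j)//= {1}/f eqxx.
apply: ler_wpM2l; first by rewrite mulr_ge0// ltW.
rewrite (eq_bigr (fun=> K1)) => [|i /negbTE ij]; last by rewrite /f ij.
rewrite prodr_const; apply: ler_weXn2l => //.
by rewrite -[X in (_ <= X)%N](card_ord m) max_card.
Qed.

End bounds.
End stokes.

Section stokes_limit.
Context (R : realType) (m : nat) (B : completeNormedModType R[i]).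
Context (P : 'I_m -> operator B).
Notation Z := ('rV[R]_m * 'rV[R]_m)%type.
Local Notation "'C" := R[i].
Hypothesis m0 : (0 < m)%N.
Hypothesis rP : forall j, real_spectrum (P j).
Hypothesis tP : forall j, locally_temperate_resolvent (P j).

Definition prod_im_bounded (G : Z -> 'C) := forall N : nat, exists2 K, 0 <= K &
  forall z, rnorm (G z) <= K * prod_im z ^+ N.

Lemma gpt_norm M n (k : gridI m M n) : `|gpt R k| <= M%:R.
Proof.
have nb (i : 'I_(2 * M * n.+1)) : `|node R M n i| <= M%:R.
  rewrite ler_norml /node; apply/andP; split.
    by rewrite lerBrDr addNr mulr_ge0//; exact: ltW (step_gt0 R n).
  rewrite lerBlDr /step ler_pdivrMl ?ltr0n//.
  have -> : n.+1%:R * (M%:R + M%:R) = (2 * M * n.+1)%:R :> R by rewrite !natrM; ring.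
  by rewrite ler_nat ltnW.
by rewrite prod_normE ge_max; apply/andP; split; apply: normr_row_le => // j; rewrite mxE.
Qed.

(** [A] and [N] depend on the radius of the support and not on [G]: this uniformity is what the
    seminorm estimate rests on. *)
Lemma weighted_res_prod_bounded (M0 : R) : 0 <= M0 -> exists (A : R) (N : nat), 0 <= A /\
  forall (G : Z -> 'C) (K : R), 0 <= K -> ball_supported M0 G ->
    (forall z, rnorm (G z) <= K * prod_im z ^+ N) ->
  forall z, rnorm (G z *: res_prod P z) <= K * A.
Proof.
move=> M00; have L1 : 1 <= M0 + 1 by rewrite lerDr.
have [C [N [C0 resC]]] := uniform_resolvent_bound tP L1.
exists ((C * (M0 + 1) ^+ N) ^+ m * (M0 + 1) ^+ m.+1), N.+1.
have L0 : 0 <= M0 + 1 by exact: le_trans L1.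
have c0 : 0 <= (C * (M0 + 1) ^+ N) ^+ m by rewrite exprn_ge0// mulr_ge0// exprn_ge0.
split=> [|G K K0 GM GK z]; first by rewrite mulr_ge0// exprn_ge0.
have [zL|zL] := leP `|z| (M0 + 1); last first.
  rewrite GM; last by apply: lt_trans zL; rewrite ltrDl.
  by rewrite scale0r rnorm0 !mulr_ge0// exprn_ge0.
apply: le_trans (weighted_res_prod_le L1 C0 resC K0 zL (GK z)) _.
by rewrite mulrA; apply: ler_wpM2l; [exact: mulr_ge0|exact: prod_im_leL].
Qed.

(** The integrand is within e/4 of its version with cutoff resolvents, uniformly. For the eps so
    fixed, the cutoff version is Lipschitz, and the distance is split into three parts of at most
    e/4 each. *)
Lemma integrand_uniformly_continuous (M0 : R) (G : Z -> 'C) : 0 <= M0 -> bsmooth G ->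
  ball_supported M0 G -> prod_im_bounded G ->
  uniformly_continuous_bop (fun z => G z *: res_prod P z).
Proof.
move=> M00 bG GM GK e e0; set L := M0 + 1.
have L1 : 1 <= L by rewrite lerDr.
have L0 : 0 <= L by exact: le_trans L1.
have [C [N [C0 resC]]] := uniform_resolvent_bound tP L1.
have [K K0 hK] := GK N.+1.
have [MG MG0 hMG] := bsmooth_bounded bG.
have [LG LG0 hLG] := bsmooth_lipschitz_dist bG.
set E := K * (C * L ^+ N) ^+ m * (2 * L ^+ m).
have E0 : 0 <= E.
  apply: mulr_ge0; last by rewrite mulr_ge0// exprn_ge0.
  by rewrite mulr_ge0// exprn_ge0// mulr_ge0// exprn_ge0.
pose eps := Num.min 1 (e / 4 / (E + 1)).
have E10 : 0 < E + 1 by rewrite ltr_wpDl.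
have eps0 : 0 < eps by rewrite lt_min ltr01 !divr_gt0.
have eps1 : eps <= 1 by rewrite ge_min lexx.
have Eeps : E * eps <= e / 4.
  apply: (@le_trans _ _ ((E + 1) * (e / 4 / (E + 1)))).
    by apply: ler_pM; rewrite ?(ltW eps0)// ?lerDl// ge_min lexx orbT.
  by rewrite mulrC divfK ?gt_eqF.
(* With [k = 0] no difference operator occurs, so the step 1 is a dummy argument. *)
pose A z := mixed_prod P 0 eps 1 z.
have near_A z : rnorm (G z *: res_prod P z - G z *: A z) <= e / 4.
  have [zL|zL] := leP `|z| L; last first.
    rewrite GM; last by apply: lt_trans zL; rewrite ltrDl.
    by rewrite !scale0r subrr rnorm0 ltW// divr_gt0.
  exact: le_trans (mixed_prod0_dist L1 C0 resC 1 eps0 eps1 K0 zL (hK z)) Eeps.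
set Kf := far_bound L C N eps; have Kf0 : 0 <= Kf by exact: far_bound_ge0.
pose K1 := 1 + Kf; have K11 : 1 <= K1 by rewrite lerDl.
have K10 : 0 <= K1 by exact: le_trans K11.
pose Q := MG * (m%:R * K1 ^+ m * (2 * Kf ^+ 2 + Kf / eps)) + LG * K1 ^+ m.
have Kq0 : 0 <= 2 * Kf ^+ 2 + Kf / eps.
  apply: addr_ge0; last by apply: divr_ge0 => //; exact: ltW.
  by apply: mulr_ge0 => //; exact: sqr_ge0.
have Q0 : 0 <= Q.
  apply: addr_ge0; last by rewrite mulr_ge0// exprn_ge0.
  by rewrite mulr_ge0// mulr_ge0// mulr_ge0// exprn_ge0.
have Q10 : 0 < Q + 1 by rewrite ltr_wpDl.
pose del := Num.min (eps / 2) (Num.min 1 (e / 4 / (Q + 1))).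
have del0 : 0 < del by rewrite !lt_min ltr01 !divr_gt0.
exists del => // z w zw.
have d1 : `|z - w| <= 1 by apply: le_trans zw _; rewrite !ge_min lexx !orbT.
have d2 : `|z - w| <= eps / 2 by apply: le_trans zw _; rewrite ge_min lexx.
have d3 : `|z - w| <= e / 4 / (Q + 1) by apply: le_trans zw _; rewrite !ge_min lexx !orbT.
have mid : rnorm (G z *: A z - G w *: A w) <= e / 4.
  (* If one of the points is in the ball of radius M0, the other is at distance at most 1 from it;
     hence L = M0 + 1. *)
  have [out|] := pselect (M0 < `|z| /\ M0 < `|w|).
    by rewrite !GM ?scale0r ?subrr ?rnorm0 ?ltW ?divr_gt0//; case: out.
  move=> nout; have [zL wL] : `|z| <= L /\ `|w| <= L.
    have zwd : `|z| <= `|w| + `|z - w|.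
      by rewrite -lerBlDl; exact: lerB_dist.
    have wzd : `|w| <= `|z| + `|z - w|.
      by rewrite -lerBlDl distrC; exact: lerB_dist.
    rewrite /L; have [zM|zM] := leP `|z| M0; first by split; lra.
    have [wM|wM] := leP `|w| M0; first by split; lra.
    by exfalso; apply: nout.
  have -> : G z *: A z - G w *: A w = G z *: (A z - A w) + (G z - G w) *: A w.
    by rewrite scalerBr scalerBl addrA subrK.
  have cz (v : Z) j : `|v| <= L -> `|v.1 0 j| <= L /\ `|v.2 0 j| <= L.
    rewrite prod_normE ge_max => /andP[h1 h2].
    by split; [exact: le_trans (normr_row_coord _ j) h1|exact: le_trans (normr_row_coord _ j) h2].
  have fK (v : Z) j : `|v| <= L -> rnorm (mixed_factor P 0 eps 1 v j) <= K1.
    move=> vL; have [v1 v2] := cz v j vL; rewrite /mixed_factor ltn0.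
    apply: le_trans (cutoff_resolvent_le L1 C0 (resC j) eps0 v1 v2) _.
    by rewrite /K1 -/Kf lerDr.
  have AK : rnorm (A w) <= K1 ^+ m.
    rewrite -[X in _ ^+ X](size_enum_ord m) /A /mixed_prod -[index_enum _]enumT.
    by apply: rnorm_bop_prod_const => j; exact: fK.
  have AA : rnorm (A z - A w) <= m%:R * K1 ^+ m * (`|z - w| * (2 * Kf ^+ 2 + Kf / eps)).
    rewrite -[X in _ ^+ X](size_enum_ord m) -[X in X%:R](size_enum_ord m).
    rewrite /A /mixed_prod -[index_enum _]enumT.
    apply: (rnorm_bop_prod_dist _ K11 (fun j => fK z j zL) (fun j => fK w j wL)) => j.
    have [z1 z2] := cz z j zL; have [w1 w2] := cz w j wL.
    rewrite /mixed_factor ltn0; apply: (cutoff_resolvent_lip L1 C0) => //.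
    - by move=> x y; exact: resolventP.
    - exact: resC.
    - have := normr_row_coord (z - w).1 j; rewrite !mxE => /le_trans; apply.
      by rewrite [leRHS]prod_normE le_max lexx.
    - have := normr_row_coord (z - w).2 j; rewrite !mxE => /le_trans; apply.
      by rewrite [leRHS]prod_normE le_max lexx orbT.
  apply: (@le_trans _ _ (Q * `|z - w|)).
    apply: le_trans (ler_rnormD _ _) _; rewrite !rnormZ /Q mulrDl; apply: lerD.
      apply: le_trans (ler_pM (rnorm_ge0 _) (rnorm_ge0 _) (hMG z) AA) _.
      by apply: eq_ler; ring.
    apply: le_trans (ler_pM (rnorm_ge0 _) (rnorm_ge0 _) (hLG z w) AK) _.
    by apply: eq_ler; ring.
  apply: (@le_trans _ _ ((Q + 1) * (e / 4 / (Q + 1)))).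
    by apply: ler_pM => //; rewrite lerDl.
  by rewrite mulrC divfK ?gt_eqF.
have -> : G z *: res_prod P z - G w *: res_prod P w =
    (G z *: res_prod P z - G z *: A z) + (G z *: A z - G w *: A w) -
    (G w *: res_prod P w - G w *: A w).
  by rewrite addrA subrK opprB addrA subrK.
apply: le_trans (ler_rnormB _ _) _.
have h1 := le_trans (ler_rnormD _ _) (lerD (near_A z) mid).
by apply: le_trans (lerD h1 (near_A w)) _; lra.
Qed.

Lemma weighted_res_prod_bochner (M0 : R) (G : Z -> 'C) (M : nat) : 0 <= M0 -> bsmooth G ->
  ball_supported M0 G -> prod_im_bounded G -> M0 + 1 <= M%:R ->
  let Phi z := G z *: res_prod P z in
  exists I : bop B, [/\ (fun n => riemann_sum M n Phi) @ \oo --> I,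
    has_bochner_integral (lebesgueCm R m) (Phi \o @tup_point R m) I &
    bochner_integral (lebesgueCm R m) (Phi \o @tup_point R m) = I].
Proof.
move=> M00 bG GM GK MM Phi; have [A [N [A0 hA]]] := weighted_res_prod_bounded M00.
have [K K0 hK] := GK N.
apply: (@riemann_bochner _ _ _ M Phi (K * A)).
- move=> z zM; rewrite /Phi GM ?scale0r//; apply: le_lt_trans zM.
  by rewrite lerBrDr.
- exact: hA.
- exact: (integrand_uniformly_continuous M00).
Qed.

Let enum_split k (km : (k < m)%N) :
  drop k (enum 'I_m) = Ordinal km :: drop k.+1 (enum 'I_m).
Proof.
rewrite (drop_nth (Ordinal km)) ?size_enum_ord//; congr (_ :: _).
by apply: val_inj; rewrite /= nth_enum_ord.
Qed.

(* Only the part near the real directions survives after m summations by parts,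
   and there h is O(eps^N) for every N. *)
Lemma riemann_limit_eq0 (M0 : R) (h : Z -> 'C) (M : nat) (I : bop B) : 0 <= M0 -> bsmooth h ->
  ball_supported M0 h -> M0 + 1 <= M%:R ->
  (forall N : nat, exists2 K, 0 <= K & forall z, rnorm (h z) <= K * `|z.2| ^+ N) ->
  prod_im_bounded (foldr (@dbar R m) h (enum 'I_m)) ->
  (fun n => riemann_sum M n (fun z => foldr (@dbar R m) h (enum 'I_m) z *: res_prod P z))
    @ \oo --> I -> I = 0.
Proof.
move=> M00 bh hM MM hN GK cvI; set G := foldr _ _ _ in GK cvI.
pose L : R := M%:R + 1; have L1 : 1 <= L by rewrite lerDr.
have L0 : 0 <= L by exact: le_trans L1.
have [C [N [C0 resC]]] := uniform_resolvent_bound tP L1.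
have [K K0 hK] := GK N.+1.
(* One more than the power (N + 1) m of 1 / eps in [mixed_prod_m_le], so that a factor eps
   survives. *)
set N1 := (N.+1 * m).+1; have [Kh Kh0 hKh] := hN N1.
have [Mh Mh0 hMh] := bsmooth_bounded bh.
pose vol : R := ((2 * M%:R) ^+ 2) ^+ m.
have vol0 : 0 <= vol by rewrite exprn_ge0// sqr_ge0.
pose E1 := K * (C * L ^+ N) ^+ m * (2 * L ^+ m).
pose cc := C * (2 * L) ^+ N + 1.
pose E2 := Kh * 3 ^+ N1 * cc ^+ m + 1.
(* The derivative of smallest index is outermost in [foldr], so the k-th summation by parts strips
   the head of the list; at [k = m] only [h] is left. *)
pose gk k := foldr (@dbar R m) h (drop k (enum 'I_m)).
have bgk k : bsmooth (gk k) by exact: dbar_foldr_bsmooth.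
have gkM k : ball_supported (M%:R - 1) (gk k).
  apply: ball_supported_dbar_foldr => z zM; apply: hM; apply: le_lt_trans zM.
  by rewrite lerBrDr.
have gridL n (k : gridI m M n) : `|gpt R k| + step R n <= L.
  apply: lerD; first exact: gpt_norm.
  by rewrite /step invf_le1 ?ltr0n// ler1n.
have gridL' n (k : gridI m M n) : `|gpt R k| <= L.
  by apply: le_trans (gridL n k); rewrite lerDl ltW// step_gt0.
apply: (@eq0_rnorm_le _ _ _ (vol * E1 + vol * E2 + 1)) => eps eps0 eps1.
pose Kf := far_bound L C N eps; have Kf0 : 0 <= Kf by exact: far_bound_ge0.
pose K1 := 1 + Kf + Kf / (2 * eps) + Kf ^+ 3.
have K10 : 0 <= K1.
  have e2 : 0 <= Kf / (2 * eps) by rewrite divr_ge0// mulr_ge0// ltW.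
  have K3 : 0 <= Kf ^+ 3 by rewrite exprn_ge0.
  by rewrite /K1; lra.
pose S n k := rnorm (riemann_sum M n (fun z => gk k z *: mixed_prod P k eps (step R n) z)).
(* Replacing dbar by its forward difference costs O(step) at each stage. The constant [D] depends on
   eps but not on [n]. *)
have claim k : (k <= m)%N -> exists2 D : R, 0 <= D & forall n, step R n <= eps / 2 ->
    S n 0%N <= S n k + D * step R n.
  elim: k => [|k IH] km; first by exists 0 => // n _; rewrite mul0r addr0.
  have [D D0 hD] := IH (ltnW km).
  have gE : gk k = dbar (Ordinal km) (gk k.+1) by rewrite /gk (enum_split km).
  have [Q Q0 hQ] := dbar_forward_dist (Ordinal km) (bgk k.+1).
  exists (D + vol * (Q * K1 ^+ m)) => [|n he].
    by rewrite addr_ge0// mulr_ge0// mulr_ge0// exprn_ge0.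
  suff main : S n k <= S n k.+1 + vol * (Q * K1 ^+ m) * step R n.
    apply: le_trans (hD n he) _; rewrite mulrDl [X in _ <= _ + X]addrC addrA.
    by rewrite lerD2r.
  pose A := mixed_prod P k eps (step R n).
  pose err z := (dbar (Ordinal km) (gk k.+1) z - dbar_forward (step R n) (Ordinal km) (gk k.+1) z) *: A z.
  have -> : S n k = rnorm (riemann_sum M n err -
      riemann_sum M n (fun z => gk k.+1 z *: mixed_prod P k.+1 eps (step R n) z)).
    rewrite /S -(riemann_sum_by_parts P n (Ordinal km) eps (gkM k.+1)) -riemann_sumD.
    congr rnorm; congr riemann_sum; apply/funext => z.
    by rewrite /err scalerBl subrK gE.
  apply: le_trans (ler_rnormB _ _) _; rewrite addrC lerD2l.
  rewrite -mulrA; apply: riemann_sum_le => p; rewrite rnormZ.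
  rewrite mulrAC; apply: ler_pM; rewrite ?rnorm_ge0//; first by apply: hQ; exact: step_gt0.
  rewrite -[X in _ ^+ X](size_enum_ord m) /A /mixed_prod -[index_enum _]enumT.
  apply: rnorm_bop_prod_const => j.
  by apply: (mixed_factor_le rP L1 C0 resC) => //; exact: step_gt0.
have [D D0 hD] := claim m (leqnn m).
have cK : 0 <= Mh * (Kf ^+ 3 * K1 ^+ m) by rewrite mulr_ge0// mulr_ge0 ?exprn_ge0.
(* With eps fixed, a mesh below eps / bigK brings every error whose constant depends on eps below
   eps. *)
pose bigK := D + Kf ^+ 3 + Mh * (Kf ^+ 3 * K1 ^+ m) + 1.
have K30 : 0 <= Kf ^+ 3 by rewrite exprn_ge0.
have bigK0 : 0 < bigK by rewrite /bigK; lra.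
have mn0 : 0 < Num.min (eps / 2) (eps / bigK) by rewrite lt_min !divr_gt0.
have [n0 hn0] := step_small mn0.
rewrite -(subr0 I); apply: (rnorm_cvg_le (N := n0) cvI) => n nn; rewrite subr0.
have := hn0 n nn; rewrite le_min => /andP[he heK].
have s0 := step_gt0 R n.
have hbig : step R n * bigK <= eps by rewrite -ler_pdivlMr.
have hK3 : step R n * Kf ^+ 3 <= eps.
  by apply: le_trans hbig; apply: ler_wpM2l; [exact: ltW|rewrite /bigK; lra].
have hDn : D * step R n <= eps.
  by apply: le_trans hbig; rewrite mulrC; apply: ler_wpM2l; [exact: ltW|rewrite /bigK; lra].
have hcK : step R n * (Mh * (Kf ^+ 3 * K1 ^+ m)) <= eps.
  by apply: le_trans hbig; apply: ler_wpM2l; [exact: ltW|rewrite /bigK; lra].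
have Sm : S n m <= vol * (E2 * eps).
  apply: riemann_sum_le => p; rewrite /gk drop_oversize ?size_enum_ord//= rnormZ.
  have E2e : E2 * eps = Kh * 3 ^+ N1 * cc ^+ m * eps + eps by rewrite /E2; ring.
  have cc0 : 0 <= cc by rewrite /cc addr_ge0// mulr_ge0// exprn_ge0// mulr_ge0.
  have [near|] := pselect (forall j, `|(gpt R p).2 0 j| <= 3 * eps).
    rewrite E2e; apply: (@le_trans _ _ (Kh * 3 ^+ N1 * cc ^+ m * eps)); last first.
      by rewrite lerDl ltW.
    have e3 : 0 <= 3 * eps by rewrite mulr_ge0// ltW.
    have h1 : rnorm (h (gpt R p)) <= Kh * (3 * eps) ^+ N1.
      apply: le_trans (hKh _) _; apply: ler_wpM2l => //; apply: ler_wXn2r => //.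
      exact: normr_row_le.
    have h2 := mixed_prod_m_le rP L1 C0 resC eps0 eps1 s0 he (gridL n p) near (le_trans hK3 eps1).
    apply: le_trans (ler_pM (rnorm_ge0 _) (rnorm_ge0 _) h1 h2) _; apply: eq_ler.
    rewrite -/cc expr_div_n -exprM.
    have -> : (3 * eps) ^+ N1 = 3 ^+ N1 * (eps * eps ^+ (N.+1 * m)).
      by rewrite exprMn /N1 [eps ^+ _.+1]exprS.
    have : eps ^+ (N.+1 * m) != 0 by rewrite expf_neq0// gt_eqF.
    by move: (eps ^+ _) (3 ^+ _) (cc ^+ _) => q1 q2 q3 q10; field.
  move=> /existsNP[j /negP]; rewrite -ltNge => yj; rewrite E2e.
  apply: (@le_trans _ _ eps); last by rewrite lerDr !mulr_ge0 ?exprn_ge0 ?(ltW eps0).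
  have h2 := mixed_prod_m_far rP L1 C0 resC eps0 eps1 s0 he (gridL n p) yj.
  apply: le_trans (ler_pM (rnorm_ge0 _) (rnorm_ge0 _) (hMh _) h2) _.
  by apply: le_trans hcK; apply: eq_ler; rewrite -/Kf -/K1; ring.
have S0 : rnorm (riemann_sum M n (fun z => G z *: res_prod P z)) <= vol * (E1 * eps) + S n 0%N.
  have GE : gk 0%N = G by rewrite /gk drop0.
  rewrite /S GE.
  apply: le_trans (ler_rnorm_dist _ (riemann_sum M n (fun z => G z *: mixed_prod P 0 eps (step R n) z))) _.
  rewrite addrC lerD2r -riemann_sumB; apply: riemann_sum_le => p.
  exact: (mixed_prod0_dist L1 C0 resC _ eps0 eps1 K0 (gridL' n p) (hK _)).
apply: le_trans S0 _; have := hD n he; rewrite 2!mulrDl mul1r -!mulrA.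
by move: hDn Sm; lra.
Qed.

End stokes_limit.

(** * A smooth plateau function *)

Section bump.
Context (R : realType).
Local Notation "'C" := R[i].

(** The functions t^(-k) exp(-1/t), extended by 0, form a family closed under differentiation up to
    linear combinations, so smoothness is proved by induction on the order for all [k] at once. *)
Definition flat_exp (k : nat) (t : R) : R :=
  if 0 < t then t^-1 ^+ k * expR (- t^-1) else 0.

Lemma flat_exp_ge0 k t : 0 <= flat_exp k t.
Proof.
rewrite /flat_exp; case: ifPn => // t0.
by rewrite mulr_ge0 ?expR_ge0// exprn_ge0// invr_ge0 ltW.
Qed.

Lemma flat_exp_nonpos k t : t <= 0 -> flat_exp k t = 0.
Proof. by rewrite /flat_exp ltNge => ->. Qed.

(** For s = 1 / (k t), the inequality s <= exp(s) raised to the power k reads (1 / (k t))^k <= exp(1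
    / t). The case k = 0 is separate because of the division. *)
Lemma flat_exp_le k t : flat_exp k t <= k%:R ^+ k.
Proof.
rewrite /flat_exp; case: ifPn => [t0|_]; last by rewrite exprn_ge0.
have ti : 0 < t^-1 by rewrite invr_gt0.
case: k => [|k].
  by rewrite !expr0 mul1r -[leRHS]expR0 ler_expR oppr_le0 ltW.
rewrite expRN ler_pdivrMr ?expR_gt0//.
have -> : t^-1 = k.+1%:R * (t^-1 / k.+1%:R) by rewrite mulrC divfK ?pnatr_eq0.
rewrite exprMn [k.+1%:R * _]mulrC expRM_natr; apply: ler_wpM2l; first by rewrite exprn_ge0.
apply: ler_wXn2r; first by rewrite divr_ge0// ltW.
by apply: le_trans (expR_ge1Dx _); rewrite lerDr.
Qed.

Lemma is_derive_flat_exp k (t : R^o) :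
  is_derive t (1 : R^o) (flat_exp k : R^o -> R) (flat_exp k.+2 t - k%:R * flat_exp k.+1 t).
Proof.
have [t0|t0|t0] := ltgtP t 0.
- rewrite !flat_exp_nonpos ?(ltW t0)// mulr0 subr0.
  apply: (near_eq_is_derive (f := cst 0)).
  near=> s; rewrite flat_exp_nonpos//= ltW//; near: s.
  by apply: open_nbhs_nbhs; split; [exact: open_lt|].
- have ti0 : t != 0 by rewrite gt_eqF.
  pose f : R^o -> R := (fun s : R => s^-1) ^+ k * (expR \o (- (fun s : R => s^-1))).
  apply: (near_eq_is_derive (f := f)).
    near=> s; rewrite /flat_exp /f (_ : 0 < s) ?fctE//; near: s.
    by apply: open_nbhs_nbhs; split; [exact: open_gt|].
  have dV := is_deriveV ti0 (is_derive_id (t : R) (1 : R)).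
  have dE := @is_derive1_comp R expR (- (fun s : R => s^-1)) t _ _
    (is_derive_expR (- t^-1)) (is_deriveN dV).
  apply: (is_derive_eq (is_deriveM (is_deriveX k dV) dE)).
  rewrite /flat_exp t0 /GRing.scale /= fctE.
  case: k {f} => [|k]; first by rewrite !expr0 mul0r; field.
  by rewrite -pred_Sn !exprS; field.
(* At 0 the derivative is read off a quadratic bound: for h > 0, [flat_exp k h] is h^2 times
   [flat_exp k.+2 h], which is bounded. *)
- rewrite t0 !flat_exp_nonpos// mulr0 subr0.
  apply: (@is_derive_quad _ _ _ _ _ _ (k.+2%:R ^+ k.+2)) => h.
  rewrite addr0 scale1_regular mulr0 subr0 (flat_exp_nonpos k (lexx 0)) subr0.
  rewrite ger0_norm ?flat_exp_ge0//.
  have [h0|h0] := ltP 0 h; last first.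
    by rewrite flat_exp_nonpos// mulr_ge0 ?sqr_ge0// exprn_ge0.
  have -> : flat_exp k h = flat_exp k.+2 h * h ^+ 2.
    by rewrite /flat_exp h0 !exprS; field; rewrite gt_eqF.
  by apply: ler_wpM2r; [exact: sqr_ge0|exact: flat_exp_le].
Unshelve. all: by end_near. Qed.

Definition flat_exp_deriv k (t : R) : R := flat_exp k.+2 t - k%:R * flat_exp k.+1 t.

Let flat_exp_deriv_bounded k : exists2 M, 0 <= M & forall s, `|flat_exp_deriv k s| <= M.
Proof.
exists (k.+2%:R ^+ k.+2 + k%:R * k.+1%:R ^+ k.+1) => [|s].
  by apply: addr_ge0; [exact: exprn_ge0|apply: mulr_ge0 => //; exact: exprn_ge0].
apply: le_trans (ler_normB _ _) _; apply: lerD; rewrite ger0_norm ?flat_exp_ge0 ?flat_exp_le//.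
  by apply: ler_wpM2l => //; exact: flat_exp_le.
by rewrite mulr_ge0// flat_exp_ge0.
Qed.

Lemma flat_exp_quad k : exists2 M, 0 <= M & forall t h : R,
  `|flat_exp k (h + t) - flat_exp k t - h * flat_exp_deriv k t| <= M * h ^+ 2.
Proof.
pose d2 t := flat_exp_deriv k.+2 t - k%:R * flat_exp_deriv k.+1 t.
have h1 j (s : R^o) : is_derive s (1 : R^o) (flat_exp j : R^o -> R) (flat_exp_deriv j s).
  exact: is_derive_flat_exp.
have h2 (s : R^o) : is_derive s (1 : R^o) (flat_exp_deriv k : R^o -> R) (d2 s).
  rewrite (_ : flat_exp_deriv k =
    (flat_exp k.+2 : R^o -> R) - k%:R \*: (flat_exp k.+1 : R^o -> R))//.
  exact: (is_deriveB (h1 _ s) (is_deriveZ k%:R (h1 _ s))).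
have [M1 M10 hM1] := flat_exp_deriv_bounded k.+2.
have [M2 M20 hM2] := flat_exp_deriv_bounded k.+1.
exists (M1 + k%:R * M2) => [|t h]; first by rewrite addr_ge0 ?mulr_ge0.
have := @mean_value_quad_real R R^o (flat_exp k) (flat_exp_deriv k) d2 t 1 (M1 + k%:R * M2) h
  (h1 k) h2.
rewrite scale1_regular; apply => s; apply: le_trans (ler_normB _ _) _; apply: lerD => //.
by rewrite normrM ger0_norm// ler_wpM2l.
Qed.

Let continuous_flat_exp k : continuous (flat_exp k).
Proof.
move=> s; apply: differentiable_continuous; apply/derivable1_diffP.
exact: (@ex_derive _ _ _ _ _ _ _ (is_derive_flat_exp k s)).
Qed.

Let rnorm_flat_exp k s : rnorm ((flat_exp k s)%:C : 'C) <= k%:R ^+ k.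
Proof. by rewrite rnormC ger0_norm ?flat_exp_ge0 ?flat_exp_le. Qed.

Let is_cderive_flat_exp k (t v : R^o) :
  is_cderive (fun s : R^o => (flat_exp k s)%:C) t v (v%:C * (flat_exp_deriv k t)%:C).
Proof.
have [M M0 hM] := flat_exp_quad k.
apply: (@is_cderive_quad _ _ _ _ _ _ (M * v ^+ 2)) => h.
rewrite -!(rmorphM, rmorphB) /= rnormC mulrA.
by apply: le_trans (hM t (h * v)) _; rewrite exprMn mulrA mulrAC.
Qed.

Let flat_exp_derivC k t :
  (flat_exp_deriv k t)%:C = (flat_exp k.+2 t)%:C + (- k%:R) * (flat_exp k.+1 t)%:C :> 'C.
Proof. by rewrite /flat_exp_deriv rmorphB rmorphM rmorph_nat mulNr. Qed.

Lemma bsmooth_flat_exp k : bsmooth (fun s : R^o => (flat_exp k s)%:C).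
Proof.
have base k' : ccontinuous (fun s : R^o => (flat_exp k' s)%:C).
  by split => s /=; [exact: continuous_flat_exp|exact: cst_continuous].
move=> n; elim: n k => [|n IH] k;
  (split; [exact: base|by exists (k%:R ^+ k) => s; exact: rnorm_flat_exp|]) => //= v.
have E x := cderive_val (is_cderive_flat_exp k x v).
split => [x|]; first by rewrite E; exact: is_cderive_flat_exp.
rewrite (funext E); apply: bcnM; first exact: bcn_cst.
by under eq_fun do rewrite flat_exp_derivC; apply: bcnD => //; apply: bcnM => //; exact: bcn_cst.
Qed.

(** The chain rule comes from composing quadratic remainders: that of [flat_exp] at the increment b
    - a = O(h), and that of [g] multiplied by the bounded derivative of [flat_exp]. *)
Lemma bsmooth_flat_exp_comp (V : normedModType R) k (g : V -> R) :
  bsmooth (fun z => (g z)%:C) -> bsmooth (fun z => (flat_exp k (g z))%:C).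
Proof.
move=> bg; have [cg _] := bsmooth_continuous bg.
have base k' : ccontinuous (fun z => (flat_exp k' (g z))%:C).
  split => z /=; last exact: cst_continuous.
  by apply: (continuous_comp (cg z)); exact: continuous_flat_exp.
move=> n; elim: n k => [|n IH] k;
  (split; [exact: base|by exists (k%:R ^+ k) => s; exact: rnorm_flat_exp|]) => //= v.
pose dg z := 'D_v g z.
have dgE z : cderive v (fun z => (g z)%:C) z = (dg z)%:C.
  by rewrite /cderive /dg /= derive_cst.
have d z : is_cderive (fun z => (flat_exp k (g z))%:C) z v
    ((flat_exp_deriv k (g z))%:C * (dg z)%:C).
  have [M M0 hM] := flat_exp_quad k; have [L L0 hL] := bsmooth_lipschitz v bg.
  have [Q Q0 hQ] := bsmooth_quad v bg; have [D D0 hD] := flat_exp_deriv_bounded k.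
  apply: (@is_cderive_quad _ _ _ _ _ _ (M * L ^+ 2 + D * Q)) => h.
  rewrite -!(rmorphM, rmorphB) /= rnormC.
  set b := g (h *: v + z); set a := g z.
  have hl : `|b - a| <= L * `|h| by have := hL z h; rewrite -rmorphB /= rnormC.
  have hq : `|b - a - h * dg z| <= Q * h ^+ 2.
    by have := hQ z h; rewrite dgE -!(rmorphM, rmorphB) /= rnormC.
  have := hM a (b - a); rewrite subrK => hm.
  have -> : flat_exp k b - flat_exp k a - h * (flat_exp_deriv k a * dg z) =
    (flat_exp k b - flat_exp k a - (b - a) * flat_exp_deriv k a) +
    flat_exp_deriv k a * (b - a - h * dg z) by ring.
  apply: le_trans (ler_normD _ _) _; rewrite [leRHS]mulrDl; apply: lerD.
    apply: le_trans hm _; rewrite -mulrA; apply: ler_wpM2l => //.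
    rewrite -[leLHS]real_normK ?num_real// -[h ^+ 2]real_normK ?num_real// -exprMn.
    exact: ler_wXn2r.
  by rewrite normrM -mulrA; apply: ler_pM.
have E x := cderive_val (d x).
split => [x|]; first by rewrite E.
rewrite (funext E); apply: bcnM; last first.
  by rewrite -(funext dgE); exact: bsmooth_cderive.
by under eq_fun do rewrite flat_exp_derivC; apply: bcnD => //; apply: bcnM => //; exact: bcn_cst.
Qed.

Definition excess (M t : R) : R := flat_exp 0 (t - M) + flat_exp 0 (- t - M).

(** No integration is involved. [excess] is 0 on [-M, M] and at least 1/e for |t| >= M + 1; the
    outer function is therefore evaluated at 1 on the plateau, where e * exp(-1) = 1, and at a
    nonpositive number far away. *)
Definition plateau (M t : R) : R := expR 1 * flat_exp 0 (1 - expR 1 * excess M t).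

Lemma plateau1 M t : `|t| <= M -> plateau M t = 1.
Proof.
rewrite ler_norml => /andP[t1 t2].
have e0 : excess M t = 0.
  by rewrite /excess !flat_exp_nonpos ?addr0 ?subr_le0// lerNl.
by rewrite /plateau e0 mulr0 subr0 /flat_exp ltr01 expr0 mul1r invr1 -expRD subrr expR0.
Qed.

Lemma plateau0 M t : M + 1 <= `|t| -> plateau M t = 0.
Proof.
move=> tM; rewrite /plateau flat_exp_nonpos ?mulr0// subr_le0.
have key s : 1 <= s -> 1 <= expR 1 * flat_exp 0 s.
  move=> s1; have s0 : 0 < s by exact: lt_le_trans s1.
  rewrite /flat_exp s0 expr0 mul1r -expRD -[leLHS]expR0 ler_expR subr_ge0.
  by rewrite invf_le1.
rewrite /excess mulrDr; have [t0|t0] := leP 0 t.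
  apply: le_trans (key (t - M) _) _.
    by rewrite lerBrDr addrC; rewrite ger0_norm in tM.
  by rewrite lerDl mulr_ge0 ?expR_ge0 ?flat_exp_ge0.
apply: le_trans (key (- t - M) _) _.
  by rewrite lerBrDr addrC; rewrite ltr0_norm in tM.
by rewrite lerDr mulr_ge0 ?expR_ge0 ?flat_exp_ge0.
Qed.

Lemma bsmooth_plateau M : bsmooth (fun t : R^o => (plateau M t)%:C).
Proof.
have aff (a b : R) : bsmooth (fun t : R^o => (flat_exp 0 (a * t + b))%:C).
  apply: (@bsmooth_affine R R^o R^o (fun s => (flat_exp 0 s)%:C)
    (fun t => a * t + b) (fun t => a * t)).
  - by move=> x v h; rewrite /GRing.scale /=; ring.
  - move=> x; apply: cvgD; last exact: cvg_cst.
    by apply: cvgM; [exact: cvg_cst|exact: cvg_id].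
  - exact: bsmooth_flat_exp.
have ex : bsmooth (fun t : R^o => (1 - expR 1 * excess M t)%:C).
  have := bsmoothB (bsmooth_cst R^o 1) (bsmoothZ (expR 1)%:C (bsmoothD (aff 1 (- M)) (aff (-1) (- M)))).
  congr bsmooth; apply/funext => t.
  by rewrite /excess mul1r mulN1r !(rmorphB, rmorphM, rmorphD, rmorph1).
have := bsmoothZ (expR 1)%:C (bsmooth_flat_exp_comp 0 ex).
by congr bsmooth; apply/funext => t; rewrite /plateau rmorphM.
Qed.

End bump.

(** * Coefficients with vanishing moments *)

Section complex_series.
Context (R : realType).
Local Notation "'C" := R[i].
Implicit Types (u v : nat -> 'C).

Definition is_csum u (l : 'C) := forall e : R, 0 < e -> exists N : nat,
  forall n, (N <= n)%N -> rnorm (\sum_(k < n) u k - l) <= e.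

Definition csum u : 'C := xget 0 [set l | is_csum u l].

Lemma is_csum_le u (l : 'C) (S : R) : is_csum u l ->
  (forall n, rnorm (\sum_(k < n) u k) <= S) -> rnorm l <= S.
Proof.
move=> ul uS; apply/ler_addgt0Pr => e e0; have [N hN] := ul e e0.
apply: le_trans (ler_rnorm_dist _ (\sum_(k < N) u k)) _.
by apply: lerD => //; rewrite rnormB; exact: hN.
Qed.

Lemma is_csum_unique u (l l' : 'C) : is_csum u l -> is_csum u l' -> l = l'.
Proof.
move=> ul ul'; apply/eqP; rewrite -subr_eq0; apply/eqP.
apply: (@eq0_rnorm_le _ _ _ 2) => e e0 _; have [N hN] := ul e e0; have [N' hN'] := ul' e e0.
pose s := \sum_(k < maxn N N') u k.
have -> : l - l' = (s - l') - (s - l) by ring.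
rewrite mulrDl mul1r; apply: le_trans (ler_rnormB _ _) _; apply: lerD.
  by apply: hN'; rewrite leq_maxr.
by apply: hN; rewrite leq_maxl.
Qed.

Lemma is_csumE u (l : 'C) : is_csum u l -> csum u = l.
Proof.
move=> ul; rewrite /csum; case: xgetP => [l' -> /= ul'|/(_ l)//].
exact: is_csum_unique ul' ul.
Qed.

Let real_series_cvg (u : nat -> R) (S : R) : (forall n, \sum_(k < n) `|u k| <= S) ->
  exists l, forall e, 0 < e -> exists N : nat, forall n, (N <= n)%N -> `|\sum_(k < n) u k - l| <= e.
Proof.
move=> uS; have cv : cvgn (series u).
  apply: normed_cvg; apply: nondecreasing_is_cvgn.
    by apply: nondecreasing_series => n _ _; exact: normr_ge0.
  by exists S => _ [n _ <-]; apply: le_trans (uS n); rewrite /= seriesEord.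
have /cvg_ex[l ul] := cv; exists l => e e0.
have /cvgrPdist_le /(_ e e0)[N _ hN] := ul; exists N => n Nn.
by have := hN n Nn; rewrite /= distrC seriesEord.
Qed.

Lemma csumP u (S : R) : (forall n, \sum_(k < n) rnorm (u k) <= S) -> is_csum u (csum u).
Proof.
move=> uS; suff [l ul] : exists l, is_csum u l by rewrite (is_csumE ul).
have [a ha] : exists l, forall e : R, 0 < e -> exists N : nat, forall n, (N <= n)%N ->
    `|\sum_(k < n) complex.Re (u k) - l| <= e.
  apply: (@real_series_cvg (fun k => complex.Re (u k)) S) => n; apply: le_trans (uS n);
    apply: ler_sum => k _.
  exact: ge_rnorm_Re.
have [b hb] : exists l, forall e : R, 0 < e -> exists N : nat, forall n, (N <= n)%N ->
    `|\sum_(k < n) complex.Im (u k) - l| <= e.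
  apply: (@real_series_cvg (fun k => complex.Im (u k)) S) => n; apply: le_trans (uS n);
    apply: ler_sum => k _.
  exact: ge_rnorm_Im.
exists (a +i* b) => e e0; have e20 : 0 < e / 2 by rewrite divr_gt0.
have [N hN] := ha _ e20; have [N' hN'] := hb _ e20.
exists (maxn N N') => n; rewrite geq_max => /andP[nN nN'].
have sRe : complex.Re (\sum_(k < n) u k) = \sum_(k < n) complex.Re (u k).
  exact: (big_morph _ (@ReD R) (erefl _)).
have sIm : complex.Im (\sum_(k < n) u k) = \sum_(k < n) complex.Im (u k).
  exact: (big_morph _ (@ImD R) (erefl _)).
apply: le_trans (rnorm_le_ReIm _) _; rewrite !raddfB /= sRe sIm [e]splitr.
by apply: lerD; [exact: hN|exact: hN'].
Qed.

Lemma is_csumD u v l l' : is_csum u l -> is_csum v l' ->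
  is_csum (fun k => u k + v k) (l + l').
Proof.
move=> ul vl e e0; have e20 : 0 < e / 2 by rewrite divr_gt0.
have [N hN] := ul _ e20; have [N' hN'] := vl _ e20.
exists (maxn N N') => n; rewrite geq_max => /andP[nN nN'].
rewrite big_split /= opprD addrACA [e]splitr; apply: le_trans (ler_rnormD _ _) _.
by apply: lerD; [exact: hN|exact: hN'].
Qed.

Lemma is_csumZ (a : 'C) u l : is_csum u l -> is_csum (fun k => a * u k) (a * l).
Proof.
move=> ul e e0; have a0 : 0 < rnorm a + 1 by rewrite ltr_wpDl ?rnorm_ge0.
have [|N hN] := ul (e / (rnorm a + 1)); first by rewrite divr_gt0.
exists N => n Nn; rewrite -mulr_sumr -mulrBr rnormM.
apply: (@le_trans _ _ ((rnorm a + 1) * (e / (rnorm a + 1)))).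
  by apply: ler_pM; rewrite ?rnorm_ge0 ?lerDl ?hN.
by rewrite mulrC divfK ?gt_eqF.
Qed.

End complex_series.

Section seeley.
Context (R : realType).
Local Notation "'C" := R[i].

(* Coefficients of the entire function prod_(n >= 0) (1 - z / 4^n), which vanishes at
   the powers of 4: hence all the moments sum_k w_k 4^(a k) are 0. *)
Fixpoint seeley (k : nat) : R :=
  if k is k'.+1 then - (4 * seeley k') / (4 ^+ k'.+1 - 1) else 1.

Let b1 k : 1 <= (4 ^+ k : R). Proof. by rewrite exprn_ege1// ler1n. Qed.

Let b3 k : 3 <= (4 ^+ k.+1 - 1 : R).
Proof. by rewrite exprS; have := b1 k; move: (4 ^+ k) => t; lra. Qed.

Let bn0 k : (4 ^+ k.+1 - 1 : R) != 0.
Proof. by rewrite gt_eqF//; apply: lt_le_trans (b3 k). Qed.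

(** Coefficient by coefficient, this is f(4z) = (1 - 4z) f(z) for the generating function f(z) =
    prod_(n >= 0) (1 - z / 4^n). *)
Lemma seeley_rec k : seeley k.+1 * 4 ^+ k.+1 = seeley k.+1 - 4 * seeley k.
Proof. by rewrite /=; field; exact: bn0. Qed.

Let moment n a := \sum_(k < n) seeley k * 4 ^+ (a * k).

Let moment0 n : moment n.+1 0 = seeley n * (4 ^+ n)^-1.
Proof.
rewrite /moment; elim: n => [|n IH].
  by rewrite big_ord_recl big_ord0 expr0 invr1 addr0.
rewrite big_ord_recr /= IH mul0n expr0 mulr1.
have n0 : 4 ^+ n != 0 :> R by rewrite expf_neq0.
have := bn0 n; rewrite exprS; move: (4 ^+ n) n0 (seeley n) => t t0 w t1.
by field; rewrite t0 t1.
Qed.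

(** The recurrence multiplied by 4^(a k) and summed. Partial moments of order a + 1 are combinations
    of those of order a, so all of them tend to 0 as soon as those of order 0 do, and these have the
    closed form [moment0]. *)
Let momentS n a : moment n.+1 a.+1 = moment n.+1 a - 4 ^+ a.+1 * moment n a.
Proof.
rewrite /moment !big_ord_recl !muln0 !expr0 !mulr1 -addrA; congr (_ + _).
rewrite mulr_sumr -sumrB; apply: eq_bigr => k _.
rewrite lift0 mulSn exprD mulrA seeley_rec mulrBl; congr (_ - _).
by rewrite mulnS exprD exprS; ring.
Qed.

Let seeley_le k : `|seeley k| <= 4 / 3.
Proof.
elim: k => [|[|k] IH]; rewrite ?normr1; first by lra.
  have -> : seeley 1 = - (4 / 3).
    by rewrite /= mulr1 expr1 (_ : 4 - 1 = 3 :> R) ?mulNr//; ring.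
  by rewrite normrN ger0_norm//; lra.
rewrite [seeley _]/= -/(seeley k.+1) normrM normrN normfV normrM.
have h : 15 <= (4 ^+ k.+2 - 1 : R) by rewrite !exprS; have := b1 k; move: (4 ^+ k) => t; lra.
rewrite ![`|4|]ger0_norm// [`|_ - 1|]ger0_norm; last by lra.
rewrite ler_pdivrMr; last by lra.
apply: (@le_trans _ _ (4 / 3 * 15)); first by lra.
by apply: ler_wpM2l => //; lra.
Qed.

(** The quotient of consecutive terms of |w_k| (2 * 4^a)^k is 2 * 4^(a+1) / (4^(k+1) - 1), which is
    at most 1 for k > a. This sequence is therefore bounded, and the extra 2^k leaves a geometric
    series. *)
Lemma seeley_summable a : exists S : R, forall n, \sum_(k < n) `|seeley k| * 4 ^+ (a * k) <= S.
Proof.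
pose v k := `|seeley k| * (2 * 4 ^+ a) ^+ k.
have v0 k : 0 <= v k by rewrite mulr_ge0// exprn_ge0// mulr_ge0// exprn_ge0.
have dec k : (a < k)%N -> v k.+1 <= v k.
  move=> ak; rewrite /v [seeley k.+1]/= normrM normrN normfV normrM [(_ * _) ^+ k.+1]exprS.
  have h : 2 * 4 ^+ a * 4 <= (4 ^+ k.+1 - 1 : R).
    have : 4 ^+ a.+2 <= 4 ^+ k.+1 :> R by rewrite ler_weXn2l// ler1n.
    by rewrite !exprS; have := b1 a; move: (4 ^+ a) (4 ^+ k) => t u; lra.
  rewrite [`|4|]ger0_norm// [`|_ - 1|]ger0_norm; last by have := b3 k; lra.
  set q := 4 ^+ k.+1 - 1 in h *; have q0 : 0 < q by rewrite /q; have := b3 k; lra.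
  have -> : 4 * `|seeley k| / q * (2 * 4 ^+ a * (2 * 4 ^+ a) ^+ k) =
     (2 * 4 ^+ a * 4 / q) * (`|seeley k| * (2 * 4 ^+ a) ^+ k).
    by field; rewrite gt_eqF.
  by apply: ler_piMl; [exact: v0|rewrite ler_pdivrMr// mul1r].
pose A := \sum_(k < a.+2) v k.
have A0 : 0 <= A by apply: sumr_ge0.
have vA k : v k <= A.
  have small j : (j < a.+2)%N -> v j <= A.
    by move=> ja; rewrite /A (bigD1 (Ordinal ja))//= lerDl; apply: sumr_ge0.
  have [ka|] := ltnP k a.+2; first exact: small.
  elim: k => // k IH; rewrite leq_eqVlt => /predU1P[<-|ka].
    by apply: le_trans (dec _ _) (small _ _).
  by apply: le_trans (dec _ _) (IH _) => //; exact: ltnW.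
exists (A * 2) => n.
have geo : \sum_(k < n) (2^-1 : R) ^+ k <= 2.
  have -> : \sum_(k < n) (2^-1 : R) ^+ k = 2 - 2 * 2^-1 ^+ n.
    elim: n => [|n IH]; first by rewrite big_ord0 expr0; ring.
    by rewrite big_ord_recr /= IH exprS; field.
  by rewrite lerBlDr lerDl mulr_ge0// exprn_ge0// invr_ge0.
apply: le_trans (ler_wpM2l A0 geo); rewrite mulr_sumr; apply: ler_sum => k _.
have -> : `|seeley k| * 4 ^+ (a * k) = v k * 2^-1 ^+ k.
  by rewrite /v exprM -mulrA -exprMn [2 * _]mulrC mulfK.
by apply: ler_wpM2r => //; rewrite exprn_ge0// invr_ge0.
Qed.

Lemma seeley_moment a : is_csum (fun k => (seeley k)%:C * (4%:C) ^+ (a * k)) (0 : 'C).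
Proof.
have mE n : \sum_(k < n) (seeley k)%:C * (4%:C) ^+ (a * k) = (moment n a)%:C :> 'C.
  by rewrite /moment rmorph_sum; apply: eq_bigr => k _; rewrite rmorphM rmorphXn.
suff key : forall e : R, 0 < e -> exists N : nat, forall n, (N <= n)%N -> `|moment n a| <= e.
  move=> e e0; have [N hN] := key e e0; exists N => n Nn.
  by rewrite mE subr0 rnormC; exact: hN.
elim: a {mE} => [|a IH] e e0.
  have [N hN] := @step_small R (e / 2) (divr_gt0 e0 (ltr0Sn _ _)).
  exists N.+1 => -[//|n]; rewrite ltnS => Nn; rewrite moment0 normrM normfV.
  rewrite [X in _ / X]ger0_norm ?exprn_ge0//.
  apply: (@le_trans _ _ (2 * (e / 2))); last by lra.
  apply: ler_pM; rewrite ?invr_ge0 ?exprn_ge0//.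
    by apply: le_trans (seeley_le n) _; lra.
  apply: le_trans (hN n Nn); rewrite /step lef_pV2 ?posrE ?exprn_gt0 ?ltr0n//.
  by rewrite -natrX ler_nat ltn_expl.
have c0 : 0 < 1 + 4 ^+ a.+1 :> R by rewrite ltr_wpDr// exprn_ge0.
have [|N hN] := IH (e / (1 + 4 ^+ a.+1)); first by rewrite divr_gt0.
exists N.+1 => -[//|n]; rewrite ltnS => Nn; rewrite momentS.
apply: le_trans (ler_normB _ _) _; rewrite normrM [X in X * _]ger0_norm ?exprn_ge0//.
apply: (@le_trans _ _ ((1 + 4 ^+ a.+1) * (e / (1 + 4 ^+ a.+1)))).
  rewrite mulrDl mul1r; apply: lerD; first by apply: hN; exact: leqW.
  by apply: ler_wpM2l; [rewrite exprn_ge0|exact: hN].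
by rewrite mulrC divfK ?gt_eqF.
Qed.

Let den k : 'C := 1 + (0 +i* 1) * (4%:C) ^+ k.

Let denE k : den k = 1 +i* (4 ^+ k).
Proof.
rewrite /den -rmorphXn /=.
by apply/eqP; rewrite eq_complex /=; apply/andP; split; apply/eqP; ring.
Qed.

Let den_ge1 k : 1 <= rnorm (den k).
Proof. by apply: le_trans (ge_rnorm_Re _); rewrite denE /= normr1. Qed.

Let den0 k : den k != 0.
Proof. by rewrite -rnorm_gt0; exact: lt_le_trans (den_ge1 k). Qed.

Let pre k : 'C := (seeley k)%:C / den k.

Let pre_le k : rnorm (pre k) <= `|seeley k|.
Proof.
rewrite rnormM rnormC rnormV ler_pdivrMr; last exact: lt_le_trans (den_ge1 k).
by rewrite ler_peMr.
Qed.

Let pre_Re k : complex.Re (pre k) = seeley k / (1 + 16 ^+ k).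
Proof.
rewrite /pre denE.
have e : (1 + 16 ^+ k : R) != 0 by rewrite gt_eqF// ltr_wpDr// exprn_ge0.
have -> : (1 +i* 4 ^+ k : 'C)^-1 = (1 + 16 ^+ k)^-1 +i* (- (4 ^+ k) / (1 + 16 ^+ k)).
  have -> : 16 ^+ k = 4 ^+ k ^+ 2 :> R by rewrite -exprM mulnC exprM; congr (_ ^+ _); ring.
  by apply/eqP; rewrite eq_complex /= expr1n mulNr div1r !eqxx.
by rewrite ReM /= mul0r subr0.
Qed.

(** The term k = 0 is 1/2 and the others are at most (4/3) 16^(-k) in absolute value, with sum 4/45
    over k >= 1. The part (4/45) 16^(-n) is the tail not yet subtracted, which makes the induction
    exact. As 1/2 - 4/45 > 1/4, the normalising sum [kappa] is nonzero. *)
Let pre_sum_Re n : 1 / 2 - 4 / 45 + 4 / 45 * (16 ^+ n)^-1 <= complex.Re (\sum_(k < n.+1) pre k).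
Proof.
have sRe (u : nat -> 'C) j : complex.Re (\sum_(k < j) u k) = \sum_(k < j) complex.Re (u k).
  exact: (big_morph _ (@ReD R) (erefl _)).
elim: n => [|n IH].
  rewrite big_ord1 pre_Re expr0 invr1 -[1 + 1]/(2%:R) -[seeley 0]/(1 : R); lra.
rewrite big_ord_recr [in leRHS]ReD pre_Re.
have e : 0 < 16 ^+ n :> R by rewrite exprn_gt0.
have h : - (4 / 3 * (16 * 16 ^+ n)^-1) <= seeley n.+1 / (1 + 16 ^+ n.+1).
  rewrite lerNl -mulNr; apply: (@le_trans _ _ (`|seeley n.+1| / (1 + 16 ^+ n.+1))).
    by apply: ler_wpM2r; [rewrite invr_ge0 addr_ge0// exprn_ge0|rewrite -normrN ler_norm].
  apply: ler_pM; rewrite ?invr_ge0 ?addr_ge0 ?exprn_ge0//.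
  by rewrite exprS lef_pV2 ?posrE ?ltr_pwDl ?mulr_gt0// ?lerDr// ltW// mulr_gt0.
apply: le_trans (lerD IH h); rewrite exprS le_eqVlt; apply/orP; left; apply/eqP.
by field; rewrite gt_eqF.
Qed.

Let kappa : 'C := csum pre.

Let pre_csum : is_csum pre kappa.
Proof.
have [S hS] := seeley_summable 0; apply: (@csumP _ _ S) => n.
apply: le_trans (hS n); apply: ler_sum => k _.
by rewrite mul0n expr0 mulr1.
Qed.

Let kappa0 : kappa != 0.
Proof.
apply/eqP => k0; have := pre_csum; rewrite k0 => /(_ (1 / 4)) [|N hN]; first by lra.
have := hN N.+1 (leqnSn N); rewrite subr0 => /(le_trans (ge_rnorm_Re _)).
apply/negP; rewrite -ltNge; apply: lt_le_trans (ler_norm _).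
apply: lt_le_trans (pre_sum_Re N).
have : 0 <= (16 ^+ N : R)^-1 by rewrite invr_ge0 exprn_ge0.
by lra.
Qed.

Definition ext_coef k : 'C := pre k / kappa.

Definition ext_scale : 'C := kappa^-1.

Lemma ext_coef_sum : is_csum ext_coef 1.
Proof.
have := is_csumZ kappa^-1 pre_csum; rewrite mulVf//.
by under eq_fun do rewrite mulrC.
Qed.

(** The division by 1 + i 4^k in [pre] is undone by the operator d/dx + i d/dy, so that the
    coefficients with vanishing moments reappear in dbar of the series. *)
Lemma ext_coef_dbar k :
  ext_coef k * (1 + (0 +i* 1) * (4%:C) ^+ k) = ext_scale * (seeley k)%:C.
Proof.
rewrite -/(den k) /ext_coef /pre /ext_scale; move: (den0 k) kappa0.
by move: (den k) kappa => d l d0 l0; field; rewrite d0 l0.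
Qed.

Definition rapid (c : nat -> 'C) := forall a : nat, exists2 S : R, 0 <= S &
  forall n, \sum_(k < n) rnorm (c k) * 4 ^+ (a * k) <= S.

Lemma rapidW (c c' : nat -> 'C) (A : R) : 0 <= A ->
  (forall k, rnorm (c' k) <= A * rnorm (c k)) -> rapid c -> rapid c'.
Proof.
move=> A0 cc' rc a; have [S S0 hS] := rc a; exists (A * S) => [|n]; first exact: mulr_ge0.
apply: le_trans (ler_wpM2l A0 (hS n)); rewrite mulr_sumr; apply: ler_sum => k _.
by rewrite mulrA; apply: ler_wpM2r => //; rewrite exprn_ge0.
Qed.

Lemma rapid_scale (c : nat -> 'C) : rapid c -> rapid (fun k => c k * (4%:C) ^+ k).
Proof.
move=> rc a; have [S S0 hS] := rc a.+1; exists S => // n.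
apply: le_trans (hS n); apply: ler_sum => k _.
by rewrite rnormM rnormX rnormC ger0_norm// -mulrA -exprD.
Qed.

Lemma rapid_seeley : rapid (fun k => (seeley k)%:C).
Proof.
move=> a; have [S hS] := seeley_summable a; exists S.
  by apply: le_trans (hS 0%N); rewrite big_ord0.
by move=> n; apply: le_trans (hS n); apply: ler_sum => k _; rewrite rnormC.
Qed.

Lemma rapid_ext_coef : rapid ext_coef.
Proof.
apply: (rapidW (rnorm_ge0 kappa^-1)) rapid_seeley => k.
rewrite /ext_coef rnormM mulrC; apply: ler_wpM2l; first exact: rnorm_ge0.
by rewrite rnormC; exact: pre_le.
Qed.

End seeley.

(** * The extension operators *)

Section rapid_series.
Context (R : realType).
Local Notation "'C" := R[i].
Implicit Types (c u v : nat -> 'C).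

Lemma is_csumB u v (l l' : 'C) : is_csum u l -> is_csum v l' ->
  is_csum (fun k => u k - v k) (l - l').
Proof.
move=> ul /(is_csumZ (-1)) vl; rewrite -[- l']mulN1r.
have := is_csumD ul vl; congr (is_csum _ _).
by apply/funext => k; rewrite mulN1r.
Qed.

(** [S] depends on [c] and [a] only, not on the summands: hence operator bounds whose constants do
    not depend on the function extended. *)
Lemma rapid_csum c (a : nat) : rapid c -> exists2 S : R, 0 <= S &
  forall u (B : R), 0 <= B -> (forall k, rnorm (u k) <= B * 4 ^+ (a * k)) ->
    is_csum (fun k => c k * u k) (csum (fun k => c k * u k)) /\
    forall l, is_csum (fun k => c k * u k) l -> rnorm l <= S * B.
Proof.
move=> /(_ a)[S S0 hS]; exists S => // u B B0 uB.
have key n : \sum_(k < n) rnorm (c k * u k) <= S * B.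
  apply: le_trans (ler_wpM2r B0 (hS n)); rewrite mulr_suml; apply: ler_sum => k _.
  rewrite rnormM -mulrA [4 ^+ _ * B]mulrC; apply: ler_wpM2l; first exact: rnorm_ge0.
  exact: uB.
split=> [|l ul]; first exact: csumP key.
by apply: is_csum_le ul _ => n; apply: le_trans (ler_rnorm_sum _ _ _) (key n).
Qed.

End rapid_series.

Section spread.
Context (R : realType) (m : nat) (j : 'I_m).
Local Notation Z := ('rV[R]_m * 'rV[R]_m)%type.
Local Notation "'C" := R[i].
Implicit Types (c : nat -> 'C) (F : Z -> 'C) (z v x : Z).
Local Notation e := (re_dir R j).

(** A real-linear shear that moves Re z_j only. For F independent of Im z_j, composing with it
    amounts to evaluating F at x_j + 4^k y_j. *)
Definition spread k z : Z := z + (4 ^+ k * z.2 0 j) *: e.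

Lemma spread_lin k x v (h : R) : spread k (h *: v + x) = h *: spread k v + spread k x.
Proof.
rewrite /spread /= !mxE scalerDr scalerA mulrDr scalerDl addrACA.
by rewrite [in RHS]mulrCA.
Qed.

Lemma continuous_coord2 : continuous (fun z : Z => z.2 0 j).
Proof.
move=> z; apply: (@continuous_comp _ _ _ snd (fun y : 'rV[R]_m => y 0 j)).
  exact: cvg_snd.
exact: coord_continuous.
Qed.

Lemma continuous_coord1 : continuous (fun z : Z => z.1 0 j).
Proof.
move=> z; apply: (@continuous_comp _ _ _ fst (fun y : 'rV[R]_m => y 0 j)).
  exact: cvg_fst.
exact: coord_continuous.
Qed.

Lemma normr_re_dir : `|e| <= 1.
Proof.
rewrite prod_normE /= normr0 ge_max ler01 andbT; apply: normr_row_le => // i.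
by rewrite mxE /=; case: eqP; rewrite ?normr1 ?normr0.
Qed.

Lemma spread_dist k z x : `|spread k z - spread k x| <= 2 * `|z - x| * 4 ^+ k.
Proof.
have -> : spread k z - spread k x = (z - x) + (4 ^+ k * (z - x).2 0 j) *: e.
  by rewrite /spread /= !mxE mulrBr scalerBl opprD addrACA.
apply: le_trans (ler_normD _ _) _; rewrite normrZ normrM (_ : `|4 ^+ k| = 4 ^+ k); last first.
  by rewrite ger0_norm// exprn_ge0.
have h1 : 1 <= 4 ^+ k :> R by rewrite exprn_ege1// ler1n.
rewrite mulrDl mul1r [leRHS]mulrDl; apply: lerD; first by rewrite ler_peMr.
apply: (@le_trans _ _ (4 ^+ k * `|z - x| * 1)); last by rewrite mulr1 mulrC.
apply: ler_pM; rewrite ?normr_ge0//; last exact: normr_re_dir.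
apply: ler_wpM2l; first by rewrite exprn_ge0.
by apply: le_trans (normr_row_coord _ _) _; rewrite prod_normE le_max lexx orbT.
Qed.

Definition extend c F z : 'C := csum (fun k => c k * F (spread k z)).

Lemma extend_csum c F z : rapid c -> bsmooth F ->
  is_csum (fun k => c k * F (spread k z)) (extend c F z).
Proof.
move=> rc bF; have [M M0 FM] := bsmooth_bounded bF; have [S S0 hS] := rapid_csum 0 rc.
by have [] := hS (fun k => F (spread k z)) M M0 (fun k => le_trans (FM _) (eq_ler (esym (mulr1 M)))).
Qed.

Lemma extend_le c : rapid c -> exists2 S : R, 0 <= S & forall F z (B : R), bsmooth F ->
  0 <= B -> (forall k, rnorm (F (spread k z)) <= B) -> rnorm (extend c F z) <= S * B.
Proof.
move=> rc; have [S S0 hS] := rapid_csum 0 rc; exists S => // F z B bF B0 FB.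
have [|_] := hS (fun k => F (spread k z)) B B0; first by move=> k; rewrite mulr1; exact: FB.
by apply; exact: extend_csum.
Qed.

(** What matters is the growth of the constant in [s]: with s = 4^k y it is O(4^(2k)), which rapidly
    decreasing coefficients absorb. *)
Lemma quad_line F v : bsmooth F -> exists2 M : R, 0 <= M & forall (s h : R) x,
  rnorm (F (h *: (v + s *: e) + x) - F x - h%:C * cderive (v + s *: e) F x) <=
    M * (1 + `|s|) ^+ 2 * h ^+ 2.
Proof.
move=> bF; pose D w := cderive w F.
have bD w : bsmooth (D w) by exact: bsmooth_cderive.
have [M1 M10 h1] := bsmooth_bounded (bsmooth_cderive v (bD v)).
have [M2 M20 h2] := bsmooth_bounded (bsmooth_cderive v (bD e)).
have [M3 M30 h3] := bsmooth_bounded (bsmooth_cderive e (bD v)).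
have [M4 M40 h4] := bsmooth_bounded (bsmooth_cderive e (bD e)).
exists (2 * (M1 + M2 + M3 + M4)) => [|s h x]; first by rewrite mulr_ge0// !addr_ge0.
pose w := v + s *: e.
have dw u y : rnorm (cderive u (D w) y) <=
    rnorm (cderive u (D v) y) + `|s| * rnorm (cderive u (D e) y).
  have -> : D w = fun y => D v y + s%:C * D e y by apply/funext => t; exact: cderive_lin.
  rewrite cderiveD//; last exact: bsmoothZ.
  rewrite cderiveZ//; apply: le_trans (ler_rnormD _ _) _.
  by rewrite rnormM rnormC.
rewrite -[2 * _ * _]mulrA.
apply: (mean_value_quad (dg := D w) (d2g := cderive w (D w))) => [y|y|y].
- exact: bsmooth_is_cderive.
- exact: bsmooth_is_cderive.
rewrite {1}/w cderive_lin//; apply: le_trans (ler_rnormD _ _) _; rewrite rnormM rnormC.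
have s0 : 0 <= `|s| by [].
apply: le_trans (lerD (dw v y) (ler_wpM2l s0 (dw e y))) _.
apply: (le_trans (lerD (lerD (h1 y) (ler_wpM2l s0 (h2 y)))
  (ler_wpM2l s0 (lerD (h3 y) (ler_wpM2l s0 (h4 y)))))).
have sM k M : 0 <= M -> 0 <= `|s| ^+ k * M :> R by move=> ?; rewrite mulr_ge0// exprn_ge0.
rewrite -subr_ge0.
have -> : (M1 + M2 + M3 + M4) * (1 + `|s|) ^+ 2 - (M1 + `|s| * M2 + `|s| * (M3 + `|s| * M4)) =
   2 * (`|s| ^+ 1 * M1) + `|s| ^+ 2 * M1 + M2 + `|s| ^+ 1 * M2 + `|s| ^+ 2 * M2 +
   M3 + `|s| ^+ 1 * M3 + `|s| ^+ 2 * M3 + M4 + 2 * (`|s| ^+ 1 * M4) by ring.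
by rewrite !addr_ge0// ?mulr_ge0// ?sM// exprn_ge0.
Qed.

(** Differentiation under the sum. The shear sends [v] to v + 4^k v_y e, and the quadratic
    remainders of the terms, O(4^(2k) h^2), sum to O(h^2); no uniform convergence of differentiated
    series is examined. *)
Lemma extend_is_cderive c F z v : rapid c -> bsmooth F ->
  is_cderive (extend c F) z v (extend c (cderive v F) z +
    (v.2 0 j)%:C * extend (fun k => c k * 4%:C ^+ k) (cderive e F) z).
Proof.
move=> rc bF; have [M M0 hM] := quad_line v bF; have [S S0 hS] := rapid_csum 2 rc.
set y := v.2 0 j; pose A := M * (1 + `|y|) ^+ 2.
have A0 : 0 <= A by rewrite mulr_ge0// exprn_ge0// addr_ge0.
have bv := bsmooth_cderive v bF; have be := bsmooth_cderive e bF.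
apply: (@is_cderive_quad _ _ _ _ _ _ (S * A)) => h.
pose u k := F (spread k (h *: v + z)) - F (spread k z) -
  h%:C * cderive (v + (4 ^+ k * y) *: e) F (spread k z).
have [|_] := hS u (A * h ^+ 2) (mulr_ge0 A0 (sqr_ge0 _)).
  move=> k; rewrite /u spread_lin.
  apply: le_trans (hM (4 ^+ k * y) h (spread k z)) _.
  rewrite [leRHS]mulrAC; apply: ler_wpM2r; first exact: sqr_ge0.
  rewrite /A -mulrA; apply: ler_wpM2l => //; rewrite [(2 * k)%N]mulnC exprM -exprMn.
  apply: ler_wXn2r; first by rewrite addr_ge0.
  have h1 : 1 <= 4 ^+ k :> R by rewrite exprn_ege1// ler1n.
  rewrite normrM ger0_norm ?exprn_ge0// mulrDl mul1r [leRHS]addrC addrC.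
  by apply: lerD => //; rewrite mulrC.
rewrite -[S * A * _]mulrA; apply.
have s1 := is_csumB (extend_csum (h *: v + z) rc bF) (extend_csum z rc bF).
have s2 := is_csumZ h%:C (is_csumD (extend_csum z rc bv)
  (is_csumZ y%:C (extend_csum z (rapid_scale rc) be))).
have := is_csumB s1 s2; congr (is_csum _ _); apply/funext => k.
rewrite /u cderive_lin// rmorphM rmorphXn /=.
move: (F _) (F _) (cderive v F _) (cderive e F _) (c k) (4%:C ^+ k) (y%:C) (h%:C).
by move=> a1 a2 a3 a4 a5 a6 a7 a8; ring.
Qed.

Lemma cderive_extend c F z v : rapid c -> bsmooth F ->
  cderive v (extend c F) z = extend c (cderive v F) z +
    (v.2 0 j)%:C * extend (fun k => c k * 4%:C ^+ k) (cderive e F) z.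
Proof. by move=> rc bF; apply: cderive_val; exact: extend_is_cderive. Qed.

Lemma extend_ccontinuous c F : rapid c -> bsmooth F -> ccontinuous (extend c F).
Proof.
move=> rc bF; have [K K0 hK] := bsmooth_lipschitz_dist bF; have [S S0 hS] := rapid_csum 1 rc.
have lip z x : rnorm (extend c F z - extend c F x) <= S * (K * 2) * `|z - x|.
  have KB0 : 0 <= K * 2 * `|z - x| by rewrite !mulr_ge0.
  have [|_] := hS (fun k => F (spread k z) - F (spread k x)) _ KB0.
    move=> k; apply: le_trans (hK _ _) _; rewrite mul1n -!mulrA; apply: ler_wpM2l => //.
    by rewrite mulrA; exact: spread_dist.
  rewrite -[S * (K * 2) * _]mulrA; apply.
  have := is_csumB (extend_csum z rc bF) (extend_csum x rc bF).
  by congr (is_csum _ _); apply/funext => k; rewrite mulrBr.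
have cont (u : Z -> R) : (forall z x, `|u z - u x| <= S * (K * 2) * `|z - x|) -> continuous u.
  move=> hu z; apply/cvgrPdist_le => d d0; pose L := S * (K * 2) + 1.
  have L0 : 0 < L by rewrite ltr_wpDl// !mulr_ge0.
  have : \forall x \near z, `|z - x| <= d / L.
    by have /cvgrPdist_le := @cvg_id _ (nbhs z); apply; rewrite divr_gt0.
  apply: filterS => x zx; apply: le_trans (hu _ _) _.
  apply: (@le_trans _ _ (L * (d / L))); last by rewrite mulrC divfK// gt_eqF.
  by apply: ler_pM; rewrite ?mulr_ge0// lerDl.
split; apply: cont => z x; apply: le_trans (lip z x).
  by rewrite -raddfB; exact: ge_rnorm_Re.
by rewrite -raddfB; exact: ge_rnorm_Im.
Qed.

(** The induction on the order runs over all rapid [c] at once, because a derivative replaces c_k by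
    c_k 4^k. *)
Lemma extend_bsmooth c F : rapid c -> bsmooth F -> bsmooth (extend c F).
Proof.
move=> rc bF n; elim: n c F rc bF => [|n IH] c F rc bF; split => //.
all: try exact: extend_ccontinuous.
all: try by have [M M0 FM] := bsmooth_bounded bF; have [S S0 hS] := extend_le rc;
  exists (S * M) => x; exact: hS.
move=> v; split=> [x|].
  by rewrite cderive_extend//; exact: extend_is_cderive.
rewrite (funext (fun z => @cderive_extend c F z v rc bF)).
apply: bcnD; first by apply: IH => //; exact: bsmooth_cderive.
apply: bcnM; first exact: bcn_cst.
by apply: IH; [exact: rapid_scale|exact: bsmooth_cderive].
Qed.

End spread.

(** * Almost holomorphic extension in one variable *)

Section almost_holomorphic_extension.
Context (R : realType) (m : nat) (j : 'I_m).
Local Notation Z := ('rV[R]_m * 'rV[R]_m)%type.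
Local Notation "'C" := R[i].
Implicit Types (c : nat -> 'C) (F : Z -> 'C) (z v x : Z).
Local Notation e := (re_dir R j).
Local Notation f := (im_dir R j).

Lemma re_dir1E i : (re_dir R i).1 0 j = (i == j)%:R.
Proof. by rewrite mxE eqxx eq_sym. Qed.

Lemma re_dir2E i : (re_dir R i).2 0 j = 0.
Proof. by rewrite mxE. Qed.

Lemma im_dir1E i : (im_dir R i).1 0 j = 0.
Proof. by rewrite mxE. Qed.

Lemma im_dir2E i : (im_dir R i).2 0 j = (i == j)%:R.
Proof. by rewrite mxE eqxx eq_sym. Qed.

Lemma spread_real k z : z.2 0 j = 0 -> spread j k z = z.
Proof. by move=> z0; rewrite /spread z0 mulr0 scale0r addr0. Qed.

Lemma extend_real c F z (l : 'C) : z.2 0 j = 0 -> is_csum c l -> extend j c F z = l * F z.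
Proof.
move=> z0 cl; apply: is_csumE; rewrite mulrC.
have := is_csumZ (F z) cl; congr (is_csum _ _).
by apply/funext => k; rewrite spread_real// mulrC.
Qed.

Lemma extend0 c z : rapid c -> extend j c (fun=> 0) z = 0.
Proof.
move=> rc; apply: is_csumE.
have := is_csumZ 0 (extend_csum j z rc (bsmooth_cst Z 0)); rewrite mul0r.
by congr (is_csum _ _); apply/funext => k; rewrite mul0r mulr0.
Qed.

Lemma cderive_im_extend c F z : rapid c -> bsmooth F -> cderive f F = (fun=> 0) ->
  cderive f (extend j c F) z = extend j (fun k => c k * 4%:C ^+ k) (cderive e F) z.
Proof.
by move=> rc bF fF; rewrite cderive_extend// fF extend0// im_dir2E eqxx mul1r add0r.
Qed.

Lemma cderive_comm0 v w F : bsmooth F -> cderive v F = (fun=> 0) ->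
  cderive v (cderive w F) = (fun=> 0).
Proof.
by move=> bF vF; apply/funext => z; rewrite cderiveC// vF cderive_cst.
Qed.

(* The moment conditions make the first [N] derivatives of [extend c F] along
   [f] vanish on the real points: each such derivative falls on [F] along [e]
   and multiplies [c] by [4^k]. *)
Lemma extend_flat N c : rapid c -> exists2 S : R, 0 <= S & forall F z (B : R),
  bsmooth F -> cderive f F = (fun=> 0) -> 0 <= B ->
  (forall a, (a < N)%N -> is_csum (fun k => c k * 4%:C ^+ (a * k)) 0 \/
     iter a (cderive e) F (z - z.2 0 j *: f) = 0) ->
  (forall s t : R, rnorm (iter N (cderive e) F (z + s *: e + t *: f)) <= B) ->
  rnorm (extend j c F z) <= S * `|z.2 0 j| ^+ N * B.
Proof.
elim: N c => [|N IH] c rc.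
  have [S S0 hS] := extend_le j rc; exists S => // F z B bF _ B0 _ FB.
  rewrite expr0 mulr1; apply: hS => // k.
  by have := FB (4 ^+ k * z.2 0 j) 0; rewrite scale0r addr0.
have [S S0 hS] := IH _ (rapid_scale rc).
exists (2 * S) => [|F z B bF fF B0 Fz FB]; first by rewrite mulr_ge0.
(* [z0] is z with its j-th imaginary part removed. The series vanishes there, so the mean value
   theorem from [z0] to z trades one derivative for one power of |y_j|, at the cost of the factor
   2. *)
set y := z.2 0 j; pose z0 := z - y *: f.
have y0 : z0.2 0 j = 0.
  by rewrite /z0 [LHS]mxE [X in _ + X]mxE /= [X in _ - X]mxE mxE !eqxx mulr1 subrr.
have yt (t : R) : (t *: f + z0).2 0 j = t.
  by rewrite [LHS]mxE y0 addr0 /= mxE mxE !eqxx mulr1.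
(* At [z0] all the shears are trivial and the series is (sum_k c_k) F(z0); either alternative of the
   hypothesis at a = 0 makes it 0. *)
have E0 : extend j c F z0 = 0.
  have [|c0|F0] := Fz 0%N; first by [].
    rewrite (@extend_real _ _ _ 0) ?mul0r//; move: c0; congr (is_csum _ _).
    by apply/funext => k; rewrite mul0n expr0 mulr1.
  apply: is_csumE; have := is_csumZ 0 (extend_csum j z0 rc bF); rewrite mul0r.
  congr (is_csum _ _); apply/funext => k; rewrite mul0r spread_real//.
  by rewrite [F z0]F0 mulr0.
have be := bsmooth_cderive e bF; have b' := extend_bsmooth j rc bF.
have -> : extend j c F z = extend j c F (y *: f + z0) - extend j c F z0.
  by rewrite E0 subr0 /z0 addrC subrK.
have -> : 2 * S * `|y| ^+ N.+1 * B = 2 * (S * `|y| ^+ N * B) * `|y|.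
  by rewrite exprSr; ring.
apply: (mean_value (fun x => bsmooth_is_cderive x f b')) => t ty.
rewrite cderive_im_extend//.
apply: (@le_trans _ _ (S * `|t| ^+ N * B)); last first.
  by apply: ler_wpM2r => //; apply: ler_wpM2l => //; exact: ler_wXn2r.
rewrite -{2}(yt t); apply: hS => //; first exact: cderive_comm0.
- move=> a aN; have [c0|F0] := Fz a.+1 aN; [left|right].
    move: c0; congr (is_csum _ _).
    by apply/funext => k; rewrite mulSn exprD mulrA.
  by rewrite yt addrC addKr -iterSr.
- move=> s u; rewrite -iterSr.
  have -> : t *: f + z0 + s *: e + u *: f = z + s *: e + (u + t - y) *: f.
    by rewrite /z0 !scalerBl scalerDl !addrA [RHS](ACl (4*1*5*2*3)).
  exact: FB.
Qed.

Variable M : R.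

(** It depends on z_j alone, so that derivatives in the other variables pass through. The plateau
    extends to M + 1, beyond the support of F: where its derivative in Re z_j lives, F and its
    derivatives vanish at the real projection. *)
Definition ext_cutoff z : 'C := (plateau (M + 1) (z.1 0 j))%:C * (plateau 1 (z.2 0 j))%:C.

Lemma ext_cutoff_bsmooth : bsmooth ext_cutoff.
Proof.
apply: bsmoothM.
  apply: (@bsmooth_affine R Z R^o (fun t : R^o => (plateau (M + 1) t)%:C)
    (fun z => z.1 0 j) (fun z => z.1 0 j)) (bsmooth_plateau _).
    by move=> x v h; rewrite /= !mxE.
  exact: continuous_coord1.
apply: (@bsmooth_affine R Z R^o (fun t : R^o => (plateau 1 t)%:C)
  (fun z => z.2 0 j) (fun z => z.2 0 j)) (bsmooth_plateau _).
  by move=> x v h; rewrite /= !mxE.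
exact: continuous_coord2.
Qed.

Lemma ext_cutoff1 z : `|z.1 0 j| <= M + 1 -> `|z.2 0 j| <= 1 -> ext_cutoff z = 1.
Proof. by move=> h1 h2; rewrite /ext_cutoff !plateau1// mulr1. Qed.

Lemma ext_cutoff0 z : M + 2 <= `|z.1 0 j| \/ 2 <= `|z.2 0 j| -> ext_cutoff z = 0.
Proof.
case=> h; rewrite /ext_cutoff; first by rewrite plateau0 ?mul0r// -addrA.
by rewrite [X in _ * X%:C]plateau0 ?mulr0.
Qed.

Lemma cderive_ext_cutoff0 v z : v.1 0 j = 0 -> v.2 0 j = 0 -> cderive v ext_cutoff z = 0.
Proof.
move=> v1 v2; apply: cderive_val; apply: (@is_cderive_quad _ _ _ _ _ _ 0) => h.
rewrite mulr0 subr0 mul0r.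
suff -> : ext_cutoff (h *: v + z) = ext_cutoff z by rewrite subrr rnorm0.
by rewrite /ext_cutoff /= !mxE v1 v2 mulr0 !add0r.
Qed.

Lemma dbar_ext_cutoff0 z : `|z.1 0 j| < M + 1 -> `|z.2 0 j| < 1 -> dbar j ext_cutoff z = 0.
Proof.
move=> z1 z2.
have n1 : \forall x \near z, `|(x : Z).1 0 j| < M + 1.
  have /cvgr_norm_lt := @continuous_coord1 R m j z; exact.
have n2 : \forall x \near z, `|(x : Z).2 0 j| < 1.
  have /cvgr_norm_lt := @continuous_coord2 R m j z; exact.
have n : \forall x \near z, ext_cutoff x - 1 = 0.
  by near=> x; rewrite ext_cutoff1 ?subrr// ltW//; near: x.
have d0 v : cderive v ext_cutoff z = 0.
  have := cderive_near0 v n; rewrite cderiveB ?cderive_cst ?subr0//.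
    exact: ext_cutoff_bsmooth.
  exact: bsmooth_cst.
by rewrite /dbar !d0 mulr0 addr0 mulr0.
Unshelve. all: by end_near. Qed.

Definition smooth_ext F z : 'C := ext_cutoff z * extend j (@ext_coef R) F z.

Lemma smooth_ext_bsmooth F : bsmooth F -> bsmooth (smooth_ext F).
Proof.
move=> bF; apply: bsmoothM; first exact: ext_cutoff_bsmooth.
by apply: extend_bsmooth => //; exact: rapid_ext_coef.
Qed.

Lemma smooth_ext_real F z : z.2 0 j = 0 -> (M < `|z.1 0 j| -> F z = 0) ->
  smooth_ext F z = F z.
Proof.
move=> z2 Fz; rewrite /smooth_ext (extend_real F z2 (@ext_coef_sum R)) mul1r.
have [z1|/Fz ->] := leP `|z.1 0 j| M; last by rewrite mulr0.
by rewrite ext_cutoff1 ?mul1r// ?z2 ?normr0// (le_trans z1)// lerDl.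
Qed.

Lemma cderive_smooth_ext v F : bsmooth F -> v.1 0 j = 0 -> v.2 0 j = 0 ->
  cderive v (smooth_ext F) = smooth_ext (cderive v F).
Proof.
move=> bF v1 v2; have rc := @rapid_ext_coef R; apply/funext => z.
rewrite cderiveM; [|exact: ext_cutoff_bsmooth|exact: extend_bsmooth].
by rewrite cderive_ext_cutoff0// mul0r add0r cderive_extend// v2 mul0r addr0.
Qed.

Lemma smooth_ext_lin (a b : 'C) F G z : bsmooth F -> bsmooth G ->
  smooth_ext (fun z => a * (F z + b * G z)) z = a * (smooth_ext F z + b * smooth_ext G z).
Proof.
move=> bF bG; have rc := @rapid_ext_coef R; rewrite /smooth_ext.
have -> : extend j (@ext_coef R) (fun z => a * (F z + b * G z)) z =
    a * (extend j (@ext_coef R) F z + b * extend j (@ext_coef R) G z).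
  apply: is_csumE; have := is_csumZ a (is_csumD (extend_csum j z rc bF)
    (is_csumZ b (extend_csum j z rc bG))).
  congr (is_csum _ _); apply/funext => k; move: (F _) (G _) (ext_coef R k) => p q r.
  by ring.
move: (extend _ _ _ _) (extend _ _ _ _) (ext_cutoff z) => p q r.
by ring.
Qed.

Lemma dbar_smooth_ext i F : bsmooth F -> i != j ->
  dbar i (smooth_ext F) = smooth_ext (dbar i F).
Proof.
move=> bF ij; have bre := bsmooth_cderive (re_dir R i) bF.
have bim := bsmooth_cderive (im_dir R i) bF; apply/funext => z.
rewrite [RHS](smooth_ext_lin 2^-1 (0 +i* 1) z bre bim) {1}/dbar.
rewrite (cderive_smooth_ext bF); [|by rewrite re_dir1E (negbTE ij)|exact: re_dir2E].
rewrite (cderive_smooth_ext bF); [|exact: im_dir1E|by rewrite im_dir2E (negbTE ij)].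
reflexivity.
Qed.

Lemma smooth_ext_le : exists2 S : R, 0 <= S & forall F z (B : R), bsmooth F -> 0 <= B ->
  (forall s : R, rnorm (F (z + s *: e)) <= B) -> rnorm (smooth_ext F z) <= S * B.
Proof.
have [S S0 hS] := extend_le j (@rapid_ext_coef R).
have [K K0 hK] := bsmooth_bounded ext_cutoff_bsmooth.
exists (K * S) => [|F z B bF B0 FB]; first exact: mulr_ge0.
rewrite rnormM -mulrA; apply: ler_pM; rewrite ?rnorm_ge0//.
by apply: hS => // k; exact: FB.
Qed.

Lemma smooth_ext_eq0 F z : (forall k, F (spread j k z) = 0) -> smooth_ext F z = 0.
Proof.
move=> F0; rewrite /smooth_ext /extend (_ : (fun k => _) = fun=> 0).
  by rewrite (@is_csumE _ _ 0) ?mulr0// => d d0; exists 0%N => n _;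
    rewrite big1// subrr rnorm0 ltW.
by apply/funext => k; rewrite F0 mulr0.
Qed.

(** F does not depend on Im z_j, so each term depends on Im z_j through the shear alone, and d/dx +
    i d/dy multiplies its coefficient by 1 + i 4^k. *)
Lemma dbar_extend F z : bsmooth F -> cderive f F = (fun=> 0) ->
  dbar j (extend j (@ext_coef R) F) z =
  2^-1 * (ext_scale R * extend j (fun k => (seeley R k)%:C) (cderive e F) z).
Proof.
move=> bF fF; have rc := @rapid_ext_coef R; rewrite /dbar cderive_im_extend//.
rewrite cderive_extend// re_dir2E mul0r addr0; congr (_ * _).
have be := bsmooth_cderive e bF.
apply: is_csum_unique (is_csumD (extend_csum j z rc be)
  (is_csumZ (0 +i* 1) (extend_csum j z (rapid_scale rc) be))) _.
have := is_csumZ (ext_scale R) (extend_csum j z (@rapid_seeley R) be).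
congr (is_csum _ _); apply/funext => k; rewrite mulrA -ext_coef_dbar.
move: (cderive _ _ _) (ext_coef R k) (0 +i* 1) (4%:C ^+ k) => a b c d.
by ring.
Qed.

Lemma cderive_vanish (U : set Z) F v : open U -> (forall z, U z -> F z = 0) ->
  forall z, U z -> cderive v F z = 0.
Proof.
move=> oU F0 z Uz; apply: cderive_near0.
by apply: filterS (open_nbhs_nbhs (conj oU Uz)) => x; exact: F0.
Qed.

(** In the product rule, the term with dbar of the series is flat by the vanishing moments. The term
    with dbar of the cutoff is nonzero only for |y_j| >= 1, where |y_j|^N >= 1 and nothing is to be
    gained, or for |x_j| >= M + 1, where [extend_flat] applies by its other alternative, the
    derivatives of F vanishing at the projected point. *)
Lemma dbar_smooth_ext_bound N : exists2 K : R, 0 <= K & forall F z (B : R),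
  bsmooth F -> cderive f F = (fun=> 0) -> (forall x, M < `|x.1 0 j| -> F x = 0) -> 0 <= B ->
  (forall a, (a <= N.+1)%N -> forall s t : R,
     rnorm (iter a (cderive e) F (z + s *: e + t *: f)) <= B) ->
  rnorm (dbar j (smooth_ext F) z) <= K * `|z.2 0 j| ^+ N * B.
Proof.
have rc := @rapid_ext_coef R; have bc := ext_cutoff_bsmooth.
have [S S0 hS] := extend_flat N rc; have [S1 S10 hS1] := extend_flat 0 rc.
have [S2 S20 hS2] := extend_flat N (@rapid_seeley R).
have [K K0 hK] := bsmooth_bounded bc; have [D D0 hD] := bsmooth_bounded (dbar_bsmooth j bc).
exists (D * (S + S1) + K * (rnorm (2^-1 * ext_scale R) * S2)) => [|F z B bF fF F0 B0 FB].
  by rewrite addr_ge0// !mulr_ge0// ?addr_ge0// rnorm_ge0.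
set y := `|z.2 0 j| ^+ N; have y0 : 0 <= y by rewrite exprn_ge0.
have Dyb : 0 <= D * (S + S1) * y * B by rewrite !mulr_ge0// addr_ge0.
rewrite dbarM//; last exact: extend_bsmooth.
rewrite !mulrDl; apply: le_trans (ler_rnormD _ _) _; apply: lerD.
  have [y1|y1] := leP 1 `|z.2 0 j|.
    rewrite rnormM -!mulrA; apply: ler_pM; rewrite ?rnorm_ge0//.
    apply: (@le_trans _ _ (S1 * B)).
      rewrite -[S1]mulr1 -(expr0 `|z.2 0 j|); apply: hS1 => // s t.
      by apply: (FB 0%N).
    rewrite mulrDl ler_wpDl//; first by rewrite !mulr_ge0.
    apply: ler_wpM2l => //; rewrite ler_peMl// /y exprn_ege1//.
  have [x1|x1] := leP (M + 1) `|z.1 0 j|; last first.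
    by rewrite dbar_ext_cutoff0// mul0r rnorm0.
  rewrite rnormM -!mulrA; apply: ler_pM; rewrite ?rnorm_ge0//.
  rewrite mulrDl ler_wpDr//; first by rewrite !mulr_ge0.
  rewrite mulrA; apply: hS => //; last by move=> s t; apply: FB; exact: leqnSn.
  move=> a _; right; have oU : open [set x : Z | M < `|x.1 0 j|].
    rewrite openE => x /= Mx; have /cvgr_norm_gt := @continuous_coord1 R m j x; exact.
  have h b : forall x, M < `|x.1 0 j| -> iter b (cderive e) F x = 0.
    elim: b => // b IHb x Mx; exact: (cderive_vanish e oU IHb).
  apply: h; rewrite /= !mxE mulr0 subr0; apply: lt_le_trans x1; rewrite ltrDl//.
rewrite rnormM -!mulrA; apply: ler_pM; rewrite ?rnorm_ge0//.
rewrite dbar_extend// [X in rnorm X]mulrA [leLHS]rnormM.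
apply: ler_wpM2l; first exact: rnorm_ge0.
rewrite mulrA; apply: hS2 => //.
- exact: bsmooth_cderive.
- exact: cderive_comm0.
- by move=> a _; left; exact: seeley_moment.
- by move=> s t; rewrite -iterSr; apply: FB.
Qed.

End almost_holomorphic_extension.

(** * Iteration over the variables *)

Section iterated_extension.
Context (R : realType) (m : nat) (M : R).
Local Notation Z := ('rV[R]_m * 'rV[R]_m)%type.
Local Notation "'C" := R[i].
Implicit Types (F : Z -> 'C) (f : 'rV[R]_m -> 'C) (z v : Z) (s l : seq 'I_m).

Lemma spread_coord1 (i j : 'I_m) k z : i != j -> (spread j k z).1 0 i = z.1 0 i.
Proof. by move=> ij; rewrite mxE /= !mxE (negbTE ij) mulr0 addr0. Qed.

Lemma spread_coord2 (i j : 'I_m) k z : (spread j k z).2 0 i = z.2 0 i.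
Proof. by rewrite mxE /= !mxE mulr0 addr0. Qed.

(** The invariant kept for the variables still to be treated; it supplies the two hypotheses on F in
    [dbar_smooth_ext_bound]. *)
Definition unextended j F :=
  cderive (im_dir R j) F = (fun=> 0) /\ forall z, M < `|z.1 0 j| -> F z = 0.

Lemma unextended_cderive j v F : bsmooth F -> unextended j F -> unextended j (cderive v F).
Proof.
move=> bF [F1 F2]; split; first exact: cderive_comm0.
apply: (@cderive_vanish _ _ [set z : Z | M < `|z.1 0 j|]) F2.
rewrite openE => x /= Mx; have /cvgr_norm_gt := @continuous_coord1 R m j x; exact.
Qed.

Lemma unextended_foldr_cderive j (vs : seq Z) F : bsmooth F -> unextended j F ->
  unextended j (foldr (@cderive R Z) F vs).
Proof.
move=> bF uF; elim: vs => //= v vs; apply: unextended_cderive.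
exact: bsmooth_foldr.
Qed.

Lemma unextended_dbar j i F : bsmooth F -> unextended j F -> unextended j (dbar i F).
Proof.
move=> bF uF; have [_ a2] := unextended_cderive (re_dir R i) bF uF.
have [_ b2] := unextended_cderive (im_dir R i) bF uF; have [u1 _] := uF; split.
  rewrite cderive_dbarC// u1; apply/funext => z.
  by rewrite /dbar !cderive_cst mulr0 addr0 mulr0.
by move=> z Mz; rewrite /dbar a2// b2// mulr0 addr0 mulr0.
Qed.

Lemma unextended_smooth_ext j i F : bsmooth F -> i != j -> unextended j F ->
  unextended j (smooth_ext i M F).
Proof.
move=> bF ij [u1 u2]; split; last first.
  move=> z Mz; apply: smooth_ext_eq0 => k; apply: u2.
  by rewrite spread_coord1// eq_sym.
rewrite cderive_smooth_ext// ?im_dir1E// ?im_dir2E; last first.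
  by rewrite eq_sym (negbTE ij).
by rewrite u1; apply/funext => z; exact: smooth_ext_eq0.
Qed.

Definition iter_ext s F := foldr (fun j => smooth_ext j M) F s.

Lemma iter_ext_bsmooth s F : bsmooth F -> bsmooth (iter_ext s F).
Proof. by move=> bF; elim: s => //= j s; exact: smooth_ext_bsmooth. Qed.

Lemma unextended_iter_ext s j F : bsmooth F -> j \notin s -> unextended j F ->
  unextended j (iter_ext s F).
Proof.
move=> bF + uF; elim: s => //= i s IH; rewrite inE negb_or => /andP[ji js].
apply: unextended_smooth_ext; [exact: iter_ext_bsmooth|by rewrite eq_sym|exact: IH].
Qed.

Lemma unextended_foldr_dbar s j F : bsmooth F -> unextended j F ->
  unextended j (foldr (@dbar R m) F s).
Proof.
move=> bF uF; elim: s => //= i s; apply: unextended_dbar; exact: dbar_foldr_bsmooth.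
Qed.

Lemma iter_ext_real s F x : uniq s -> bsmooth F -> (forall j, unextended j F) ->
  iter_ext s F (x, 0) = F (x, 0).
Proof.
move=> + bF uF; elim: s => //= j s IH /andP[js us].
rewrite smooth_ext_real ?IH//; first by rewrite mxE.
by have [_] := uF j; apply.
Qed.

Lemma iter_ext_eq0 s F z i : i \in s -> M + 2 < `|z.1 0 i| \/ 2 < `|z.2 0 i| ->
  iter_ext s F z = 0.
Proof.
elim: s z => //= j s IH z; rewrite inE; have [<- _|ij /= si] := eqVneq i j => zi.
  by rewrite /smooth_ext ext_cutoff0 ?mul0r//; case: zi => /ltW; [left|right].
by apply: smooth_ext_eq0 => k; apply: IH => //; rewrite spread_coord1// spread_coord2.
Qed.

Lemma iter_ext_ball_supported F : 0 <= M ->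
  ball_supported (M + 2) (iter_ext (enum 'I_m) F).
Proof.
move=> M0 z Mz; apply: contrapT => z0.
have small i : `|z.1 0 i| <= M + 2 /\ `|z.2 0 i| <= 2.
  split; rewrite leNgt; apply/negP => zi; apply: z0.
    by apply: (@iter_ext_eq0 _ _ _ i); [rewrite mem_enum|left].
  by apply: (@iter_ext_eq0 _ _ _ i); [rewrite mem_enum|right].
have M20 : 0 <= M + 2 by rewrite addr_ge0.
move: Mz; rewrite ltNge => /negP; apply; rewrite prod_normE ge_max.
apply/andP; split; apply: normr_row_le => // i; first by case: (small i).
by apply: le_trans (small i).2 _; rewrite lerDr.
Qed.

(** For the outermost variable the one-variable bound applies, the derivatives of the inner function
    being bounded. For an inner variable j, dbar_j passes through the outer extension, whose shears
    leave Im z_j unchanged, so flatness in j survives. *)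
Lemma iter_ext_flat s F j : uniq s -> bsmooth F -> (forall j, unextended j F) ->
  j \in s -> flat j (dbar j (iter_ext s F)).
Proof.
move=> + bF uF; elim: s => //= i s IH /andP[is_ us].
have bG := iter_ext_bsmooth s bF; move: IH is_; rewrite inE.
have uG : i \notin s -> unextended i (iter_ext s F).
  by move=> is_; exact: unextended_iter_ext.
move: (iter_ext s F) bG uG => G bG uG IH is_.
have [-> _ N|ji /= js N] := eqVneq j i.
  have [K K0 hK] := @dbar_smooth_ext_bound R m i M N.
  have /choice[A hA] : forall a, exists A : R, 0 <= A /\
      forall z, rnorm (iter a (cderive (re_dir R i)) G z) <= A.
    move=> a; have bi : bsmooth (iter a (cderive (re_dir R i)) G).
      by elim: a => //= a; exact: bsmooth_cderive.
    by have [A ? ?] := bsmooth_bounded bi; exists A.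
  have A0 : 0 <= \sum_(a < N.+2) A a by apply: sumr_ge0 => a _; case: (hA a).
  have [u1 u2] := uG is_.
  exists (K * \sum_(a < N.+2) A a) => [|z]; first exact: mulr_ge0.
  rewrite mulrAC; apply: hK => // a aN s' t.
  apply: le_trans ((hA a).2 _) _; rewrite (bigD1 (Ordinal (aN : (a < N.+2)%N)))//= lerDl.
  by apply: sumr_ge0 => b _; case: (hA b).
rewrite dbar_smooth_ext//; have [S S0 hS] := @smooth_ext_le R m i M.
have [K K0 hK] := IH us js N; exists (S * K) => [|z]; first exact: mulr_ge0.
rewrite -mulrA; apply: hS => [||t].
- exact: dbar_bsmooth.
- by rewrite mulr_ge0// exprn_ge0.
have := hK (z + t *: re_dir R i).
by rewrite /= !mxE mulr0 addr0.
Qed.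

Lemma foldr_dbar_smooth_ext s j F : bsmooth F -> j \notin s ->
  foldr (@dbar R m) (smooth_ext j M F) s = smooth_ext j M (foldr (@dbar R m) F s).
Proof.
move=> bF; elim: s => //= i s IH; rewrite inE negb_or => /andP[ji js].
rewrite IH// dbar_smooth_ext//; first exact: dbar_foldr_bsmooth.
by rewrite eq_sym.
Qed.

Lemma foldr_cderive_smooth_ext l j F : bsmooth F -> j \notin l ->
  foldr (@cderive R Z) (smooth_ext j M F) (map (@re_dir R m) l) =
  smooth_ext j M (foldr (@cderive R Z) F (map (@re_dir R m) l)).
Proof.
move=> bF; elim: l => //= i l IH; rewrite inE negb_or => /andP[ji jl].
rewrite IH// cderive_smooth_ext ?re_dir2E// ?re_dir1E; first exact: bsmooth_foldr.
by rewrite eq_sym (negbTE ji).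
Qed.

Lemma foldr_cderive_dbar (vs : seq Z) j F : bsmooth F ->
  foldr (@cderive R Z) (dbar j F) vs = dbar j (foldr (@cderive R Z) F vs).
Proof.
move=> bF; elim: vs => //= v vs ->; rewrite cderive_dbarC//; exact: bsmooth_foldr.
Qed.

(** The list [l] holds the real derivatives waiting in front of the extensions in [s]. Treating a
    variable j adds at most N + 1 derivatives along e_j; they commute with the remaining extensions
    because j is not among them, and reach F in the end. This accounts for the total L + (N + 1)
    size s. *)
Lemma iter_ext_bound s (N L : nat) : uniq s -> exists2 K : R, 0 <= K &
  forall F l (p : R) z, bsmooth F -> (forall j, unextended j F) -> 0 <= p ->
  (size l <= L)%N -> (forall j, j \in l -> j \notin s) ->
  (forall l' x, (size l' <= L + size s * N.+1)%N ->
     rnorm (foldr (@cderive R Z) F (map (@re_dir R m) l') x) <= p) ->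
  rnorm (foldr (@cderive R Z) (foldr (@dbar R m) (iter_ext s F) s)
    (map (@re_dir R m) l) z) <= K * \prod_(j <- s) `|z.2 0 j| ^+ N * p.
Proof.
elim: s L => [|j s IH] L /=.
  move=> _; exists 1 => // F l p z bF uF p0 lL _ Fp; rewrite big_nil !mul1r.
  by apply: Fp; rewrite addn0.
move=> /andP[js us]; have [K K0 hK] := IH (L + N.+1)%N us.
have [D D0 hD] := @dbar_smooth_ext_bound R m j M N.
exists (D * K) => [|F l p z bF uF p0 lL ls Fp]; first exact: mulr_ge0.
have jl : j \notin l by apply/negP => /ls; rewrite inE eqxx.
have bE := iter_ext_bsmooth s bF; have bG := dbar_foldr_bsmooth s bE.
rewrite foldr_dbar_smooth_ext// foldr_cderive_dbar; last exact: smooth_ext_bsmooth.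
rewrite foldr_cderive_smooth_ext//; set G := foldr _ _ s in bG *.
have bH := bsmooth_foldr (map (@re_dir R m) l) bG.
have [u1 u2] : unextended j (foldr (@cderive R Z) G (map (@re_dir R m) l)).
  apply: unextended_foldr_cderive => //; apply: unextended_foldr_dbar => //.
  exact: unextended_iter_ext.
have P0 : 0 <= \prod_(i <- s) `|z.2 0 i| ^+ N.
  by elim: (s) => [|i r IHr]; rewrite ?big_nil// big_cons mulr_ge0// exprn_ge0.
rewrite big_cons (_ : D * K * _ * p =
    D * `|z.2 0 j| ^+ N * (K * \prod_(i <- s) `|z.2 0 i| ^+ N * p)); last by ring.
apply: hD => // [|a aN t t']; first by rewrite !mulr_ge0.
have -> : iter a (cderive (re_dir R j)) (foldr (@cderive R Z) G (map (@re_dir R m) l)) =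
    foldr (@cderive R Z) G (map (@re_dir R m) (nseq a j ++ l)).
  by elim: a {aN} => //= a ->.
set w := z + _ + _.
have -> : \prod_(i <- s) `|z.2 0 i| ^+ N = \prod_(i <- s) `|w.2 0 i| ^+ N.
  rewrite !big_seq; apply: eq_bigr => i si.
  have ij : i == j = false by apply/negbTE; apply: contra js => /eqP <-.
  by rewrite /w /= !mxE ij !mulr0 !addr0.
apply: hK => //.
- by rewrite size_cat size_nseq addnC leq_add.
- move=> i; rewrite mem_cat => /orP[|/ls]; first by move=> /nseqP[->].
  by rewrite inE negb_or => /andP[].
- by move=> l' x l's; apply: Fp; rewrite mulSn addnA.
Qed.

End iterated_extension.

Section real_functions.
Context (R : realType) (m : nat).
Local Notation Z := ('rV[R]_m * 'rV[R]_m)%type.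
Local Notation "'C" := R[i].
Implicit Types (f : 'rV[R]_m -> 'C).

Definition real_ext f (z : Z) : 'C := f z.1.

Lemma real_ext_bsmooth f : bsmooth f -> bsmooth (real_ext f).
Proof.
move=> bf; apply: (@bsmooth_affine R Z _ f fst fst) bf => // z.
exact: cvg_fst.
Qed.

Lemma cderive_real_ext f v : bsmooth f -> cderive v (real_ext f) = real_ext (cderive v.1 f).
Proof.
by move=> bf; apply/funext => z; exact: (@cderive_affine R Z _ f fst fst).
Qed.

Lemma foldr_cderive_real_ext f (vs : seq Z) : bsmooth f ->
  foldr (@cderive R Z) (real_ext f) vs =
  real_ext (foldr (@cderive R 'rV[R]_m) f (map fst vs)).
Proof.
move=> bf; elim: vs => //= v vs ->; rewrite cderive_real_ext//.
exact: bsmooth_foldr.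
Qed.

Lemma real_ext_unextended M f j : bsmooth f -> ball_supported M f ->
  unextended M j (real_ext f).
Proof.
move=> bf fM; split=> [|z Mz]; last first.
  by apply: fM; apply: lt_le_trans Mz _; exact: normr_row_coord.
by rewrite cderive_real_ext//; apply/funext => z; exact: cderive0v.
Qed.

Definition extension M f : Z -> 'C := iter_ext M (enum 'I_m) (real_ext f).

Lemma extension_special M f : 0 <= M -> bsmooth f -> ball_supported M f ->
  special_extension f (extension M f).
Proof.
move=> M0 bf fM; have br := real_ext_bsmooth bf.
have ur j := real_ext_unextended j bf fM; have be := iter_ext_bsmooth M (enum 'I_m) br.
split=> [|x|j N].
- split; first exact: bsmooth_smooth.
  exact: ball_supported_compact (iter_ext_ball_supported _ M0).
- by rewrite /extension iter_ext_real// enum_uniq.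
have je : j \in enum 'I_m by rewrite mem_enum.
by have [K K0 hK] := iter_ext_flat (enum_uniq _) br ur je N; exists K.
Qed.

Lemma extension_bound M N : exists2 K : R, 0 <= K & forall f (p : R) z,
  bsmooth f -> ball_supported M f -> 0 <= p ->
  (forall l x, (size l <= m * N.+1)%N ->
     rnorm (foldr (@cderive R 'rV[R]_m) f [seq delta_mx 0 j | j <- l] x) <= p) ->
  rnorm (foldr (@dbar R m) (extension M f) (enum 'I_m) z) <= K * p * prod_im z ^+ N.
Proof.
have [K K0 hK] := iter_ext_bound M N 0 (enum_uniq 'I_m).
exists K => // f p z bf fM p0 fp; have br := real_ext_bsmooth bf.
have := hK (real_ext f) [::] p z br (fun j => real_ext_unextended j bf fM) p0.
rewrite /= big_enum /= prodrXl mulrAC; apply => // l x.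
rewrite add0n size_enum_ord foldr_cderive_real_ext// -map_comp; exact: fp.
Qed.

End real_functions.

(** * The functional calculus *)

Section seminorms.
Context (R : realType) (m : nat).
Local Notation "'C" := R[i].
Local Notation V := ('rV[R]_m).
Implicit Types (f : V -> 'C) (l : seq 'I_m).

(** Lists of indices fit the induction on the variables; the seminorms use multi-indices, and
    [partials_pderiv] translates by counting occurrences, the order being immaterial. *)
Definition partials f l := foldr (@cderive R V) f [seq delta_mx 0 j | j <- l].

Lemma partials_bsmooth f l : bsmooth f -> bsmooth (partials f l).
Proof. exact: bsmooth_foldr. Qed.

Lemma partials_cat f l l' : partials f (l ++ l') = partials (partials f l') l.
Proof. by rewrite /partials map_cat foldr_cat. Qed.

Lemma partials_perm f l l' : bsmooth f -> perm_eq l l' -> partials f l = partials f l'.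
Proof.
move=> bf; apply: catCA_perm_subst => l1 l2 l3.
have swap j l4 g : bsmooth g -> partials (cderive (delta_mx 0 j) g) l4 =
    cderive (delta_mx 0 j) (partials g l4).
  by move=> bg; apply/funext => x; rewrite /partials cderive_foldrC.
have comm g : bsmooth g -> partials (partials g l2) l1 = partials (partials g l1) l2.
  move=> bg; elim: l2 => //= j l5 IH.
  rewrite -[partials g (j :: l5)]/(cderive _ (partials g l5)).
  by rewrite swap ?IH//; exact: partials_bsmooth.
by rewrite !partials_cat comm//; exact: partials_bsmooth.
Qed.

Lemma pderivE (al : 'I_m -> nat) f :
  pderiv al f = partials f (flatten [seq nseq (al j) j | j <- enum 'I_m]).
Proof.
rewrite /pderiv; elim: (enum 'I_m) => //= j l ->; rewrite partials_cat.
by elim: (al j) => //= a ->.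
Qed.

Lemma partials_pderiv f l : bsmooth f -> partials f l = pderiv (fun j => count_mem j l) f.
Proof.
move=> bf; rewrite pderivE; apply: partials_perm => //.
apply/allP => j _ /=; apply/eqP; rewrite count_flatten -map_comp sumnE big_map big_enum /=.
rewrite (bigD1 j)//= count_nseq /= eqxx mul1n big1 ?addn0// => i /negbTE ij.
by rewrite count_nseq /= ij.
Qed.

Lemma sum_count_mem l : (\sum_j count_mem j l = size l)%N.
Proof.
elim: l => [|j l IH] /=; first by rewrite big1.
rewrite big_split /= IH (bigD1 j)//= eqxx big1 ?addn0// => i.
by rewrite eq_sym => /negbTE ->.
Qed.

Lemma partials_le_seminorm (K : set V) (N : nat) f l x : compact K -> bsmooth f ->
  csupport f `<=` K -> (size l <= N)%N -> rnorm (partials f l x) <= seminorm_sum K N f.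
Proof.
move=> cK bf fK lN;
  pose u (al : {ffun 'I_m -> 'I_N.+1}) y := rnorm (pderiv (fun j => al j : nat) f y).
have bal (al : {ffun 'I_m -> 'I_N.+1}) : bsmooth (pderiv (fun j => al j : nat) f).
  by rewrite pderivE; exact: partials_bsmooth.
have ub al y : K y -> u al y <= sup [set u al x | x in K].
  move=> Ky; apply: ub_le_sup; last by exists y.
  have [M _ hM] := ccontinuous_compact_bounded (bsmooth_continuous (bal al)) cK.
  by exists M => _ [z Kz <-]; exact: hM.
have s0 al : 0 <= sup [set u al x | x in K].
  (* The supremum over an empty K is 0 by convention. *)
  have [->|/set0P[y Ky]] := eqVneq K set0; first by rewrite image_set0 sup0.
  exact: le_trans (rnorm_ge0 _) (ub al y Ky).
have p0 : 0 <= seminorm_sum K N f by apply: sumr_ge0 => al _; exact: s0.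
have [Kx|Kx] := pselect (K x); last first.
  rewrite csupport0 ?rnorm0// => /csupport_foldr /fK; exact: Kx.
have cl j : (count_mem j l < N.+1)%N by rewrite ltnS (leq_trans (count_size _ _)).
pose al : {ffun 'I_m -> 'I_N.+1} := [ffun j => Ordinal (cl j)].
have alE : (fun j => al j : nat) = (fun j => count_mem j l).
  by apply/funext => j; rewrite ffunE.
have -> : rnorm (partials f l x) = u al x by rewrite /u alE partials_pderiv.
apply: le_trans (ub al x Kx) _; rewrite /seminorm_sum (bigD1 al)/=;
  last by under eq_bigr do rewrite ffunE; rewrite sum_count_mem.
by rewrite lerDl; apply: sumr_ge0 => be _; exact: s0.
Qed.

End seminorms.

(** * Independence of the extension, and the seminorm estimate *)

Section assembly.
Context (R : realType) (m : nat) (B : completeNormedModType R[i]).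
Context (P : 'I_m -> operator B).
Local Notation Z := ('rV[R]_m * 'rV[R]_m)%type.
Local Notation "'C" := R[i].
Local Notation mu := (lebesgueCm R m).
Hypothesis m0 : (0 < m)%N.
Hypothesis rP : forall j, real_spectrum (P j).
Hypothesis tP : forall j, locally_temperate_resolvent (P j).
Implicit Types (f g : 'rV[R]_m -> 'C) (ft gt : Z -> 'C).

Let Phi ft z : bop B := foldr (@dbar R m) ft (enum 'I_m) z *: res_prod P z.

Lemma integrandE ft : integrand P ft = Phi ft \o @tup_point R m.
Proof.
apply/funext => t; rewrite /integrand /Phi /= /res_prod; congr (_ *: _).
by apply: eq_bigr => j _; rewrite !mxE.
Qed.

Lemma special_extension_flat f ft : special_extension f ft ->
  bsmooth ft /\ forall j, flat j (dbar j ft).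
Proof.
move=> [tft _ dft]; split=> [|j N]; first exact: test_function_bsmooth.
have [C hC] := dft j N; exists `|C| => // z; apply: le_trans (hC z) _.
by apply: ler_wpM2r (ler_norm _); rewrite exprn_ge0.
Qed.

Lemma special_prod_im_bounded f ft : special_extension f ft ->
  prod_im_bounded (foldr (@dbar R m) ft (enum 'I_m)).
Proof.
move=> /special_extension_flat[bft fft]; apply: flat_prod_im => // j.
by apply: flat_dbar_foldr => //; rewrite mem_enum.
Qed.

Lemma ball_supported_le (V : normedModType R) (M M' : R) (h : V -> 'C) : M <= M' ->
  ball_supported M h -> ball_supported M' h.
Proof. by move=> MM hM x M'x; apply: hM; exact: le_lt_trans M'x. Qed.

Lemma ball_supported_lin (V : normedModType R) (M : R) (a : 'C) (h k : V -> 'C) :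
  ball_supported M h -> ball_supported M k -> ball_supported M (fun x => a * h x + k x).
Proof. by move=> hM kM x Mx; rewrite hM// kM// mulr0 addr0. Qed.

Lemma special_extension_lin f g ft gt (a : 'C) :
  special_extension f ft -> special_extension g gt ->
  special_extension (fun x => a * f x + g x) (fun z => a * ft z + gt z).
Proof.
move=> sf sg; have [bf ff] := special_extension_flat sf.
have [bg fg] := special_extension_flat sg.
have [tf rf _] := sf; have [tg rg _] := sg.
have [M M0 fM] := test_function_ball tf; have [N N0 gN] := test_function_ball tg.
have bh : bsmooth (fun z => a * ft z + gt z) by apply: bsmoothD => //; exact: bsmoothZ.
split=> [|x|j k].
- split; first exact: bsmooth_smooth.
  apply: (@ball_supported_compact _ _ (M + N)); apply: ball_supported_lin.
    by apply: ball_supported_le fM; rewrite lerDl ltW.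
  by apply: ball_supported_le gN; rewrite lerDr ltW.
- by rewrite rf rg.
have [K K0 hK] := flatD (flatZ a (ff j)) (fg j) k; exists K => z.
by rewrite dbarD ?dbarZ//; exact: bsmoothZ.
Qed.

Lemma riemann_sum_lin (M n : nat) (a : 'C) ft gt : bsmooth ft -> bsmooth gt ->
  riemann_sum M n (Phi (fun z => a * ft z + gt z)) =
  a *: riemann_sum M n (Phi ft) + riemann_sum M n (Phi gt).
Proof.
move=> bf bg; rewrite -riemann_sumZ -riemann_sumD; congr riemann_sum.
apply/funext => z; rewrite /Phi dbar_foldr_lin//.
by rewrite scalerDl scalerA.
Qed.

Lemma special_riemann f ft (M0 : R) (M : nat) : special_extension f ft -> 0 <= M0 ->
  ball_supported M0 ft -> M0 + 1 <= M%:R ->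
  exists I : bop B, [/\ (fun n => riemann_sum M n (Phi ft)) @ \oo --> I,
    has_bochner_integral mu (integrand P ft) I &
    bochner_integral mu (integrand P ft) = I].
Proof.
move=> sf M00 fM MM; rewrite integrandE;
  apply: (weighted_res_prod_bochner m0 rP tP (M0 := M0)) => //.
- by apply: dbar_foldr_bsmooth; case: (special_extension_flat sf).
- exact: ball_supported_dbar_foldr.
- exact: special_prod_im_bounded sf.
Qed.

Lemma special_ball f g ft gt : special_extension f ft -> special_extension g gt ->
  exists (M0 : R) (M : nat), [/\ 0 <= M0, M0 + 1 <= M%:R,
    ball_supported M0 ft & ball_supported M0 gt].
Proof.
move=> [tf _ _] [tg _ _].
have [M MM fM] := test_function_ball tf; have [N NN gN] := test_function_ball tg.
have h : 0 <= M + N + 1 by rewrite !addr_ge0// ltW.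
exists (M + N), (Num.bound (M + N + 1)); split.
- by rewrite addr_ge0// ltW.
- by rewrite ltW// archi_boundP.
- by apply: ball_supported_le fM; rewrite lerDl ltW.
- by apply: ball_supported_le gN; rewrite lerDr ltW.
Qed.

Lemma bochner_integrable_special f ft : special_extension f ft ->
  bochner_integrable mu (integrand P ft).
Proof.
move=> sf; have [M0 [M [M00 MM fM _]]] := special_ball sf sf.
by have [I [_ hI _]] := special_riemann sf M00 fM MM; exists I.
Qed.

(** All three integrals are limits of Riemann sums on one common box, so linearity is that of finite
    sums together with uniqueness of limits. *)
Lemma calculus_integral_lin f g ft gt (a : 'C) :
  special_extension f ft -> special_extension g gt ->
  calculus_integral P (fun z => a * ft z + gt z) =
  a *: calculus_integral P ft + calculus_integral P gt.
Proof.
move=> sf sg; have [M0 [M [M00 MM fM gM]]] := special_ball sf sg.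
have [I [cI _ eI]] := special_riemann sf M00 fM MM.
have [J [cJ _ eJ]] := special_riemann sg M00 gM MM.
have hM := ball_supported_lin a fM gM.
have [K [cK _ eK]] := special_riemann (special_extension_lin a sf sg) M00 hM MM.
rewrite /calculus_integral eI eJ eK.
suff -> : K = a *: I + J by rewrite scalerDr !scalerA [_ * a]mulrC.
have [bf _] := special_extension_flat sf; have [bg _] := special_extension_flat sg.
have cS : (fun n => a *: riemann_sum M n (Phi ft) + riemann_sum M n (Phi gt)) @ \oo -->
    a *: I + J by apply: cvgD cJ; exact: cvgZl_tmp.
rewrite -(funext (fun n => riemann_sum_lin M n a bf bg)) in cS.
exact: (cvg_unique _ cK cS).
Qed.

(** The difference of the two extensions is a special extension of -f + f, which is 0 at the real
    points. It is therefore flat there, and [riemann_limit_eq0] gives the value 0. *)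
Lemma calculus_integral_eq f ft gt : special_extension f ft -> special_extension f gt ->
  calculus_integral P ft = calculus_integral P gt.
Proof.
move=> sf sg; have sh := special_extension_lin (- 1) sg sf.
have [bh fh] := special_extension_flat sh; have [_ h0 _] := sh.
have [M0 [M [M00 MM hM _]]] := special_ball sh sh.
have [I [cI _ eI]] := special_riemann sh M00 hM MM.
have I0 : I = 0.
  apply: (riemann_limit_eq0 rP tP M00 bh hM MM _ (special_prod_im_bounded sh) cI).
  apply: real_flat_bound => //; apply: dbar_flat_real_flat => // x.
  by rewrite h0 mulN1r addNr.
have := calculus_integral_lin (- 1) sg sf.
rewrite {1}/calculus_integral eI I0 scaler0 scaleN1r addrC => /esym/eqP.
by rewrite subr_eq0 => /eqP.
Qed.

Lemma calculusE f ft : special_extension f ft -> calculus P f = calculus_integral P ft.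
Proof.
move=> sf; rewrite /calculus; case: xgetP => [T -> [gt sg <-]|/(_ (calculus_integral P ft))].
  exact: calculus_integral_eq sg sf.
by move=> h; exfalso; apply: h; exists ft.
Qed.

Lemma calculus_lin (a : 'C) f g : test_function f -> test_function g ->
  calculus P (fun x => a * f x + g x) = a *: calculus P f + calculus P g.
Proof.
have ext h : test_function h -> exists ht, special_extension h ht.
  move=> th; have [M M0 hM] := test_function_ball th; exists (extension M h).
  by apply: extension_special => //; [exact: ltW|exact: test_function_bsmooth].
move=> /ext[ft sf] /ext[gt sg]; rewrite (calculusE sf) (calculusE sg).
rewrite -(calculus_integral_lin a sf sg); apply: calculusE.
exact: special_extension_lin.
Qed.

(** The constants are fixed in this order: K gives the radius M, the extensions live in the ball of
    radius M + 2, this ball fixes the power N demanded by the resolvents, and N fixes the number m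
    (N + 1) of derivatives of f. The bound holds for every Riemann sum and passes to the limit. *)
Lemma calculus_bound (K : set 'rV[R]_m) : compact K -> exists (C : R) (N : nat), 0 <= C /\
  forall f, test_function f -> csupport f `<=` K ->
    opnorm (calculus P f) <= C * seminorm_sum K N f.
Proof.
move=> cK; have [M00 hK] := compact_bounded cK.
pose M : R := `|M00| + 1; have M_ge0 : 0 <= M by rewrite addr_ge0.
have KM x : K x -> `|x| <= M.
  by move=> Kx; case: hK => _ /(_ M); apply => //; rewrite (le_lt_trans (ler_norm _))// ltrDl.
have M20 : 0 <= M + 2 by rewrite addr_ge0.
have [A [N [A0 hA]]] := weighted_res_prod_bounded m0 tP M20.
have [D D0 hD] := @extension_bound R m M N.
have b0 : 0 <= M + 2 + 1 by rewrite addr_ge0.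
pose L := Num.bound (M + 2 + 1); have ML : M + 2 + 1 <= L%:R by rewrite ltW// archi_boundP.
pose c : 'C := (- (pi^-1)%:C) ^+ m.
have V0 : 0 <= ((2 * L%:R) ^+ 2) ^+ m :> R by rewrite !exprn_ge0// mulr_ge0.
exists (rnorm c * (((2 * L%:R) ^+ 2) ^+ m * (D * A))), (m * N.+1)%N; split.
  by rewrite !mulr_ge0// rnorm_ge0.
move=> f tf fK; have bf := test_function_bsmooth tf.
have fM : ball_supported M f.
  move=> x Mx; apply: csupport0 => /fK /KM; rewrite leNgt Mx//.
have sf := extension_special M_ge0 bf fM.
have [bE _] := special_extension_flat sf.
have sE : ball_supported (M + 2) (extension M f) by exact: iter_ext_ball_supported.
have [I [cI _ eI]] := special_riemann sf M20 sE ML.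
rewrite (calculusE sf) /calculus_integral eI -rnorm_bop rnormZ -mulrA.
apply: ler_wpM2l; first exact: rnorm_ge0.
set p := seminorm_sum _ _ _.
have fp l x : (size l <= m * N.+1)%N -> rnorm (partials f l x) <= p.
  by move=> lN; exact: partials_le_seminorm.
have p0 : 0 <= p by apply: le_trans (fp [::] 0 _); rewrite ?rnorm_ge0.
have Phile z : rnorm (Phi (extension M f) z) <= D * p * A.
  apply: hA; [exact: mulr_ge0|exact: ball_supported_dbar_foldr|].
  by move=> z'; exact: hD.
rewrite -[I]subr0; apply: (rnorm_cvg_le (N := 0%N) cI) => n _; rewrite subr0.
have -> : ((2 * L%:R) ^+ 2) ^+ m * (D * A) * p = ((2 * L%:R) ^+ 2) ^+ m * (D * p * A) by ring.
by apply: riemann_sum_le => k.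
Qed.

End assembly.

Theorem mainTheorem1 (R : realType) (m : nat) (B : completeNormedModType R[i])
    (P : 'I_m -> operator B) :
  (1 <= m)%N ->
  (forall j, densely_defined (P j)) ->
  (forall j, closed_operator (P j)) ->
  (forall j, real_spectrum (P j)) ->
  (forall j, locally_temperate_resolvent (P j)) ->
  [/\ (forall f ft, test_function f -> special_extension f ft ->
         bochner_integrable (lebesgueCm R m) (integrand P ft)),
      (forall f ft1 ft2, test_function f ->
         special_extension f ft1 -> special_extension f ft2 ->
         calculus_integral P ft1 = calculus_integral P ft2),
      (forall K : set 'rV[R]_m, compact K -> exists (C : R) (N : nat), 0 <= C /\
         forall f, test_function f -> csupport f `<=` K ->
           opnorm (calculus P f) <= C * seminorm_sum K N f) &
      is_distribution (calculus P)].
Proof.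
move=> m0 _ _ rP tP; split=> [f ft _|f ft1 ft2 _|K|].
- exact: bochner_integrable_special.
- exact: calculus_integral_eq.
- exact: calculus_bound.
- split=> [a f g|K]; first exact: calculus_lin.
  exact: calculus_bound.
Qed.
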